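(* Let $n\ge2$, let $0\le i<j\le n-1$ with $(i^2-j^2,n)=1$, and let $p=-e^{\pi\sqrt{-1}/n}=e^{(n+1)\pi\sqrt{-1}/n}$. Let $H=H_{2n^2}$ act (inner-faithfully) by $\pi_{i,j}(u,v)$ on $A=A^-=\Bbbk\langle u,v\rangle/(p^{i^2-j^2}uv-vu)$. Then the fixed subring is the commutative polynomial ring $$A^H=\begin{cases}\Bbbk[u^n+v^n,\,u^nv^n]& n\text{ odd}\\ \Bbbk[u^n+(-1)^{ij}v^n,\,u^nv^n]& n\text{ even}\end{cases}$$ (the two displayed generators being algebraically independent). Hence $H_{2n^2}$ is a reflection Hopf algebra under this action for $A^-$.
   Context: Ground field $\Bbbk=\mathbb{C}$. A connected graded algebra $A$ is AS regular of dimension $d$ if it has finite global dimension $d$, finite Gelfand–Kirillov dimension, and $\mathrm{Ext}^k_A(\Bbbk,A)=\delta_{k,d}\cdot\Bbbk(l)$ for some $l\in\mathbb{Z}$. An action of $H$ on an $H$-module algebra $A$ is inner-faithful if the only Hopf ideal $I$ of $H$ with $I\cdot A=0$ is $0$. $A^H=\{a\in A: h\cdot a=\epsilon(h)a\ \forall h\in H\}$. A semisimple Hopf algebra $H$ acting inner-faithfully and preserving the grading on an AS regular $H$-module algebra $A$ is a reflection Hopf algebra for $A$ if $A^H$ is AS regular. ''$H$ acts by $V$ on $A$'' means that $A$ is generated in degree 1, $A_1=V$ as an $H$-module, and the action is extended to $A$ by $h\cdot(ab)=\sum(h_{(1)}\cdot a)(h_{(2)}\cdot b)$. $H_{2n^2}$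 (Pansera), $n\ge2$: let $q=e^{2\pi\sqrt{-1}/n}$, $G=\langle x\rangle\times\langle y\rangle$ with $x,y$ of order $n$, $J=\frac1n\sum_{r,s=0}^{n-1}q^{-rs}x^r\otimes y^s$. $H_{2n^2}$ is generated by $\Bbbk G$ and $z$ with $zx=yz$, $zy=xz$, $z^2=\frac1n\sum_{r,s}q^{-rs}x^ry^s$; it has basis $x^ry^sz^k$ ($0\le r,s\le n-1$, $k=0,1$); $x,y$ are grouplike, $\Delta(z)=J(z\otimes z)$, $\epsilon(z)=1$, $S(z)=z$. $\pi_{i,j}(u,v)$ is the two-dimensional module with ordered basis $u,v$ and $xu=q^iu$, $xv=q^jv$, $yu=q^ju$, $yv=q^iv$, $zu=q^{ij}v$, $zv=u$. *)

(* Defs.v *)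
From HB Require Import structures.
From mathcomp Require Import all_boot all_order all_algebra.
From mathcomp Require Import all_classical all_reals all_analysis.
From mathcomp Require Import complex.
From mathcomp Require Import -(notations) monalg mpoly.

Set Implicit Arguments.
Unset Strict Implicit.
Unset Printing Implicit Defensive.

Import Order.TTheory GRing.Theory Num.Theory.

Local Open Scope classical_set_scope.
Local Open Scope ring_scope.

(** * Algebras given by generators and relations *)

Section Presentations.
Variables (k : fieldType) (I : choiceType).

(* monalg provides this algebra as an lalgType only, hence not an algType. *)
Definition free_alg : lalgType k := malg (fmonom I) k.

Definition free_gen (i : I) : free_alg := mkmalgU (fmu i) 1.

Definition generated_ideal (rels : seq free_alg) : set free_alg :=
  [set f | exists s : seq (free_alg * free_alg * free_alg),
     (forall t, t \in s -> t.1.2 \in rels)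
     /\ f = \sum_(t <- s) t.1.1 * t.1.2 * t.2].

(* A = k<I>/(rels), the class of the generator i being g i *)
Definition presented (rels : seq free_alg) (A : algType k) (g : I -> A) :=
  exists phi : {lrmorphism free_alg -> A},
    [/\ forall i, phi (free_gen i) = g i,
        forall a, exists f, phi f = a
      & forall f, phi f = 0 <-> generated_ideal rels f].

(* the span of the products of d generators *)
Definition word_span (A : algType k) (g : I -> A) (d : nat) : set A :=
  [set a | exists s : seq (k * d.-tuple I),
     a = \sum_(t <- s) t.1 *: \prod_(i <- t.2) g i].

Definition word_grading (A : algType k) (g : I -> A) (m : int) : set A :=
  match m with Posz d => word_span g d | Negz _ => [set 0] end.

End Presentations.

(** * Hopf algebras and their actions *)

Section Hopf.
Variable k : fieldType.

(* An element of U (x) V is represented by a formal sum of pure tensors; two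
   formal sums are the same tensor iff no bilinear map separates them. *)
Definition bilinear_map (U V W : lmodType k) (B : U -> V -> W) :=
  (forall u, linear (B u)) /\ (forall v, linear (B^~ v)).

Definition tensor_eq (U V : lmodType k) (s t : seq (U * V)) :=
  forall (W : lmodType k) (B : U -> V -> W), bilinear_map B ->
    \sum_(p <- s) B p.1 p.2 = \sum_(p <- t) B p.1 p.2.

Definition trilinear_map (U V W X : lmodType k) (B : U -> V -> W -> X) :=
  [/\ forall v w, linear (fun u => B u v w),
      forall u w, linear (fun v => B u v w)
    & forall u v, linear (fun w => B u v w)].

Definition tensor3_eq (U V W : lmodType k) (s t : seq (U * V * W)) :=
  forall (X : lmodType k) (B : U -> V -> W -> X), trilinear_map B ->
    \sum_(p <- s) B p.1.1 p.1.2 p.2 = \sum_(p <- t) B p.1.1 p.1.2 p.2.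

Record hopf (H : algType k) := Hopf {
  comul : H -> seq (H * H);
  counit : {lrmorphism H -> k^o};
  antipode : {linear H -> H};
  comul_linear : forall (c : k) (g h : H),
    tensor_eq (comul (c *: g + h))
              ([seq (c *: p.1, p.2) | p <- comul g] ++ comul h);
  comul1 : tensor_eq (comul 1) [:: (1, 1)];
  comulM : forall g h : H,
    tensor_eq (comul (g * h))
              [seq (p.1 * r.1, p.2 * r.2) | p <- comul g, r <- comul h];
  comulA : forall h : H,
    tensor3_eq [seq (r.1, r.2, p.2) | p <- comul h, r <- comul p.1]
               [seq (p.1, r.1, r.2) | p <- comul h, r <- comul p.2];
  counit_l : forall h : H, \sum_(p <- comul h) (counit p.1 : k) *: p.2 = h;
  counit_r : forall h : H, \sum_(p <- comul h) (counit p.2 : k) *: p.1 = h;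
  antipode_l : forall h : H,
    \sum_(p <- comul h) antipode p.1 * p.2 = (counit h : k) *: 1;
  antipode_r : forall h : H,
    \sum_(p <- comul h) p.1 * antipode p.2 = (counit h : k) *: 1
}.

Definition hopf_ideal (H : algType k) (hH : hopf H) (I : set H) :=
  [/\ I 0 /\ (forall a b, I a -> I b -> I (a + b)),
      forall a b, I a -> I (b * a) /\ I (a * b),
      forall a, I a -> exists2 s, tensor_eq (comul hH a) s
                     & forall p, p \in s -> I p.1 \/ I p.2,
      forall a, I a -> counit hH a = 0
    & forall a, I a -> I (antipode hH a)].

Definition semisimple (H : pzRingType) :=
  forall (M : lmodType H) (N : set M),
    N 0 -> (forall (h : H) a b, N a -> N b -> N (h *: a + b)) ->
    exists N' : set M,
      [/\ N' 0, forall (h : H) a b, N' a -> N' b -> N' (h *: a + b),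
          forall m, exists a b, [/\ N a, N' b & m = a + b]
        & forall m, N m -> N' m -> m = 0].

Record module_algebra (H : algType k) (hH : hopf H) (A : algType k) :=
  ModuleAlgebra {
    act :> H -> A -> A;
    act_bilinear : bilinear_map act;
    act1 : forall a, act 1 a = a;
    actM : forall g h a, act (g * h) a = act g (act h a);
    act_unit : forall h, act h 1 = (counit hH h : k) *: 1;
    act_mul : forall h a b,
      act h (a * b) = \sum_(p <- comul hH h) act p.1 a * act p.2 b
  }.

Section Fixed.
Variables (H : algType k) (hH : hopf H) (A : algType k).
Variable M : module_algebra hH A.

Definition inner_faithful :=
  forall I : set H, hopf_ideal hH I ->
    (forall h a, I h -> M h a = 0) -> forall h, I h -> h = 0.

Definition fixed : {pred A} :=
  fun a => `[< forall h, M h a = (counit hH h : k) *: a >].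

Lemma fixedP a : reflect (forall h, M h a = (counit hH h : k) *: a) (a \in fixed).
Proof. exact: asboolP. Qed.

Lemma fixed_closed : GRing.subalg_closed fixed.
Proof.
split; first by apply/fixedP => h; rewrite act_unit.
- move=> c a b /fixedP Fa /fixedP Fb; apply/fixedP => h.
  have [lin_h _] := act_bilinear M.
  by rewrite lin_h Fa Fb scalerDr !scalerA mulrC.
- move=> a b /fixedP Fa /fixedP Fb; apply/fixedP => h; rewrite act_mul.
  under eq_bigr do rewrite Fa Fb -scalerAl -scalerAr scalerA.
  rewrite -scaler_suml -[in RHS](counit_l hH h) linear_sum; congr (_ *: _).
  by apply: eq_bigr => p _; rewrite linearZ.
Qed.

HB.instance Definition _ := GRing.isSubalgClosed.Build k A fixed fixed_closed.

(* the subalgebra A^H, as an algebra of its own *)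
Record fixed_alg := FixedAlg { fixed_val : A; fixed_valP : fixed_val \in fixed }.

HB.instance Definition _ := [isSub for fixed_val].
HB.instance Definition _ := [Choice of fixed_alg by <:].
HB.instance Definition _ := [SubChoice_isSubAlgebra of fixed_alg by <:].

End Fixed.
End Hopf.

(** * AS regular algebras *)

Section HomologicalDimension.
Variable A : pzRingType.

Definition projective (P : lmodType A) :=
  forall (M N : lmodType A) (f : {linear M -> N}) (g : {linear P -> N}),
    (forall n, exists m, f m = n) -> exists h : {linear P -> M}, forall p, f (h p) = g p.

Record proj_resolution (M : lmodType A) := ProjResolution {
  res_obj : nat -> lmodType A;
  res_d : forall i, {linear res_obj i.+1 -> res_obj i};
  res_aug : {linear res_obj 0 -> M};
  res_projective : forall i, projective (res_obj i);
  res_surj : forall m, exists p, res_aug p = m;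
  res_exact0 : forall p, res_aug p = 0 <-> exists p', res_d 0 p' = p;
  res_exact : forall i p, res_d i p = 0 <-> exists p', res_d i.+1 p' = p
}.

Definition gldim_le (d : nat) :=
  forall M : lmodType A, exists Q : proj_resolution M,
    forall i, (d < i)%N -> forall p : res_obj Q i, p = 0.

Definition gldim_eq (d : nat) :=
  gldim_le d /\ forall e, gldim_le e -> (d <= e)%N.

End HomologicalDimension.

Definition graded_by (V : zmodType) (gr : int -> set V) :=
  [/\ forall m, gr m 0 /\ (forall a b, gr m a -> gr m b -> gr m (a - b)),
      forall a, exists (s : seq int) (c : int -> V),
        (forall m, gr m (c m)) /\ a = \sum_(m <- s) c m
    & forall (s : seq int) (c : int -> V), uniq s -> (forall m, gr m (c m)) ->
        \sum_(m <- s) c m = 0 -> forall m, m \in s -> c m = 0].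

Section ASRegular.
Variables (R : realType) (A : algType R[i]).
Implicit Types (gr : int -> set A) (s : seq A) (d : nat) (m l : int).

Definition connected_graded gr :=
  [/\ graded_by gr,
      forall m l a b, gr m a -> gr l b -> gr (m + l) (a * b),
      forall a, gr 0 a <-> exists c : R[i], a = c *: 1
    & forall m a, m < 0 -> gr m a -> a = 0].

Definition free_family s :=
  forall c : 'I_(size s) -> R[i],
    \sum_(i < size s) c i *: s`_i = 0 -> forall i, c i = 0.

(* the dimension of the span of s *)
Definition span_dim s : nat :=
  \max_(b : (size s).-tuple bool | `[< free_family (mask b s) >])
    size (mask b s).

(* the products of at most n factors taken from s *)
Fixpoint words s n : seq A :=
  if n is n'.+1 then words s n' ++ [seq a * b | a <- s, b <- words s n']
  else [:: 1].

Definition GKdim : \bar R :=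
  ereal_sup [set limn_esup (fun n =>
    (ln (span_dim (words s n))%:R / ln n%:R : R)%:E) | s in [set: seq A]].

Definition graded_module gr (P : lmodType A) (grP : int -> set P) :=
  graded_by grP /\ forall m l a p, gr m a -> grP l p -> grP (m + l) (a *: p).

(* T is the module k = A / A_{>0}, with basis e *)
Definition trivial_module gr (T : lmodType A) (e : T) :=
  [/\ e <> 0, forall t, exists c : R[i], t = (c *: 1 : A) *: e
    & forall m a, 0 < m -> gr m a -> a *: e = 0].

Section Ext.
Variables (gr : int -> set A) (T : lmodType A) (Q : proj_resolution T).
Variable grQ : forall i, int -> set (res_obj Q i).

(* T is placed in degree 0 *)
Definition graded_resolution :=
  [/\ forall i, graded_module gr (@grQ i),
      forall i m p, @grQ i.+1 m p -> @grQ i m (res_d Q i p)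
    & forall m p, m <> 0 -> @grQ 0 m p -> res_aug Q p = 0].

Definition hom_degree i m (f : res_obj Q i -> A) :=
  forall l p, @grQ i l p -> gr (l + m) (f p).

Definition ext_cocycle i m (f : {linear res_obj Q i -> A^o}) :=
  hom_degree m f /\ forall p, f (res_d Q i p) = 0.

Definition ext_coboundary i m : (res_obj Q i -> A) -> Prop :=
  match i return (res_obj Q i -> A) -> Prop with
  | 0 => fun f => forall p, f p = 0
  | i'.+1 => fun f => exists g : {linear res_obj Q i' -> A^o},
      hom_degree m g /\ forall p, f p = g (res_d Q i' p)
  end.

(* Ext^i_A(T, A) = 0 for i <> d, and Ext^d_A(T, A) = k(l) as a graded right
   A-module: it is spanned by the class of a cocycle b of degree - l, and is
   killed by A_{>0}. *)
Definition ext_shift d l :=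
  (forall i m (f : {linear res_obj Q i -> A^o}), i <> d ->
     ext_cocycle m f -> ext_coboundary m f)
  /\ exists b : {linear res_obj Q d -> A^o},
    [/\ ext_cocycle (- l) b /\ ~ ext_coboundary (- l) b,
        forall m (f : {linear res_obj Q d -> A^o}), m <> - l ->
          ext_cocycle m f -> ext_coboundary m f,
        forall f : {linear res_obj Q d -> A^o}, ext_cocycle (- l) f ->
          exists c : R[i], ext_coboundary (- l) (fun p => (f p : A) - c *: (b p : A))
      & forall m a, 0 < m -> gr m a ->
          ext_coboundary (m - l) (fun p => (b p : A) * a)].

End Ext.

(* Ext is computed from one graded projective resolution of the trivial module;
   by the comparison theorem the choice is immaterial. *)
Definition AS_regular gr d :=
  [/\ connected_graded gr, gldim_eq A d, (GKdim < +oo)%E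
    & exists (T : lmodType A) (e : T) (Q : proj_resolution T)
             (grQ : forall i, int -> set (res_obj Q i)) (l : int),
        [/\ trivial_module gr e, graded_resolution gr grQ
          & ext_shift gr grQ d l]].

End ASRegular.

Definition fixed_grading (k : fieldType) (H : algType k) (hH : hopf H)
    (A : algType k) (M : module_algebra hH A) (gr : int -> set A) (m : int) :
    set (fixed_alg M) :=
  [set a | gr m (fixed_val a)].

Definition reflection_hopf (R : realType) (H : algType R[i]) (hH : hopf H)
    (A : algType R[i]) (gr : int -> set A) (M : module_algebra hH A) :=
  [/\ semisimple H, exists d, AS_regular gr d, inner_faithful M,
      forall h m a, gr m a -> gr m (M h a)
    & exists d, AS_regular (fixed_grading (M := M) gr) d].

(** * The Hopf algebra H_{2n^2} and its two-dimensional modules *)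

Section Pansera.
Variable R : realType.
Local Notation k := R[i].

(* e^(t sqrt(-1)) *)
Definition expi (t : R) : k := (cos t +i* sin t)%C.

Variable n : nat.

Definition qroot : k := expi (2 * pi / n%:R).

Definition pansera_rels : seq (free_alg k 'I_3) :=
  let X := free_gen k (0 : 'I_3) in
  let Y := free_gen k (1 : 'I_3) in
  let Z := free_gen k (2 : 'I_3) in
  [:: X ^+ n - 1; Y ^+ n - 1; X * Y - Y * X; Z * X - Y * Z; Z * Y - X * Z;
      Z ^+ 2 - n%:R^-1 *: \sum_(r < n) \sum_(s < n)
        (qroot ^- (r * s)) *: (X ^+ r * Y ^+ s)].

Record pansera (H : algType k) (hH : hopf H) (x y z : H) : Prop := Pansera {
  pansera_presented : presented pansera_rels (tnth [tuple x; y; z]);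
  comul_x : tensor_eq (comul hH x) [:: (x, x)];
  comul_y : tensor_eq (comul hH y) [:: (y, y)];
  (* J (z (x) z) *)
  comul_z : tensor_eq (comul hH z)
    [seq ((n%:R^-1 * qroot ^- (r * s)) *: (x ^+ r * z), y ^+ s * z)
       | r <- iota 0 n, s <- iota 0 n];
  counit_x : counit hH x = 1;
  counit_y : counit hH y = 1;
  counit_z : counit hH z = 1;
  antipode_z : antipode hH z = z
}.

Definition acts_by_pi (H : algType k) (hH : hopf H) (x y z : H)
    (A : algType k) (M : module_algebra hH A) (i j : nat) (u v : A) :=
  [/\ M x u = qroot ^+ i *: u /\ M x v = qroot ^+ j *: v,
      M y u = qroot ^+ j *: u /\ M y v = qroot ^+ i *: v
    & M z u = qroot ^+ (i * j) *: v /\ M z v = u].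

Definition proot : k := - expi (pi / n%:R).

Definition quantum_plane_rels (c : k) : seq (free_alg k 'I_2) :=
  let U := free_gen k (0 : 'I_2) in
  let V := free_gen k (1 : 'I_2) in
  [:: c *: (U * V) - V * U].

End Pansera.

(* B = k[s, t], with s and t commuting and algebraically independent *)
Definition is_polynomial_ring (k : fieldType) (A : algType k) (B : {pred A})
    (s t : A) :=
  exists phi : {lrmorphism mpoly 2 k -> A},
    [/\ phi (mpolyX k (mnm1 (0 : 'I_2))) = s,
        phi (mpolyX k (mnm1 (1 : 'I_2))) = t,
        injective phi
      & forall a, a \in B <-> exists f, phi f = a].

(* Main.v *)
Require Import Defs.
From HB Require Import structures.
From mathcomp Require Import all_boot all_order all_algebra.
From mathcomp Require Import all_classical all_reals all_analysis.
From mathcomp Require Import complex ring lra zify.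
From mathcomp Require Import -(notations) monalg mpoly.
From mathcomp Require Import perm.

(** The algebra A is treated through one property only: for some nonzero c it
    satisfies v u = c u v, and the monomials u^i v^j form a basis. This is the
    notion qplane, and pres_qplane deduces it from the presentation; freeness
    comes from the linear forms that read off the normal form of a word.

    Fixed ring. Set U = u^n and V = v^n. The group elements x and y multiply
    u^s v^t by q^(i s + j t) and q^(j s + i t). As i^2 - j^2 is prime to n, both
    factors are 1 only if n divides s and t (weight_zero), so the elements fixed
    by x and y form the algebra generated by U and V; it is commutative because
    c^(n^2) = 1. On weight vectors the twist J in the coproduct of z is a scalar
    (act_zM), which gives z U = eps V and z V = eps U with eps = q^(i j n(n-1)/2),
    that is 1 for n odd and (-1)^(i j) for n even. Hence z acts on k[U, eps V] by
    exchanging the variables, and its fixed polynomials are the symmetric ones,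
    freely generated by U + eps V and eps U V (fixed_polynomial_ring).

    AS regularity. A quantum plane B has, for every module M, the Koszul
    resolution 0 -> B (x) M -> (B (x) M)^2 -> B (x) M -> M -> 0 over the ground
    field, whose exactness amounts to division by monic linear polynomials. It
    bounds the global dimension by 2; for M = k it gives Ext, concentrated in
    degree 2, and shows that the global dimension is not smaller (qp_gldim_ge2).
    Words of length n span a space of dimension O(n^2), so the Gelfand-Kirillov
    dimension is finite. This proves qp_AS_regular for arbitrary positive degrees
    of the generators. It applies to A with degrees (1, 1) and to A^H, which is a
    quantum plane with parameter 1 and degrees (n, 2 n).

    Reflection Hopf algebra. H is semisimple by a Maschke argument in two stages,
    for the group and then for z (pansera_semisimple). The action is faithful:
    H is spanned by 2 n^2 elements e_(a,b) and e_(a,b) z, with e_(a,b) the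
    idempotents of the group algebra, and every weight (a, b) is carried by some
    u^s v^t with s <> t (weight_surj), on which e_(a,b) and e_(b,a) z act linearly
    independently (act_faithful). In particular no nonzero Hopf ideal kills A. *)

Set Implicit Arguments.
Unset Strict Implicit.
Unset Printing Implicit Defensive.

Import Order.TTheory GRing.Theory Num.Theory.

Local Open Scope ring_scope.

(** * Monomial bases of quantum planes *)

Section QuantumPlane.
Variables (k : fieldType) (B : algType k) (u v : B) (c : k).

Definition monomial_sum (N : nat) (e : nat -> nat -> k) : B :=
  \sum_(i < N) \sum_(j < N) e i j *: (u ^+ i * v ^+ j).

(** The presentation of A enters only through this basis property. It also
    covers the fixed ring (with c = 1 and generators of degrees n and 2 n), so
    both AS regularity claims are instances of a single theorem. *)
Record qplane : Prop := QPlane {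
  qp_neq0 : c != 0;
  qp_comm : v * u = c *: (u * v);
  qp_span : forall a, exists N e, a = monomial_sum N e;
  qp_free : forall N e, monomial_sum N e = 0 ->
    forall i j, (i < N)%N -> (j < N)%N -> e i j = 0
}.

Definition in_box (V : zmodType) (N : nat) (e : nat -> nat -> V) :=
  forall i j, (N <= i)%N || (N <= j)%N -> e i j = 0.

Lemma in_box_le (V : zmodType) N N' (e : nat -> nat -> V) :
  (N <= N')%N -> in_box N e -> in_box N' e.
Proof.
move=> le_N eN i j ij; apply: eN.
by case/orP: ij => /(leq_trans le_N) ->; rewrite ?orbT.
Qed.

Lemma box_sum_widen (V W : zmodType) N N' (e : nat -> nat -> V)
    (F : nat -> nat -> V -> W) :
  (forall i j, F i j 0 = 0) -> in_box N e -> (N <= N')%N ->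
  \sum_(i < N') \sum_(j < N') F i j (e i j) = \sum_(i < N) \sum_(j < N) F i j (e i j).
Proof.
move=> F0 eN le_N.
rewrite (big_ord_widen _ (fun i => \sum_(j < N) F i j (e i j)) le_N) [RHS]big_mkcond.
apply: eq_bigr => i _; case: ifP => iN; last first.
  by apply: big1 => j _; rewrite eN ?F0 // leqNgt iN.
rewrite (big_ord_widen _ (fun j => F i j (e i j)) le_N) [RHS]big_mkcond.
apply: eq_bigr => j _; case: ifP => // jN.
by rewrite eN ?F0 // [(N <= j)%N]leqNgt jN orbT.
Qed.

(** Kronecker deltas on a square of indices, the form in which every
    coefficient extraction below is computed. *)
Lemma box_sum_delta (W : zmodType) N (F : nat -> nat -> W) i j :
  (i < N)%N -> (j < N)%N ->
  \sum_(i' < N) \sum_(j' < N) F i' j' *+ ((i' == i :> nat) && (j' == j :> nat)) = F i j.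
Proof.
move=> iN jN; rewrite (bigD1 (Ordinal iN)) //= (bigD1 (Ordinal jN)) //= !eqxx.
rewrite big1 => [|j' /negPf nj]; last by move: nj; rewrite -val_eqE /= => ->.
rewrite big1 ?addr0 // => i' /negPf ni; rewrite big1 // => j' _.
by move: ni; rewrite -val_eqE /= => ->.
Qed.

Lemma monomial_sum_eq N e e' :
  (forall i j, (i < N)%N -> (j < N)%N -> e i j = e' i j) ->
  monomial_sum N e = monomial_sum N e'.
Proof. by move=> ee; apply: eq_bigr => i _; apply: eq_bigr => j _; rewrite ee. Qed.

Lemma monomial_sum_linear N a e e' :
  monomial_sum N (fun i j => a * e i j + e' i j) =
  a *: monomial_sum N e + monomial_sum N e'.
Proof.
rewrite /monomial_sum scaler_sumr -big_split; apply: eq_bigr => i _ /=.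
rewrite scaler_sumr -big_split; apply: eq_bigr => j _ /=.
by rewrite scalerDl scalerA.
Qed.

Lemma monomial_sum_widen N N' e :
  in_box N e -> (N <= N')%N -> monomial_sum N' e = monomial_sum N e.
Proof.
move=> eN le_N.
apply: (box_sum_widen (F := fun i j x => x *: (u ^+ i * v ^+ j))) => // i j.
by rewrite scale0r.
Qed.

Lemma comm_vXu i : v * u = c *: (u * v) -> v * u ^+ i = c ^+ i *: (u ^+ i * v).
Proof.
move=> vu; elim: i => [|i IH]; first by rewrite !expr0 mulr1 mul1r scale1r.
rewrite exprS mulrA vu -scalerAl -[u * v * _]mulrA IH -scalerAr scalerA.
by rewrite mulrA -!exprS.
Qed.

Hypothesis qp : qplane.

Lemma qp_span_box (a : B) :
  exists Ne : nat * (nat -> nat -> k), in_box Ne.1 Ne.2 /\ a = monomial_sum Ne.1 Ne.2.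
Proof.
have [N [e ->]] := qp_span qp a.
exists (N, fun i j => if (i < N)%N && (j < N)%N then e i j else 0); split=> /=.
  by move=> i j; rewrite [(N <= i)%N]leqNgt [(N <= j)%N]leqNgt -negb_and => /negPf ->.
by apply: monomial_sum_eq => i j -> ->.
Qed.

(** The expansion of a in the monomial basis is chosen once; by freeness it
    depends on a only. *)
Definition qcoef_bound (a : B) : nat := (projT1 (cid (qp_span_box a))).1.
Definition qcoef (a : B) : nat -> nat -> k := (projT1 (cid (qp_span_box a))).2.

Lemma qcoef_box a : in_box (qcoef_bound a) (qcoef a).
Proof. by rewrite /qcoef_bound /qcoef; case: cid => -[N e] []. Qed.

Lemma qcoefK a N : (qcoef_bound a <= N)%N -> a = monomial_sum N (qcoef a).
Proof.
move=> /monomial_sum_widen -> //; last exact: qcoef_box.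
by rewrite /qcoef_bound /qcoef; case: cid => -[N' e] [].
Qed.

Lemma qcoef_uniq a N e : in_box N e -> a = monomial_sum N e -> qcoef a =2 e.
Proof.
move=> eN aE i j.
pose N' := maxn (maxn N (qcoef_bound a)) (maxn i j).+1.
have le1 : (N <= N')%N by rewrite /N' !leq_max leqnn.
have le2 : (qcoef_bound a <= N')%N by rewrite /N' !leq_max leqnn orbT.
have [iN jN] : (i < N')%N /\ (j < N')%N.
  by rewrite /N' !leq_max !ltnS !leq_max !leqnn !orbT.
have /(qp_free qp) : monomial_sum N' (fun i j => -1 * e i j + qcoef a i j) = 0.
  by rewrite monomial_sum_linear -qcoefK // (monomial_sum_widen eN) // -aE scaleN1r addNr.
by move=> /(_ _ _ iN jN) /eqP; rewrite mulN1r addrC subr_eq0 => /eqP.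
Qed.

Lemma qcoef_inj a b : qcoef a =2 qcoef b -> a = b.
Proof.
move=> ab; pose N := maxn (qcoef_bound a) (qcoef_bound b).
rewrite (@qcoefK a N) ?leq_maxl // (@qcoefK b N) ?leq_maxr //.
by apply: monomial_sum_eq => i j _ _; exact: ab.
Qed.

Lemma qcoef_linear l a b i j : qcoef (l *: a + b) i j = l * qcoef a i j + qcoef b i j.
Proof.
pose N := maxn (qcoef_bound a) (qcoef_bound b).
rewrite (@qcoef_uniq (l *: a + b) N (fun i j => l * qcoef a i j + qcoef b i j)) //.
- move=> i' j' ij.
  rewrite (in_box_le (leq_maxl _ (qcoef_bound b)) (@qcoef_box a)) //.
  by rewrite (in_box_le (leq_maxr (qcoef_bound a) _) (@qcoef_box b)) // mulr0 addr0.
- by rewrite monomial_sum_linear -!qcoefK ?leq_maxl ?leq_maxr.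
Qed.

Lemma qcoefD a b i j : qcoef (a + b) i j = qcoef a i j + qcoef b i j.
Proof. by rewrite -[a in LHS]scale1r qcoef_linear mul1r. Qed.

Lemma qcoef0 i j : qcoef 0 i j = 0.
Proof. by apply: (addrI (qcoef 0 i j)); rewrite -qcoefD !addr0. Qed.

Lemma qcoefZ l a i j : qcoef (l *: a) i j = l * qcoef a i j.
Proof. by rewrite -[l *: a]addr0 qcoef_linear qcoef0 addr0. Qed.

Lemma qcoef_sum I (r : seq I) (P : pred I) (F : I -> B) i j :
  qcoef (\sum_(x <- r | P x) F x) i j = \sum_(x <- r | P x) qcoef (F x) i j.
Proof. by apply: (big_morph (fun a => qcoef a i j)) => [a b|]; rewrite ?qcoefD ?qcoef0. Qed.

Lemma qcoef_monomial i j i' j' :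
  qcoef (u ^+ i * v ^+ j) i' j' = ((i' == i) && (j' == j))%:R.
Proof.
pose N := (maxn i j).+1.
have [iN jN] : (i < N)%N /\ (j < N)%N by rewrite /N !ltnS !leq_max !leqnn !orbT.
rewrite (@qcoef_uniq _ N (fun i' j' => ((i' == i) && (j' == j))%:R)) //.
  move=> i1 j1; case: eqP => [->|] //=; case: eqP => [->|] //=.
  by rewrite leqNgt iN leqNgt jN.
rewrite /monomial_sum -[LHS](box_sum_delta (fun i j => u ^+ i * v ^+ j) iN jN).
by apply: eq_bigr => i1 _; apply: eq_bigr => j1 _; rewrite scaler_nat.
Qed.

Lemma vXu i : v * u ^+ i = c ^+ i *: (u ^+ i * v).
Proof. exact: comm_vXu (qp_comm qp). Qed.

Lemma vXuX i j : v ^+ j * u ^+ i = c ^+ (i * j) *: (u ^+ i * v ^+ j).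
Proof.
elim: j => [|j IH]; first by rewrite muln0 !expr0 mulr1 mul1r scale1r.
rewrite exprS -[v * _ * _]mulrA IH -scalerAr [v * (_ * _)]mulrA vXu -scalerAl scalerA.
by rewrite -mulrA -exprS -exprD addnC -mulnS.
Qed.

(** Left multiplication by u shifts the coefficients, and left multiplication
    by v shifts them up to a power of c: all module structures below are
    checked against these two rules. *)
Lemma qcoef_u a i j : qcoef (u * a) i j = if i is i'.+1 then qcoef a i' j else 0.
Proof.
rewrite [in LHS](@qcoefK a (qcoef_bound a)) // /monomial_sum mulr_sumr qcoef_sum.
under eq_bigr do rewrite mulr_sumr qcoef_sum.
under eq_bigr do under eq_bigr do rewrite -scalerAr qcoefZ mulrA -exprS qcoef_monomial.
case: i => [|i]; first by apply: big1 => i _; apply: big1 => j' _; rewrite mulr0.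
pose N := maxn (qcoef_bound a) (maxn i j).+1.
have [iN jN] : (i < N)%N /\ (j < N)%N by rewrite /N !leq_max !ltnS !leq_max !leqnn !orbT.
rewrite -[LHS](box_sum_widen (N' := N) (F := fun i' j' x =>
  x * ((i.+1 == i'.+1) && (j == j'))%:R)) ?leq_maxl //; first last.
- exact: qcoef_box.
- by move=> *; rewrite mul0r.
rewrite -[RHS](box_sum_delta (qcoef a) iN jN).
apply: eq_bigr => i1 _; apply: eq_bigr => j1 _.
by rewrite mulr_natr eqSS [i == _]eq_sym [j == _]eq_sym.
Qed.

Lemma qcoef_v a i j :
  qcoef (v * a) i j = if j is j'.+1 then c ^+ i * qcoef a i j' else 0.
Proof.
rewrite [in LHS](@qcoefK a (qcoef_bound a)) // /monomial_sum mulr_sumr qcoef_sum.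
under eq_bigr do rewrite mulr_sumr qcoef_sum.
under eq_bigr do under eq_bigr do
  rewrite -scalerAr qcoefZ mulrA vXu -scalerAl qcoefZ -mulrA -exprS qcoef_monomial.
case: j => [|j]; first by apply: big1 => i1 _; apply: big1 => j' _; rewrite andbF !mulr0.
pose N := maxn (qcoef_bound a) (maxn i j).+1.
have [iN jN] : (i < N)%N /\ (j < N)%N by rewrite /N !leq_max !ltnS !leq_max !leqnn !orbT.
rewrite -[LHS](box_sum_widen (N' := N) (F := fun i' j' x =>
  x * (c ^+ i' * ((i == i') && (j.+1 == j'.+1))%:R))) ?leq_maxl //; first last.
- exact: qcoef_box.
- by move=> *; rewrite mul0r.
rewrite -[RHS](box_sum_delta (fun i j => c ^+ i * qcoef a i j) iN jN).
apply: eq_bigr => i1 _; apply: eq_bigr => j1 _.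
by rewrite mulrA mulr_natr eqSS [i == _]eq_sym [j == _]eq_sym [c ^+ _ * _]mulrC.
Qed.

(** Reduction of a property of all elements to the two generators. *)
Lemma qp_ind (P : B -> Prop) :
  P 1 -> (forall a, P a -> P (u * a)) -> (forall a, P a -> P (v * a)) ->
  (forall l a b, P a -> P b -> P (l *: a + b)) -> forall a, P a.
Proof.
move=> P1 Pu Pv PD a.
have P0 : P 0 by rewrite -(addNr 1) -scaleN1r; apply: PD.
rewrite (@qcoefK a (qcoef_bound a)) // /monomial_sum.
elim/big_rec: _ => // i x _ Px; rewrite -[X in X + _]scale1r; apply: (PD) => //.
elim/big_rec: _ => // j y _ Py; apply: PD => //.
elim: (nat_of_ord i) => [|i' IH]; last by rewrite exprS -mulrA; apply: Pu.
elim: (nat_of_ord j) => [|j' IH]; first by rewrite mulr1.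
by rewrite expr0 mul1r exprS; apply: Pv; rewrite expr0 mul1r in IH.
Qed.

End QuantumPlane.

(** * Finitely supported families *)

Section FinitelySupported.
Variable V : zmodType.

Definition finite_box : {pred nat -> nat -> V} :=
  fun e => `[< exists N, in_box N e >].

Lemma finite_boxP e : reflect (exists N, in_box N e) (e \in finite_box).
Proof. exact: asboolP. Qed.

Lemma finite_box_zmod : zmod_closed finite_box.
Proof.
split=> [|e f /finite_boxP[N eN] /finite_boxP[N' fN]]; apply/finite_boxP.
  by exists 0%N.
exists (maxn N N') => i j ij.
have /= := in_box_le (leq_maxl N N') eN ij; have /= := in_box_le (leq_maxr N N') fN ij.
by rewrite !fctE => -> ->; rewrite subr0.
Qed.

HB.instance Definition _ := GRing.isZmodClosed.Build _ finite_box finite_box_zmod.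

(** The coordinates of a vector of B (x) V in the basis u^i v^j of a quantum
    plane B. *)
Record fs2 := Fs2 { fs2_val : nat -> nat -> V; fs2_valP : fs2_val \in finite_box }.

HB.instance Definition _ := [isSub for fs2_val].
HB.instance Definition _ := [Choice of fs2 by <:].
HB.instance Definition _ := [SubChoice_isSubZmodule of fs2 by <:].

Definition fs2_fun (f : fs2) : nat -> nat -> V := fs2_val f.
Coercion fs2_fun : fs2 >-> Funclass.

Lemma fs2P (f g : fs2) : f =2 g -> f = g.
Proof. by move=> fg; apply: val_inj; apply/funext => i; apply/funext => j; exact: fg. Qed.

Lemma fs2_box (f : fs2) : exists N, in_box N f.
Proof. exact/finite_boxP/fs2_valP. Qed.

Lemma fs2D (f g : fs2) i j : (f + g) i j = f i j + g i j. Proof. by []. Qed.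
Lemma fs2B (f g : fs2) i j : (f - g) i j = f i j - g i j. Proof. by []. Qed.
Lemma fs2N (f : fs2) i j : (- f) i j = - f i j. Proof. by []. Qed.

Definition mkfs2 N e (eN : in_box N e) : fs2 :=
  Fs2 (introT (finite_boxP e) (ex_intro _ N eN)).

Lemma mkfs2E N e (eN : in_box N e) i j : mkfs2 eN i j = e i j. Proof. by []. Qed.

End FinitelySupported.

(** * Modules over the quantum plane *)

Section Modules.
Variables (k : fieldType) (B : algType k) (M : lmodType B).

(** Scalars act on a B-module through the unit of B. *)
Definition kscale (l : k) (m : M) : M := (l *: 1 : B) *: m.

Lemma kscaleA l l' m : kscale l (kscale l' m) = kscale (l * l') m.
Proof. by rewrite /kscale scalerA -scalerAl mul1r scalerA. Qed.
Lemma kscale1 m : kscale 1 m = m.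
Proof. by rewrite /kscale !scale1r. Qed.
Lemma kscale0 m : kscale 0 m = 0.
Proof. by rewrite /kscale !scale0r. Qed.
Lemma kscaler0 l : kscale l 0 = 0.
Proof. by rewrite /kscale scaler0. Qed.
Lemma kscaleDl l l' m : kscale (l + l') m = kscale l m + kscale l' m.
Proof. by rewrite /kscale !scalerDl. Qed.
Lemma kscaleDr l m m' : kscale l (m + m') = kscale l m + kscale l m'.
Proof. by rewrite /kscale scalerDr. Qed.
Lemma kscaleN l m : kscale l (- m) = - kscale l m.
Proof. by rewrite /kscale scalerN. Qed.
Lemma kscale_sum l I (r : seq I) (P : pred I) (F : I -> M) :
  kscale l (\sum_(x <- r | P x) F x) = \sum_(x <- r | P x) kscale l (F x).
Proof. exact: scaler_sumr. Qed.
Lemma scale_kscale (a : B) l m : a *: kscale l m = kscale l (a *: m).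
Proof. by rewrite /kscale !scalerA -scalerAr mulr1 -scalerAl mul1r. Qed.
Lemma scale_scale (l : k) (a : B) m : (l *: a) *: m = kscale l (a *: m).
Proof. by rewrite /kscale scalerA -scalerAl mul1r. Qed.

End Modules.

Section Tensor.
Variables (k : fieldType) (B : algType k) (u v : B) (c : k).
Hypothesis qp : qplane u v c.
Local Notation qcoef := (qcoef qp).

Section Action.
Variable M : lmodType B.
Implicit Types (e : nat -> nat -> M) (f : fs2 M).

(** Left multiplication by a on B (x) M in coordinates; the power of c is the
    one in v^j u^(x-i) = c^(j (x-i)) u^(x-i) v^j. *)
Definition tens_act (a : B) e x y : M :=
  \sum_(i < x.+1) \sum_(j < y.+1) kscale (qcoef a i j * c ^+ (j * (x - i))) (e (x - i) (y - j))%N.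

Lemma tens_act_linear l a b e x y :
  tens_act (l *: a + b) e x y = kscale l (tens_act a e x y) + tens_act b e x y.
Proof.
rewrite /tens_act kscale_sum -big_split; apply: eq_bigr => i _ /=.
rewrite kscale_sum -big_split; apply: eq_bigr => j _ /=.
by rewrite kscaleA -kscaleDl qcoef_linear mulrA mulrDl.
Qed.

Lemma tens_act_additive a e e' x y :
  tens_act a (e + e') x y = tens_act a e x y + tens_act a e' x y.
Proof.
rewrite /tens_act -big_split; apply: eq_bigr => i _ /=.
by rewrite -big_split; apply: eq_bigr => j _ /=; rewrite -kscaleDr.
Qed.

Lemma tens_act1 e x y : tens_act 1 e x y = e x y.
Proof.
have c1 i j : qcoef 1 i j = ((i == 0%N) && (j == 0%N))%:R.
  by rewrite -[1]mulr1 -[X in X * _](expr0 u) -[X in _ * X](expr0 v) qcoef_monomial.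
rewrite /tens_act big_ord_recl big_ord_recl /= c1 mul1r mul0n expr0 kscale1 !subn0.
rewrite !big1 ?addr0 // => i _; rewrite ?big1 // => *; by rewrite c1 /= ?andbF mul0r kscale0.
Qed.

Lemma tens_act_u a e x y :
  tens_act (u * a) e x y = if x is x'.+1 then tens_act a e x' y else 0.
Proof.
rewrite /tens_act big_ord_recl big1 ?add0r => [|j _]; last first.
  by rewrite qcoef_u mul0r kscale0.
case: x => [|x]; first by rewrite big_ord0.
by apply: eq_bigr => i _; apply: eq_bigr => j _; rewrite qcoef_u lift0 subSS.
Qed.

Lemma tens_act_v a e x y :
  tens_act (v * a) e x y = if y is y'.+1 then kscale (c ^+ x) (tens_act a e x y') else 0.
Proof.
rewrite /tens_act; case: y => [|y].
  by apply: big1 => i _; apply: big1 => j _; rewrite qcoef_v ord1 mul0r kscale0.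
rewrite kscale_sum; apply: eq_bigr => i _; rewrite kscale_sum big_ord_recl.
rewrite qcoef_v mul0r kscale0 add0r; apply: eq_bigr => j _.
rewrite qcoef_v lift0 subSS kscaleA; congr (kscale _ _).
by rewrite mulrAC -exprD mulSn addnA subnKC -1?ltnS // exprD -mulrA [_ * qcoef a i j]mulrC.
Qed.

Lemma tens_act_fs a f : tens_act a f \in @finite_box M.
Proof.
apply/finite_boxP; move: a; apply: (qp_ind qp).
- by have [N fN] := fs2_box f; exists N => i j ij; rewrite tens_act1 fN.
- move=> a [N aN]; exists N.+1 => -[|i] j ij; rewrite tens_act_u // aN //.
  by move: ij; rewrite ltnS => /orP[|/ltnW] ->; rewrite ?orbT.
- move=> a [N aN]; exists N.+1 => i [|j] ij; rewrite tens_act_v // aN ?kscaler0 //.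
  by move: ij; rewrite !ltnS => /orP[/ltnW|] ->; rewrite ?orbT.
- move=> l a b [N aN] [N' bN]; exists (maxn N N') => i j ij; rewrite tens_act_linear.
  rewrite (in_box_le (leq_maxl N N') aN) // (in_box_le (leq_maxr N N') bN) //.
  by rewrite kscaler0 addr0.
Qed.

Lemma tens_actM a b e : tens_act (a * b) e = tens_act a (tens_act b e).
Proof.
move: a; apply: (qp_ind qp) => [|a IH|a IH|l a a' IH IH']; apply/funext => x; apply/funext => y.
- by rewrite mul1r tens_act1.
- by rewrite -mulrA !tens_act_u IH.
- by rewrite -mulrA !tens_act_v IH.
- by rewrite mulrDl -scalerAl !tens_act_linear IH IH'.
Qed.

End Action.

(** The module B (x)_k M with B acting on the left factor: f stands for the sum
    of the u^i v^j (x) f i j. The argument qp records the basis of B. *)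
Definition tens (_ : qplane u v c) (M : lmodType B) : Type := fs2 M.

Section TensorModule.
Variable M : lmodType B.
Local Notation T := (tens qp M).
HB.instance Definition _ := GRing.Zmodule.on T.

Definition tens_scale (a : B) (f : T) : T := Fs2 (tens_act_fs a f).

Fact tens_scaleA a b f : tens_scale a (tens_scale b f) = tens_scale (a * b) f.
Proof. by apply: val_inj; rewrite /= tens_actM. Qed.
Fact tens_scale1 : left_id 1 tens_scale.
Proof. by move=> f; apply: fs2P => i j; exact: tens_act1. Qed.
Fact tens_scaleDr : right_distributive tens_scale +%R.
Proof. by move=> a f g; apply: fs2P => i j; exact: tens_act_additive. Qed.
Fact tens_scaleDl f : {morph tens_scale^~ f : a b / a + b}.
Proof.
move=> a b; apply: fs2P => i j; have := tens_act_linear 1 a b f i j.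
by rewrite scale1r kscale1.
Qed.

HB.instance Definition _ := GRing.Zmodule_isLmodule.Build B T
  tens_scaleA tens_scale1 tens_scaleDr tens_scaleDl.

Lemma tens_u (f : T) x y : (u *: f) x y = if x is x'.+1 then f x' y else 0.
Proof. by rewrite -[u in LHS]mulr1 [LHS]tens_act_u; case: x => // x; rewrite tens_act1. Qed.

Lemma tens_v (f : T) x y : (v *: f) x y = if y is y'.+1 then kscale (c ^+ x) (f x y') else 0.
Proof. by rewrite -[v in LHS]mulr1 [LHS]tens_act_v; case: y => // y; rewrite tens_act1. Qed.

Lemma tens_kscale l (f : T) x y : (kscale l f) x y = kscale l (f x y).
Proof.
rewrite -[LHS]/(tens_act (l *: 1) f x y) -[l *: 1]addr0 tens_act_linear tens_act1.
by rewrite [X in _ + X]big1 ?addr0 // => i _; rewrite big1 // => j _; rewrite qcoef0 mul0r kscale0.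
Qed.

End TensorModule.

End Tensor.

(** * Vector spaces and induced modules *)

(** A linear map given by a function, opaque: it is used through mklinE only. *)
Fact mklin_exists (R : pzRingType) (U V : lmodType R) (h : U -> V) :
  linear h -> {f : {linear U -> V} | f =1 h}.
Proof.
move=> lin_h; pose f : {linear U -> V} := HB.pack h (GRing.isLinear.Build R U V *:%R h lin_h).
by exists f.
Qed.

Definition mklin (R : pzRingType) (U V : lmodType R) (h : U -> V) (lin_h : linear h) :
  {linear U -> V} := sval (mklin_exists lin_h).

Lemma mklinE (R : pzRingType) (U V : lmodType R) (h : U -> V) (lin_h : linear h) :
  mklin lin_h =1 h.
Proof. by rewrite /mklin; case: mklin_exists. Qed.

(** Zorn: a subset closed under linear combinations that meets N trivially and
    is maximal for this. Such a subset may be empty, which the maximality of C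
    excludes. *)
Lemma subspace_complement (k : fieldType) (W : lmodType k) (N : set W) :
  N 0 -> (forall (l : k) a b, N a -> N b -> N (l *: a + b)) ->
  exists C : set W,
    [/\ C 0, forall (l : k) a b, C a -> C b -> C (l *: a + b),
        forall w, exists a b, [/\ N a, C b & w = a + b]
      & forall w, N w -> C w -> w = 0].
Proof.
move=> N0 Nlin.
have Nz l a : N a -> N (l *: a) by move=> Na; rewrite -[l *: a]addr0; apply: Nlin.
have ND a b : N a -> N b -> N (a + b).
  by move=> Na Nb; rewrite -[a]scale1r; apply: Nlin.
pose P (C : set W) := (forall (l : k) a b, C a -> C b -> C (l *: a + b)) /\
                      (forall w, N w -> C w -> w = 0).
have [F FP Ftot|C [[Clin CN] Cmax]] := @Zorn_bigcup W P.
  split=> [l a b [X FX Xa] [Y FY Yb]|w Nw [X FX Xw]]; last by have [_] := FP _ FX; apply.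
  have [XY|YX] := Ftot _ _ FX FY.
    by exists Y => //; have [+ _] := FP _ FY; apply=> //; exact: XY.
  by exists X => //; have [+ _] := FP _ FX; apply=> //; exact: YX.
(* adjoining to C a vector outside N + C would contradict maximality *)
have grow (w : W) : (forall l x, l != 0 -> N (l *: w + x) -> C x \/ x = 0 -> False) ->
    ~ C w -> False.
  move=> wNC nCw; pose C' : set W := [set y | exists l x, (C x \/ x = 0) /\ y = l *: w + x]%classic.
  apply: (Cmax C').
    split=> [x Cx|]; first by exists 0, x; rewrite scale0r add0r; split=> //; left.
    move=> /(_ w) C'C; apply/nCw/C'C; exists 1, 0; rewrite scale1r addr0; split=> //; by right.
  split=> [l _ _ [l1 [x1 [Cx1 ->]]] [l2 [x2 [Cx2 ->]]]|y Ny [l [x [Cx yE]]]].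
    exists (l * l1 + l2), (l *: x1 + x2); split; last first.
      by rewrite scalerDr scalerDl scalerA !addrA; congr (_ + _); rewrite addrAC.
    case: Cx1 Cx2 => [Cx1|->] [Cx2|->].
    - by left; exact: Clin.
    - left; rewrite addr0; have := Clin (l - 1) _ _ Cx1 Cx1.
      by rewrite scalerBl scale1r subrK.
    - by left; rewrite scaler0 add0r.
    - by right; rewrite scaler0 addr0.
  rewrite yE in Ny *; have [l0|l0] := eqVneq l 0; last by case: (wNC l x l0 Ny).
  move: Ny; rewrite l0 scale0r add0r; case: Cx => [Cx|-> //] Nx; exact: CN.
have C0 : C 0.
  apply: contrapT => nC0; apply: (grow 0) => // l x l0; rewrite scaler0 add0r => Nx.
  case=> [Cx|x0].
    by apply: nC0; have := Clin (-1) _ _ Cx Cx; rewrite scaleN1r addNr.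
  have [x' Cx'] : exists x', C x'.
    apply: contrapT => nC; apply: (Cmax [set 0]%classic).
      split; first by move=> y Cy; case: nC; exists y.
      by move=> /(_ 0 erefl).
    by split=> [m a b -> ->|w _ ->//]; rewrite scaler0 addr0.
  by apply: nC0; have := Clin (-1) _ _ Cx' Cx'; rewrite scaleN1r addNr.
exists C; split=> // w; apply: contrapT => nw.
apply: (grow w) => [l x l0 Nlx Cx|Cw]; last by apply: nw; exists 0, w; rewrite add0r.
apply: nw; exists (l^-1 *: (l *: w + x)), ((- l^-1) *: x); split; first exact: Nz.
  by rewrite -[_ *: _]addr0; apply: Clin => //; case: Cx => [//|->].
by rewrite scalerDr scalerA mulVf // scale1r scaleNr addrK.
Qed.

Lemma linear_section (k : fieldType) (U V : lmodType k) (f : {linear U -> V}) :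
  (forall y, exists x, f x = y) -> exists s : {linear V -> U}, forall y, f (s y) = y.
Proof.
move=> fS; have [||C [C0 Clin Cspan C_inj]] := @subspace_complement k U [set x | f x = 0]%classic.
- exact: linear0.
- by move=> l a b /= fa fb; rewrite linearP fa fb scaler0 addr0.
have sP y : exists x, C x /\ f x = y.
  have [x <-] := fS y; have [a [b [/= fa Cb ->]]] := Cspan x.
  by exists b; rewrite linearD fa add0r.
pose s y := projT1 (cid (sP y)).
have Cs y : C (s y) by have [] := projT2 (cid (sP y)).
have fs y : f (s y) = y by have [] := projT2 (cid (sP y)).
have s_uniq x : C x -> s (f x) = x.
  move=> Cx; apply/eqP; rewrite -subr_eq0; apply/eqP/C_inj.
    by rewrite /= linearB fs subrr.
  by rewrite addrC -scaleN1r; apply: Clin.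
have s_lin : linear s.
  move=> l a b; rewrite -{1}(fs a) -{1}(fs b) -linearP s_uniq //; exact: Clin.
by exists (mklin s_lin) => y; rewrite mklinE.
Qed.

(** A module over a k-algebra, seen as a vector space. *)
Definition kmod (k : fieldType) (B : algType k) (M : lmodType B) : Type := M.

Section KMod.
Variables (k : fieldType) (B : algType k) (M : lmodType B).
HB.instance Definition _ := GRing.Zmodule.on (kmod M).
HB.instance Definition _ := GRing.Zmodule_isLmodule.Build k (kmod M)
  (@kscaleA _ _ M) (@kscale1 _ _ M) (@kscaleDr _ _ M) (fun m l l' => @kscaleDl _ _ M l l' m).
End KMod.

Lemma linear_kscale (k : fieldType) (B : algType k) (M N : lmodType B) (f : {linear M -> N}) l m :
  f (kscale l m) = kscale l (f m).
Proof. exact: linearZ. Qed.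

Section Extension.
Variables (k : fieldType) (B : algType k) (u v : B) (c : k).
Hypothesis qp : qplane u v c.
Implicit Types M N : lmodType B.

Lemma qp_linear M N (h : {additive M -> N}) :
  (forall l m, h (kscale l m) = kscale l (h m)) ->
  (forall m, h (u *: m) = u *: h m) -> (forall m, h (v *: m) = v *: h m) -> linear h.
Proof.
move=> hk hu hv a x y; rewrite raddfD; congr (_ + _); move: a x.
apply: (qp_ind qp) => [x|a IH x|a IH x|l a b IHa IHb x].
- by rewrite !scale1r.
- by rewrite -!scalerA hu IH.
- by rewrite -!scalerA hv IH.
- by rewrite !scalerDl raddfD IHb !scale_scale hk IHa.
Qed.

(** The vectors 1 (x) m. *)
Definition tens_unit M (m : M) : tens qp M :=
  @mkfs2 M 1 (fun x y => if (x == 0%N) && (y == 0%N) then m else 0)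
    ltac:(by move=> [|x] [|y]).

Lemma tens_unitE M (m : M) x y :
  tens_unit m x y = if (x == 0%N) && (y == 0%N) then m else 0.
Proof. by []. Qed.

Lemma tens_monomial M (m : M) i j x y :
  ((u ^+ i * v ^+ j) *: tens_unit m) x y = if (x == i) && (y == j) then m else 0.
Proof.
elim: i x => [|i IH] x; last first.
  rewrite exprS -mulrA -scalerA tens_u; case: x => // x; exact: IH.
rewrite expr0 mul1r; elim: j y => [|j IH] y; first by rewrite expr0 scale1r.
rewrite exprS -scalerA tens_v; case: y => [|y]; first by rewrite andbF.
by rewrite IH eqSS; case: eqP => [->|] /=; rewrite ?kscaler0 // expr0 kscale1.
Qed.

Lemma fs2_sum V I (r : seq I) (P : pred I) (F : I -> fs2 V) i j :
  (\sum_(x <- r | P x) F x) i j = \sum_(x <- r | P x) F x i j.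
Proof. by apply: (big_morph (fun f : fs2 V => f i j)). Qed.

Lemma tens_sum M (f : tens qp M) K : in_box K f ->
  f = \sum_(i < K) \sum_(j < K) (u ^+ i * v ^+ j) *: tens_unit (f i j).
Proof.
move=> fK; apply: fs2P => x y; rewrite fs2_sum.
under eq_bigr do rewrite fs2_sum.
under eq_bigr do under eq_bigr do rewrite tens_monomial.
have [/andP[xK yK]|] := boolP ((x < K)%N && (y < K)%N); last first.
  move=> nxy; rewrite fK; last by rewrite [(K <= x)%N]leqNgt [(K <= y)%N]leqNgt -negb_and.
  rewrite big1 // => i _; rewrite big1 // => j _; case: ifP => // /andP[/eqP xi /eqP yj].
  by rewrite xi yj !ltn_ord in nxy.
rewrite -[LHS](box_sum_delta (f : nat -> nat -> M) xK yK); apply: eq_bigr => i _; apply: eq_bigr => j _.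
by rewrite [x == _]eq_sym [y == _]eq_sym; case: ifP.
Qed.

Definition klinear M N (s : M -> N) :=
  forall l m m', s (kscale l m + m') = kscale l (s m) + s m'.

Section Ext.
Variables (M N : lmodType B) (s : M -> N).
Hypothesis s_lin : klinear s.

Lemma klinear0 : s 0 = 0.
Proof. by apply: (addrI (s 0)); rewrite -[X in X + _ = _]kscale1 -s_lin kscale1 !addr0. Qed.

Lemma klinearD m m' : s (m + m') = s m + s m'.
Proof. by have := s_lin 1 m m'; rewrite !kscale1. Qed.

Lemma klinearB m m' : s (m - m') = s m - s m'.
Proof. by apply/eqP; rewrite eq_sym subr_eq -klinearD subrK. Qed.

Lemma klinearZ l m : s (kscale l m) = kscale l (s m).
Proof. by have := s_lin l m 0; rewrite klinear0 !addr0. Qed.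

Definition tens_ext_sum K (f : tens qp M) : N :=
  \sum_(i < K) \sum_(j < K) (u ^+ i * v ^+ j) *: s (f i j).

Definition tens_ext_fun (f : tens qp M) : N := tens_ext_sum (projT1 (cid (fs2_box f))) f.

Lemma tens_extE (f : tens qp M) K : in_box K f -> tens_ext_fun f = tens_ext_sum K f.
Proof.
move=> fK; rewrite /tens_ext_fun; case: cid => K' /= fK'.
pose F i j m := (u ^+ i * v ^+ j) *: s m.
have F0 i j : F i j 0 = 0 by rewrite /F klinear0 scaler0.
rewrite -[LHS](box_sum_widen F0 fK' (leq_maxl K' K)).
exact: (box_sum_widen F0 fK (leq_maxr K' K)).
Qed.

Lemma tens_ext_common (f g : tens qp M) : exists K, [/\ in_box K f, in_box K g & (0 < K)%N].
Proof.
have [K fK] := fs2_box f; have [K' gK] := fs2_box g; exists (maxn K K').+1; split=> //.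
  by apply: in_box_le fK; rewrite ltnW // ltnS leq_maxl.
by apply: in_box_le gK; rewrite ltnW // ltnS leq_maxr.
Qed.

Fact tens_ext_is_additive : {morph tens_ext_fun : f g / f - g}.
Proof.
move=> f g; have [K [fK gK _]] := tens_ext_common f g.
have fgK : in_box K (f - g).
  by move=> i j ij; rewrite fs2B fK // gK // subrr.
rewrite !(tens_extE (K := K)) // /tens_ext_sum -sumrB; apply: eq_bigr => i _.
rewrite -sumrB; apply: eq_bigr => j _; rewrite fs2B -scalerBr; congr (_ *: _).
by rewrite klinearB.
Qed.
HB.instance Definition _ := GRing.isAdditive.Build (tens qp M) N tens_ext_fun
  tens_ext_is_additive.

Fact tens_ext_linear : linear tens_ext_fun.
Proof.
apply: qp_linear => [l f|f|f] /=.
- have [K fK] := fs2_box f; have lK : in_box K (kscale l f).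
    by move=> i j ij; rewrite tens_kscale fK // kscaler0.
  rewrite !(tens_extE (K := K)) // /tens_ext_sum kscale_sum; apply: eq_bigr => i _.
  rewrite kscale_sum; apply: eq_bigr => j _.
  by rewrite tens_kscale klinearZ scale_kscale.
- have [K fK] := fs2_box f; have uK : in_box K.+1 (u *: f).
    move=> [|i] j ij; rewrite tens_u // fK //.
    by move: ij; rewrite ltnS => /orP[|/ltnW] ->; rewrite ?orbT.
  rewrite (tens_extE fK) (tens_extE uK) /tens_ext_sum big_ord_recl big1 ?add0r => [|j _]; last first.
    by rewrite tens_u klinear0 scaler0.
  rewrite scaler_sumr; apply: eq_bigr => i _.
  rewrite big_ord_recr lift0 tens_u fK ?leqnn ?orbT //.
  rewrite klinear0 scaler0 [LHS]addr0 scaler_sumr; apply: eq_bigr => j _.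
  by rewrite tens_u scalerA mulrA -exprS.
- have [K fK] := fs2_box f; have vK : in_box K.+1 (v *: f).
    move=> i [|j] ij; rewrite tens_v // fK ?kscaler0 //.
    by move: ij; rewrite !ltnS => /orP[/ltnW|] ->; rewrite ?orbT.
  have v_last (j : 'I_K.+1) : s ((v *: f) K j) = 0.
    by rewrite tens_v; case: (nat_of_ord j) => [|j']; rewrite ?klinear0 // fK ?leqnn // kscaler0 klinear0.
  rewrite (tens_extE fK) (tens_extE vK) /tens_ext_sum big_ord_recr.
  rewrite [X in _ _ X = _]big1 => [|j _]; last by rewrite v_last scaler0.
  rewrite [LHS]addr0.
  rewrite scaler_sumr; apply: eq_bigr => i _; rewrite big_ord_recl tens_v klinear0 scaler0 add0r.
  rewrite scaler_sumr; apply: eq_bigr => j _; rewrite tens_v lift0 klinearZ.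
  by rewrite scale_kscale -scale_scale scalerA mulrA (vXu qp) -scalerAl -mulrA -exprS.
Qed.

(** B (x) M is induced from the vector space M: a k-linear map s on M extends to
    the B-linear map sending a (x) m to a s(m). *)
Definition tens_ext : {linear tens qp M -> N} := mklin tens_ext_linear.

Lemma tens_ext_unit m : tens_ext (tens_unit m) = s m.
Proof.
rewrite /tens_ext mklinE (@tens_extE _ 1) ?/tens_ext_sum ?big_ord1 => [|[|i] [|j]] //.
by rewrite mulr1 scale1r.
Qed.

End Ext.

Lemma tens_ext_uniq M N (h h' : {linear tens qp M -> N}) :
  (forall m, h (tens_unit m) = h' (tens_unit m)) -> h =1 h'.
Proof.
move=> hh' f; have [K fK] := fs2_box f; rewrite (tens_sum fK) !linear_sum.
apply: eq_bigr => i _; rewrite !linear_sum; apply: eq_bigr => j _.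
by rewrite !linearZ hh'.
Qed.

Lemma tens_unit_klinear M : klinear (@tens_unit M).
Proof.
move=> l m m'; apply: fs2P => x y; rewrite fs2D tens_kscale !tens_unitE.
by case: ifP; rewrite ?kscaler0 ?addr0.
Qed.

(** Induced modules are projective: a k-linear section of the given surjection
    is available, and composing with it on M extends uniquely to B (x) M. *)
Lemma tens_projective M : projective (tens qp M).
Proof.
move=> N1 N2 f g fS.
pose fk : {linear kmod N1 -> kmod N2} := @mklin k (kmod N1) (kmod N2) f
  (fun l a b => etrans (linearD f _ _) (congr1 (+%R^~ _) (linear_kscale f l a))).
have [y|s fs] := @linear_section _ _ _ fk.
  by have [x <-] := fS y; exists x; rewrite mklinE.
have s_lin : klinear (fun m => s (g (tens_unit m)) : N1).
  move=> l m m'; rewrite tens_unit_klinear linearD linear_kscale.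
  exact: (linearP s l (g (tens_unit m)) (g (tens_unit m'))).
exists (tens_ext s_lin); apply: (@tens_ext_uniq _ _ (f \o tens_ext s_lin)%FUN g) => m.
by rewrite -[LHS]/(f (tens_ext s_lin (tens_unit m))) tens_ext_unit -[RHS]fs mklinE.
Qed.

End Extension.

(** * The Koszul resolution *)

Section Division.
Variables (M : zmodType) (phi : {additive M -> M}) (e : nat -> M) (N : nat).
Hypothesis eN : forall n, (N <= n)%N -> e n = 0.

Let iter0 m : iter m phi 0 = 0.
Proof. by elim: m => //= m ->; rewrite raddf0. Qed.

Definition quotient_coef (n : nat) : M := \sum_(m < N) iter m phi (e (n.+1 + m)%N).

Lemma quotient_coef0 n : (N <= n)%N -> quotient_coef n = 0.
Proof.
move=> Nn; apply: big1 => m _; rewrite eN ?iter0 //.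
by rewrite addSn (leq_trans Nn) // -addnS leq_addr.
Qed.

(** Division with remainder of a polynomial with coefficients in M by the monic
    t - phi, where phi acts on M. *)
Lemma quotient_coefP n : e n.+1 = quotient_coef n - phi (quotient_coef n.+1).
Proof.
rewrite /quotient_coef raddf_sum -sumrB.
pose a m := iter m phi (e (n.+1 + m)%N).
rewrite (eq_bigr (fun m : 'I_N => a m - a m.+1)); last first.
  by move=> m _; rewrite /a iterS addnS.
apply: oppr_inj; rewrite -sumrN (eq_bigr (fun m : 'I_N => a m.+1 - a m)) => [|m _]; last by rewrite opprB.
rewrite -(big_mkord xpredT (fun m => a m.+1 - a m)) telescope_sumr //.
by rewrite /a [e (n.+1 + N)%N]eN ?leq_addl // iter0 addn0 sub0r.
Qed.

End Division.

(** A polynomial killed by t - phi vanishes, from its top coefficient down. *)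
Lemma no_remainder (M : zmodType) (phi : {additive M -> M}) (e : nat -> M) N :
  (forall n, (N <= n)%N -> e n = 0) -> (forall n, e n = phi (e n.+1)) -> forall n, e n = 0.
Proof.
move=> eN ephi n; suff H m : e (N - m)%N = 0.
  have [/eN//|nN] := leqP N n; by rewrite -(subKn (ltnW nN)) H.
elim: m => [|m IH]; first by rewrite subn0 eN.
have [le_Nm|lt_mN] := leqP N m.
  have /eqP Nm : (N - m == 0)%N by rewrite subn_eq0.
  by move: IH; rewrite subnS Nm.
by rewrite ephi subnSK // IH raddf0.
Qed.

Lemma projective_prod (A : pzRingType) (P Q : lmodType A) :
  projective P -> projective Q -> projective (P * Q)%type.
Proof.
move=> pP pQ M N f g fS.
have lin1 : linear (fun p => g (p, 0)).
  by move=> a x y; rewrite -linearP; congr (g (_, _)); rewrite /= scaler0 addr0.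
have lin2 : linear (fun q => g (0, q)).
  by move=> a x y; rewrite -linearP; congr (g (_, _)); rewrite /= scaler0 addr0.
have [h1 fh1] := pP _ _ f (mklin lin1) fS; have [h2 fh2] := pQ _ _ f (mklin lin2) fS.
have lin : linear (fun pq : P * Q => h1 pq.1 + h2 pq.2).
  by move=> a x y; rewrite /= !linearP scalerDr !addrA; congr (_ + _); rewrite addrAC.
exists (mklin lin) => -[p q]; rewrite mklinE linearD fh1 fh2 !mklinE -linearD.
by congr (g (_, _)); rewrite /= ?addr0 ?add0r.
Qed.

Lemma row0E (A : pzRingType) (p q : 'rV[A]_0) : p = q.
Proof. by apply/rowP => -[]. Qed.

Lemma projective0 (A : pzRingType) : projective 'rV[A]_0.
Proof.
move=> M N f g fS; exists \0 => p.
by rewrite (row0E p 0) !linear0.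
Qed.

Section Koszul.
Variables (k : fieldType) (B : algType k) (u v : B) (c : k).
Hypothesis qp : qplane u v c.

Section Differentials.
Variable M : lmodType B.
Local Notation T := (tens qp M).
Implicit Types (f g h : T).

(** The operators a (x) m |-> a v (x) m - l a (x) v m and
    a (x) m |-> l a u (x) m - a (x) u m, with right multiplications expressed
    in the basis u^i v^j: v^j u = c^j u v^j gives the power of c. *)
Definition kos_v_coef (l : k) (e : nat -> nat -> M) x y : M :=
  (if y is y'.+1 then e x y' else 0) - kscale l (v *: e x y).

Definition kos_u_coef (l : k) (e : nat -> nat -> M) x y : M :=
  (if x is x'.+1 then kscale (l * c ^+ y) (e x' y) else 0) - u *: e x y.

Fact kos_v_box l (e : nat -> nat -> M) N : in_box N e -> in_box N.+1 (kos_v_coef l e).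
Proof.
move=> eN i j ij; rewrite /kos_v_coef [e i j]eN; last first.
  by move: ij => /orP[/ltnW|/ltnW] ->; rewrite ?orbT.
rewrite scaler0 kscaler0 subr0; case: j ij => // j ij; apply: eN.
by move: ij; rewrite !ltnS => /orP[/ltnW|] ->; rewrite ?orbT.
Qed.

Fact kos_u_box l (e : nat -> nat -> M) N : in_box N e -> in_box N.+1 (kos_u_coef l e).
Proof.
move=> eN i j ij; rewrite /kos_u_coef [e i j]eN; last first.
  by move: ij => /orP[/ltnW|/ltnW] ->; rewrite ?orbT.
rewrite scaler0 subr0; case: i ij => // i ij; rewrite eN ?kscaler0 //.
by move: ij; rewrite !ltnS => /orP[|/ltnW] ->; rewrite ?orbT.
Qed.

Fact kos_v_fs l f : kos_v_coef l f \in @finite_box M.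
Proof. by have [N fN] := fs2_box f; apply/finite_boxP; exists N.+1; exact: kos_v_box. Qed.
Fact kos_u_fs l f : kos_u_coef l f \in @finite_box M.
Proof. by have [N fN] := fs2_box f; apply/finite_boxP; exists N.+1; exact: kos_u_box. Qed.

Definition kos_v_fun l f : T := Fs2 (kos_v_fs l f).
Definition kos_u_fun l f : T := Fs2 (kos_u_fs l f).

Lemma kos_v_funE l f x y : kos_v_fun l f x y =
  (if y is y'.+1 then f x y' else 0) - kscale l (v *: f x y).
Proof. by []. Qed.
Lemma kos_u_funE l f x y : kos_u_fun l f x y =
  (if x is x'.+1 then kscale (l * c ^+ y) (f x' y) else 0) - u *: f x y.
Proof. by []. Qed.

Lemma vu_scale (m : M) : v *: (u *: m) = kscale c (u *: (v *: m)).
Proof. by rewrite !scalerA (qp_comm qp) scale_scale. Qed.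

Let subrACA (V : zmodType) (a b p q : V) : a - b - (p - q) = a - p - (b - q).
Proof. by rewrite !opprB addrACA [RHS]addrACA [- b + _]addrC. Qed.

Let kscaleB l (m m' : M) : kscale l (m - m') = kscale l m - kscale l m'.
Proof. by rewrite kscaleDr kscaleN. Qed.

Fact kos_v_additive l : {morph kos_v_fun l : f g / f - g}.
Proof.
move=> f g; apply: fs2P => x y; rewrite fs2B !kos_v_funE subrACA.
by case: y => [|y]; rewrite !fs2B ?subr0 scalerBr kscaleB.
Qed.
HB.instance Definition _ l := GRing.isAdditive.Build T T (kos_v_fun l) (kos_v_additive l).

Fact kos_u_additive l : {morph kos_u_fun l : f g / f - g}.
Proof.
move=> f g; apply: fs2P => x y; rewrite fs2B !kos_u_funE subrACA.
by case: x => [|x]; rewrite !fs2B ?subr0 scalerBr // kscaleB.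
Qed.
HB.instance Definition _ l := GRing.isAdditive.Build T T (kos_u_fun l) (kos_u_additive l).

Fact kos_v_linear l : linear (kos_v_fun l).
Proof.
apply: (qp_linear qp) => [a f|f|f]; apply: fs2P => x y.
- rewrite tens_kscale !kos_v_funE kscaleB; case: y => [|y]; rewrite !tens_kscale ?kscaler0;
  by rewrite !scale_kscale !kscaleA [a * l]mulrC.
- rewrite tens_u !kos_v_funE; case: x => [|x].
    by case: y => [|y]; rewrite !tens_u scaler0 kscaler0 subr0.
  by rewrite kos_v_funE; case: y => [|y]; rewrite !tens_u.
- rewrite tens_v !kos_v_funE; case: y => [|y].
    by rewrite tens_v scaler0 kscaler0 subr0.
  rewrite !tens_v kos_v_funE kscaleB scale_kscale !kscaleA [l * _]mulrC.
  by case: y => [|y]; rewrite ?tens_v ?kscaler0.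
Qed.

Fact kos_u_linear l : linear (kos_u_fun l).
Proof.
apply: (qp_linear qp) => [a f|f|f]; apply: fs2P => x y.
- rewrite tens_kscale !kos_u_funE kscaleB; case: x => [|x]; rewrite !tens_kscale ?kscaler0;
  by rewrite !scale_kscale ?kscaleA ?[a * _]mulrC.
- rewrite tens_u !kos_u_funE; case: x => [|x].
    by rewrite tens_u scaler0 subr0.
  by rewrite !tens_u kos_u_funE; case: x => [|x]; rewrite ?tens_u ?kscaler0.
- rewrite tens_v !kos_u_funE; case: y => [|y].
    by case: x => [|x]; rewrite !tens_v ?kscaler0 scaler0 subr0.
  rewrite !tens_v kos_u_funE kscaleB scale_kscale.
  case: x => [|x]; first by rewrite kscaler0.
  by rewrite tens_v !kscaleA; congr (kscale _ _ - _); rewrite !exprS -!mulrA mulrCA [_ * c ^+ x]mulrC mulrCA mulrC; ring.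
Qed.

Definition kos_v l : {linear T -> T} := mklin (kos_v_linear l).
Definition kos_u l : {linear T -> T} := mklin (kos_u_linear l).

Lemma kos_vE l f x y : kos_v l f x y =
  (if y is y'.+1 then f x y' else 0) - kscale l (v *: f x y).
Proof. by rewrite /kos_v mklinE. Qed.
Lemma kos_uE l f x y : kos_u l f x y =
  (if x is x'.+1 then kscale (l * c ^+ y) (f x' y) else 0) - u *: f x y.
Proof. by rewrite /kos_u mklinE. Qed.

(** The composite of the two differentials vanishes: this is where the relation
    v u = c u v enters, together with the choice l = 1 or c of the twists. *)
Lemma kos_comm f : kos_u 1 (kos_v c f) = kos_v 1 (kos_u c f).
Proof.
apply: fs2P => -[|x] [|y]; rewrite !(kos_uE, kos_vE) ?mul1r ?kscale1 ?sub0r !(scalerN, kscaleN, scalerBr, kscaleB, opprB, opprK, scaler0, kscaler0, sub0r).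
- by rewrite scale_kscale vu_scale.
- by rewrite addrC scale_kscale vu_scale.
- by rewrite addrC expr0 mulr1 !scale_kscale vu_scale.
- rewrite !scale_kscale vu_scale !kscaleA -!exprS -exprSr.
  by rewrite addrACA [RHS]addrACA; congr (_ + _); rewrite addrC.
Qed.

(** Let t be the right multiplication by v on B. Then kos_v l is t - phi with phi
    the action of l v on M, so it is injective, and every vector is congruent
    modulo its image to one involving no v. With t the right multiplication by u,
    kos_u 1 is t - u on the latter vectors, whence the same statements. Exactness
    of the complex follows from these four facts. *)
Lemma kos_v_inj l f : (forall x y, kos_v l f x y.+1 = 0) -> f = 0.
Proof.
move=> Df; apply: fs2P => x y; have [N fN] := fs2_box f.
apply: (@no_remainder M (GRing.scale (l *: v)) (f x) N) => [n Nn|n].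
  by rewrite fN // Nn orbT.
by have /eqP := Df x n; rewrite kos_vE subr_eq0 -scale_scale => /eqP.
Qed.

Lemma kos_u_inj f : (forall x y, f x y.+1 = 0) -> kos_u 1 f = 0 -> f = 0.
Proof.
move=> f0 Df; apply: fs2P => x [|y]; last by rewrite f0.
have [N fN] := fs2_box f.
apply: (@no_remainder M (GRing.scale u) (f^~ 0%N) N) => [n Nn|n]; first by rewrite fN // Nn.
have /eqP := congr1 (fun g : T => g n.+1 0%N) Df.
by rewrite kos_uE mul1r expr0 kscale1 subr_eq0 => /eqP.
Qed.

Lemma kos_v_div l f : exists g f0, f = kos_v l g + f0 /\ forall x y, f0 x y.+1 = 0.
Proof.
have [N fN] := fs2_box f.
have fN' x n : (N <= n)%N -> f x n = 0 by move=> Nn; rewrite fN // Nn orbT.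
pose g x y := quotient_coef (GRing.scale (l *: v)) (f x) N y.
have gN : in_box N g.
  move=> x y /orP[Nx|]; last exact: (quotient_coef0 _ (fN' x)).
  apply: big1 => m _; rewrite fN ?Nx //.
  by elim: (nat_of_ord m) => //= m' ->; rewrite scaler0.
exists (mkfs2 gN), (f - kos_v l (mkfs2 gN)); split; first by rewrite addrC subrK.
move=> x y; rewrite fs2B kos_vE !mkfs2E -scale_scale.
by rewrite (quotient_coefP (GRing.scale (l *: v)) (fN' x)) subrr.
Qed.

Lemma kos_u_div f : (forall x y, f x y.+1 = 0) ->
  exists h m, f = kos_u 1 h + tens_unit qp m.
Proof.
move=> f0; have [N fN] := fs2_box f.
have fN' n : (N <= n)%N -> f n 0%N = 0 by move=> Nn; rewrite fN // Nn.
pose g x y := if y is 0 then quotient_coef (GRing.scale u) (f^~ 0%N) N x else 0.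
have gN : in_box N.+1 g.
  by move=> x [|y] //; rewrite ltn0 orbF => /ltnW; exact: (quotient_coef0 _ fN').
pose h : T := mkfs2 gN.
exists h, (f 0%N 0%N + u *: h 0%N 0%N).
apply: fs2P => x y; rewrite fs2D kos_uE tens_unitE.
case: y => [|y].
  case: x => [|x] /=; first by rewrite sub0r addrC addrK.
  rewrite addr0 mul1r expr0 kscale1; exact: (quotient_coefP (GRing.scale u) fN').
by rewrite f0 andbF addr0 /h mkfs2E scaler0 subr0; case: x => // x; rewrite kscaler0.
Qed.

Definition kos_aug : {linear T -> M} := tens_ext qp (s := @id M) (fun _ _ _ => erefl).

Lemma kos_aug_unit m : kos_aug (tens_unit qp m) = m.
Proof. exact: tens_ext_unit. Qed.

Lemma kos_v_unit l m : kos_v l (tens_unit qp m) = v *: tens_unit qp m - kscale l (tens_unit qp (v *: m)).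
Proof.
apply: fs2P => x y; rewrite fs2B tens_kscale tens_v kos_vE !tens_unitE.
case: x => [|x]; case: y => [|y]; rewrite /= ?scaler0 ?kscaler0 //.
by case: y => [|y]; rewrite /= ?kscaler0 // expr0 kscale1.
Qed.

Lemma kos_u_unit l m : kos_u l (tens_unit qp m) = kscale l (u *: tens_unit qp m) - tens_unit qp (u *: m).
Proof.
apply: fs2P => x y; rewrite fs2B tens_kscale tens_u kos_uE !tens_unitE.
case: x => [|x]; rewrite ?kscaler0 /=; first by case: y => [|y] //=; rewrite scaler0.
by case: x => [|x]; case: y => [|y]; rewrite /= ?expr0 ?mulr1 ?kscaler0 ?scaler0.
Qed.

Lemma kos_aug_v f : kos_aug (kos_v 1 f) = 0.
Proof.
apply: (@tens_ext_uniq _ _ _ _ _ qp M M (kos_aug \o kos_v 1)%FUN \0) => m.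
rewrite -[LHS]/(kos_aug (kos_v 1 (tens_unit qp m))) kos_v_unit linearB kscale1 linearZ.
by rewrite !kos_aug_unit subrr.
Qed.

Lemma kos_aug_u f : kos_aug (kos_u 1 f) = 0.
Proof.
apply: (@tens_ext_uniq _ _ _ _ _ qp M M (kos_aug \o kos_u 1)%FUN \0) => m.
rewrite -[LHS]/(kos_aug (kos_u 1 (tens_unit qp m))) kos_u_unit linearB kscale1 linearZ.
by rewrite !kos_aug_unit subrr.
Qed.

Definition kos_obj (i : nat) : lmodType B :=
  match i with 0 => T | 1 => (T * T)%type | 2 => T | _ => 'rV[B]_0 end.

Fact kos_d0_linear : linear (fun p : T * T => kos_u 1 p.1 + kos_v 1 p.2).
Proof. by move=> a p q; rewrite /= !linearP scalerDr addrACA. Qed.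

Fact kos_d1_linear : linear (fun h : T => (- kos_v c h, kos_u c h) : T * T).
Proof. by move=> a p q; apply/pair_equal_spec; split; rewrite /= linearP ?opprD ?scalerN. Qed.

Definition kos_d0 : {linear (T * T)%type -> T} := mklin kos_d0_linear.
Definition kos_d1 : {linear T -> (T * T)%type} := mklin kos_d1_linear.

Lemma kos_d0E p : kos_d0 p = kos_u 1 p.1 + kos_v 1 p.2.
Proof. exact: mklinE. Qed.
Lemma kos_d1E h : kos_d1 h = (- kos_v c h, kos_u c h).
Proof. exact: mklinE. Qed.

Definition kos_d (i : nat) : {linear kos_obj i.+1 -> kos_obj i} :=
  match i with
  | 0 => kos_d0 | 1 => kos_d1
  | _.+2 => \0
  end.

Fact kos_projective i : projective (kos_obj i).
Proof.
case: i => [|[|[|i]]] /=.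
- exact: tens_projective.
- by apply: projective_prod; exact: tens_projective.
- exact: tens_projective.
- exact: projective0.
Qed.

Fact kos_surj m : exists p : kos_obj 0, kos_aug p = m.
Proof. by exists (tens_unit qp m); rewrite kos_aug_unit. Qed.

Fact kos_exact0 (p : kos_obj 0) : kos_aug p = 0 <-> exists p', kos_d 0 p' = p.
Proof.
split=> [ap|[[f g] <-]]; last by rewrite kos_d0E linearD kos_aug_u kos_aug_v addr0.
have [g [f0 [pE f0E]]] := kos_v_div 1 p; have [h [m f0D]] := kos_u_div f0E.
exists (h, g); rewrite kos_d0E addrC pE f0D; move: ap.
rewrite pE f0D !linearD kos_aug_v kos_aug_u !add0r kos_aug_unit => ->.
by rewrite addrA -[LHS]addr0; congr (_ + _); apply: fs2P => x y; rewrite tens_unitE; case: ifP.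
Qed.

Fact kos_exact i (p : kos_obj i.+1) : kos_d i p = 0 <-> exists p', kos_d i.+1 p' = p.
Proof.
case: i p => [|[|i]] p.
- case: p => f g; split=> [|[h]]; last first.
    by rewrite /= kos_d1E => -[<- <-]; rewrite kos_d0E linearN kos_comm addNr.
  rewrite /= kos_d0E /= => dfg.
  have [f1 [f0 [fE f0E]]] := kos_v_div c f.
  have Dv : kos_v 1 (kos_u c f1 + g) = - kos_u 1 f0.
    by apply/eqP; rewrite -addr_eq0 linearD -kos_comm addrAC addrC -[X in _ + X == 0]linearD -fE addrC dfg.
  have Du0 x y : kos_u 1 f0 x y.+1 = 0.
    by rewrite kos_uE f0E scaler0 subr0; case: x => // x; rewrite f0E kscaler0.
  have uv0 : kos_u c f1 + g = 0.
    by apply: (@kos_v_inj 1) => x y; rewrite Dv fs2N Du0 oppr0.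
  have f00 : f0 = 0.
    by apply: kos_u_inj => //; apply/eqP; rewrite -oppr_eq0 -Dv uv0 linear0.
  exists (- f1); rewrite /= kos_d1E !linearN opprK fE f00 addr0; congr (_, _).
  by apply/eqP; rewrite eq_sym -addr_eq0 addrC uv0.
- split=> [|[p' <-]]; last exact: (linear0 kos_d1).
  rewrite /= kos_d1E => /(congr1 fst)/eqP; rewrite oppr_eq0 => /eqP vp.
  by exists 0; apply/esym/(@kos_v_inj c) => x y; rewrite vp.
- by split=> // _; exists 0; exact: row0E.
Qed.

(** The length two resolution of an arbitrary module M,
    0 -> B (x) M -> (B (x) M)^2 -> B (x) M -> M -> 0. *)
Definition koszul : proj_resolution M :=
  ProjResolution kos_projective kos_surj kos_exact0 kos_exact.

End Differentials.

Lemma qp_gldim_le2 : gldim_le B 2.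
Proof.
by move=> M; exists (koszul M) => -[|[|[|i]]] //= _ p; exact: row0E.
Qed.

End Koszul.

(** * Gradings of a quantum plane *)

(** Common source of the gradings of B, of free modules and of their sums:
    homogeneity is tested on coordinates. *)
Lemma coord_graded (V W : zmodType) (I : Type) (pi : I -> {additive V -> W})
    (deg : I -> int) (gr : int -> set V) :
  (forall m a, gr m a <-> forall t, pi t a <> 0 -> m = deg t) ->
  (forall a, (forall t, pi t a = 0) -> a = 0) ->
  (forall a, exists (s : seq int) (C : int -> V),
    [/\ uniq s, forall t, pi t a <> 0 -> deg t \in s
      & forall m t, pi t (C m) = if m == deg t then pi t a else 0]) ->
  graded_by gr.
Proof.
move=> grP pi_inj comp; split.
- move=> m; split; first by apply/grP => t; rewrite raddf0.
  move=> a b /grP ga /grP gb; apply/grP => t; rewrite raddfB.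
  have [a0|a0] := eqVneq (pi t a) 0; last by move=> _; apply: ga; exact/eqP.
  have [b0|b0] := eqVneq (pi t b) 0; last by move=> _; apply: gb; exact/eqP.
  by rewrite a0 b0 subrr.
- move=> a; have [s [C [s_uniq sP CP]]] := comp a; exists s, C; split=> [m|].
    by apply/grP => t; rewrite CP; case: eqP.
  apply/eqP; rewrite -subr_eq0; apply/eqP/pi_inj => t; rewrite raddfB raddf_sum.
  under eq_bigr do rewrite CP.
  have [a0|a0] := eqVneq (pi t a) 0.
    by rewrite a0 big1 ?subrr // => m _; case: ifP.
  rewrite (bigD1_seq (deg t)) ?sP //=; last exact/eqP.
  by rewrite eqxx big1 ?addr0 ?subrr // => m /negPf ->.
- move=> s c s_uniq cP c0 m ms; apply: pi_inj => t.
  have /(congr1 (pi t)) := c0; rewrite raddf0 raddf_sum (bigD1_seq m) //=.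
  apply: contra_eq => cm; have mt : m = deg t by move/grP: (cP m); apply; exact/eqP.
  rewrite big1 ?addr0 // => m' m'm; apply/eqP; apply: contra_neqT m'm => cm'.
  by rewrite mt; move/grP: (cP m'); apply; exact/eqP.
Qed.

Section QGrading.
Variables (k : fieldType) (B : algType k) (u v : B) (c : k).
Hypothesis qp : qplane u v c.
Local Notation qcoef := (qcoef qp).
Variables (du dv : nat).
Hypotheses (du_gt0 : (0 < du)%N) (dv_gt0 : (0 < dv)%N).

Definition qdeg (i j : nat) : int := (i * du + j * dv)%N.

(** The grading with u in degree du and v in degree dv. *)
Definition qgr (m : int) : set B :=
  [set a | forall i j, qcoef a i j <> 0 -> m = qdeg i j]%classic.

Lemma qdeg_eq0 i j : qdeg i j = 0 -> i = 0%N /\ j = 0%N.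
Proof.
move=> [] /eqP; rewrite addn_eq0 !muln_eq0 => /andP[].
by rewrite (gtn_eqF du_gt0) (gtn_eqF dv_gt0) !orbF => /eqP -> /eqP ->.
Qed.

Lemma qdegS i j : qdeg i.+1 j = du%:Z + qdeg i j.
Proof. by rewrite /qdeg mulSn -addnA PoszD. Qed.

Lemma qdegS' i j : qdeg i j.+1 = dv%:Z + qdeg i j.
Proof. by rewrite /qdeg mulSn addnCA PoszD. Qed.

Lemma qdegD i j i' j' : qdeg (i + i') (j + j') = qdeg i j + qdeg i' j'.
Proof. by rewrite /qdeg !mulnDl addnACA PoszD. Qed.

Definition degrees (N : nat) : seq int := map Posz (iota 0 (N * du + N * dv)).

Lemma degrees_uniq N : uniq (degrees N).
Proof. by rewrite map_inj_uniq ?iota_uniq // => x y []. Qed.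

Lemma mem_degrees N i j : (i < N)%N -> (j < N)%N -> qdeg i j \in degrees N.
Proof.
move=> iN jN; apply: map_f; rewrite mem_iota add0n.
have lt1 : (i * du < N * du)%N by rewrite ltn_pmul2r.
by rewrite (leq_trans (_ : _ < N * du + j * dv)%N) ?ltn_add2r // leq_add2l leq_mul // ltnW.
Qed.

Fact qcoef_additive t : {morph (fun a => qcoef a t.1 t.2) : a b / a - b}.
Proof. by move=> a b /=; rewrite qcoefD -scaleN1r qcoefZ mulN1r. Qed.

Fact qcoef_add_exists (t : nat * nat) : {p : {additive B -> k} | forall a, p a = qcoef a t.1 t.2}.
Proof.
pose p : {additive B -> k} := HB.pack (fun a => qcoef a t.1 t.2)
  (GRing.isAdditive.Build B k _ (qcoef_additive t)).
by exists p.
Qed.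

Lemma qgr_graded : graded_by qgr.
Proof.
apply: (@coord_graded B k (nat * nat)%type (fun t => sval (qcoef_add_exists t))
  (fun t => qdeg t.1 t.2)).
- move=> m a; split=> [ga [i j]|ga i j]; first by case: qcoef_add_exists => p /= ->; exact: ga.
  by have := ga (i, j); case: qcoef_add_exists => p /= ->.
- move=> a a0; apply: (@qcoef_inj _ _ _ _ _ qp) => i j; rewrite qcoef0.
  by have := a0 (i, j); case: qcoef_add_exists => p /= ->.
- move=> a; pose N := qcoef_bound qp a.
  pose e (m : int) i j := if m == qdeg i j then qcoef a i j else 0.
  have eN m : in_box N (e m).
    by move=> i j ij; rewrite /e qcoef_box //; case: ifP.
  exists (degrees N), (fun m => monomial_sum u v N (e m)); split.
  + exact: degrees_uniq.
  + move=> [i j]; case: qcoef_add_exists => p /= -> aij.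
    have /andP[iN jN] : (i < N)%N && (j < N)%N.
      apply: contra_notT aij; rewrite negb_and -!leqNgt; exact: qcoef_box.
    exact: mem_degrees.
  + move=> m [i j]; case: qcoef_add_exists => p /= pE; rewrite !pE.
    by rewrite (@qcoef_uniq _ _ _ _ _ qp _ N (e m)).
Qed.

Lemma qgr0 m : qgr m 0. Proof. by case: qgr_graded => /(_ m) []. Qed.
Lemma qgrB m a b : qgr m a -> qgr m b -> qgr m (a - b).
Proof. by case: qgr_graded => /(_ m) [_ +] _ _; apply. Qed.
Lemma qgrD m a b : qgr m a -> qgr m b -> qgr m (a + b).
Proof. by move=> ga gb; rewrite -[b]opprK -[- b]sub0r; do !apply: qgrB => //; exact: qgr0. Qed.
Lemma qgrZ m l a : qgr m a -> qgr m (l *: a).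
Proof. by move=> ga i j; rewrite qcoefZ => /eqP; rewrite mulf_eq0 negb_or => /andP[_ /eqP /ga]. Qed.
Lemma qgr_sum m I (r : seq I) (P : pred I) (F : I -> B) :
  (forall x, P x -> qgr m (F x)) -> qgr m (\sum_(x <- r | P x) F x).
Proof. by move=> FP; elim/big_ind: _ => //; [exact: qgr0|exact: qgrD]. Qed.

Lemma qgr_monomial i j : qgr (qdeg i j) (u ^+ i * v ^+ j).
Proof.
move=> x y; rewrite qcoef_monomial.
by case: eqP => [->|] //=; case: eqP => [->|].
Qed.

Lemma qgrM m l a b : qgr m a -> qgr l b -> qgr (m + l) (a * b).
Proof.
move=> ga gb; rewrite [a in a * _](qcoefK (leqnn (qcoef_bound qp a))) [b in _ * b](qcoefK (leqnn (qcoef_bound qp b))).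
rewrite /monomial_sum mulr_suml; apply: qgr_sum => i _.
rewrite mulr_suml; apply: qgr_sum => j _; rewrite mulr_sumr; apply: qgr_sum => i' _.
rewrite mulr_sumr; apply: qgr_sum => j' _.
rewrite -scalerAl -scalerAr scalerA.
have [->|/eqP aij] := eqVneq (qcoef a i j) 0; first by rewrite mul0r scale0r; exact: qgr0.
have [->|/eqP bij] := eqVneq (qcoef b i' j') 0; first by rewrite mulr0 scale0r; exact: qgr0.
rewrite (ga _ _ aij) (gb _ _ bij) -qdegD; apply: qgrZ.
rewrite -mulrA [v ^+ j * _]mulrA (vXuX qp) -scalerAl -scalerAr; apply: qgrZ.
by rewrite !mulrA -exprD -mulrA -exprD; exact: qgr_monomial.
Qed.

Lemma qgr_scalar a : qgr 0 a <-> exists l : k, a = l *: 1.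
Proof.
have one : 1 = u ^+ 0 * v ^+ 0 :> B by rewrite !expr0 mulr1.
split=> [ga|[l ->]]; last by apply: qgrZ; rewrite one; exact: qgr_monomial.
exists (qcoef a 0 0); apply: (@qcoef_inj _ _ _ _ _ qp) => i j.
rewrite qcoefZ one qcoef_monomial.
have [/andP[/eqP -> /eqP ->]|ij] := boolP ((i == 0%N) && (j == 0%N)); first by rewrite mulr1.
rewrite mulr0; apply/eqP; apply: contraNT ij => /eqP aij.
by have [-> ->] := qdeg_eq0 (esym (ga _ _ aij)).
Qed.

Lemma qgr_neg m a : m < 0 -> qgr m a -> a = 0.
Proof.
move=> m0 ga; apply: (@qcoef_inj _ _ _ _ _ qp) => i j; rewrite qcoef0.
by apply/eqP; apply: contraTT m0 => /eqP/ga ->.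
Qed.

(** The terms containing u make up u a1, and the powers of v make up v a2. *)
Lemma qgr_split m a : qgr m a -> qcoef a 0 0 = 0 ->
  exists a1 a2, [/\ qgr (m - du%:Z) a1, qgr (m - dv%:Z) a2 & a = u * a1 + v * a2].
Proof.
move=> ga a0; pose N := qcoef_bound qp a.
pose e i j := qcoef a i.+1 j; pose e' i j := if i is 0 then qcoef a 0 j.+1 else 0.
have eN : in_box N e.
  by move=> i j ij; apply: qcoef_box; case/orP: ij => [/leqW|] ->; rewrite ?orbT.
have eN' : in_box N e'.
  by move=> [|i] j ij //; apply: qcoef_box; case/orP: ij => [|/leqW] ->; rewrite ?orbT.
have c1 := @qcoef_uniq _ _ _ _ _ qp _ N e eN erefl.
have c2 := @qcoef_uniq _ _ _ _ _ qp _ N e' eN' erefl.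
exists (monomial_sum u v N e), (monomial_sum u v N e'); split.
- by move=> i j; rewrite c1 => /ga ->; rewrite qdegS addrC addKr.
- by move=> i j; rewrite c2; case: i => // /ga ->; rewrite qdegS' addrC addKr.
- apply: (@qcoef_inj _ _ _ _ _ qp) => i j; rewrite qcoefD qcoef_u qcoef_v.
  case: i => [|i]; last by rewrite c1; case: j => [|j]; rewrite ?c2 ?mulr0 addr0.
  by case: j => [|j]; rewrite ?c2 ?a0 add0r // mul1r.
Qed.

Lemma qgr_u_inv m a : qgr (du%:Z + m) (u * a) -> qgr m a.
Proof.
by move=> ga i j aij; apply: (addrI du%:Z); rewrite -qdegS; apply: ga; rewrite qcoef_u.
Qed.

Lemma qp_lregu a : u * a = 0 -> a = 0.
Proof.
move=> ua; apply: (@qcoef_inj _ _ _ _ _ qp) => i j; rewrite qcoef0.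
by rewrite -(qcoef_u qp a i.+1 j) ua qcoef0.
Qed.

(** Middle exactness of the dual Koszul complex: comparing coefficients, a
    contains no pure power of v, hence is divisible by u on the left, and u is
    left regular. *)
Lemma qp_syzygy a b : v * a = c *: (u * b) -> exists w, a = u * w /\ b = v * w.
Proof.
move=> ab; have a0 j : qcoef a 0 j = 0.
  by have := qcoef_v qp a 0 j.+1; rewrite ab qcoefZ qcoef_u mulr0 mul1r.
pose N := qcoef_bound qp a; pose e i j := qcoef a i.+1 j.
have eN : in_box N e.
  by move=> i j ij; apply: qcoef_box; case/orP: ij => [/leqW|] ->; rewrite ?orbT.
have c1 := @qcoef_uniq _ _ _ _ _ qp _ N e eN erefl.
have aE : a = u * monomial_sum u v N e.
  by apply: (@qcoef_inj _ _ _ _ _ qp) => -[|i] j; rewrite qcoef_u ?c1.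
exists (monomial_sum u v N e); split=> //.
apply/eqP; rewrite -subr_eq0; apply/eqP/qp_lregu.
have cZ x : c *: x = 0 -> x = 0 :> B.
  by move=> /eqP; rewrite scaler_eq0 (negPf (qp_neq0 qp)) => /eqP.
apply: cZ; rewrite mulrBr scalerBr -ab [in LHS]aE mulrA (qp_comm qp) -scalerAl mulrA.
by rewrite subrr.
Qed.

End QGrading.

(** * The trivial module *)

Section Trivial.
Variables (k : fieldType) (B : algType k) (u v : B) (c : k).
Hypothesis qp : qplane u v c.
Local Notation qcoef := (qcoef qp).

Lemma qcoef1 i j : qcoef 1 i j = ((i == 0%N) && (j == 0%N))%:R.
Proof. by rewrite -[1]mulr1 -[X in X * _](expr0 u) -[X in _ * X](expr0 v) qcoef_monomial. Qed.

Lemma qcoef00M a b : qcoef (a * b) 0 0 = qcoef a 0 0 * qcoef b 0 0.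
Proof.
move: a; apply: (qp_ind qp) => [|a _|a _|l a a' IH IH'].
- by rewrite mul1r qcoef1 mul1r.
- by rewrite -mulrA !qcoef_u mul0r.
- by rewrite -mulrA !qcoef_v mul0r.
- by rewrite mulrDl -scalerAl !qcoefD !qcoefZ IH IH' mulrDl mulrA.
Qed.

(** The trivial module k, on which u and v act as 0. *)
Definition triv (_ : qplane u v c) : Type := k.
HB.instance Definition _ := GRing.Zmodule.on (triv qp).

Definition triv_scale (a : B) (t : triv qp) : triv qp := qcoef a 0 0 * (t : k).

Fact triv_scaleA a b t : triv_scale a (triv_scale b t) = triv_scale (a * b) t.
Proof. by rewrite /triv_scale qcoef00M mulrA. Qed.
Fact triv_scale1 : left_id 1 triv_scale.
Proof. by move=> t; rewrite /triv_scale qcoef1 mul1r. Qed.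
Fact triv_scaleDr : right_distributive triv_scale +%R.
Proof. by move=> a s t; exact: mulrDr. Qed.
Fact triv_scaleDl t : {morph triv_scale^~ t : a b / a + b}.
Proof. by move=> a b; rewrite /triv_scale qcoefD mulrDl. Qed.
HB.instance Definition _ := GRing.Zmodule_isLmodule.Build B (triv qp)
  triv_scaleA triv_scale1 triv_scaleDr triv_scaleDl.

Definition triv1 : triv qp := (1 : k).

Lemma trivE (a : B) (t : triv qp) : a *: t = qcoef a 0 0 * (t : k) :> k.
Proof. by []. Qed.

Lemma triv_kscale l (t : triv qp) : kscale l t = l * (t : k) :> k.
Proof. by rewrite /kscale trivE qcoefZ qcoef1 mulr1. Qed.

Lemma triv_u (t : triv qp) : u *: t = 0.
Proof. by have := trivE u t; rewrite -[u in qcoef u]mulr1 qcoef_u mul0r. Qed.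
Lemma triv_v (t : triv qp) : v *: t = 0.
Proof. by have := trivE v t; rewrite -[v in qcoef v]mulr1 qcoef_v mul0r. Qed.

Local Notation T := (tens qp (triv qp)).
Local Notation e := (tens_unit qp triv1).

Lemma tens_unit_triv (t : triv qp) : tens_unit qp t = kscale (t : k) e.
Proof.
have {1}-> : t = kscale (t : k) triv1 by rewrite -[LHS]mulr1 -triv_kscale.
exact: (klinearZ (@tens_unit_klinear _ _ _ _ _ qp (triv qp))).
Qed.

(** B (x) k is free on e = 1 (x) 1, so its maps to B are the right
    multiplications triv_map w, e going to w. *)
Lemma triv_ext_uniq (N : lmodType B) (h h' : {linear T -> N}) : h e = h' e -> h =1 h'.
Proof.
by move=> he; apply: tens_ext_uniq => t; rewrite tens_unit_triv !linear_kscale he.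
Qed.

Fact triv_map_klinear (w : B) : klinear (fun t : triv qp => (t : k) *: w : B^o).
Proof.
move=> l t t'; rewrite /kscale -[RHS]/((l *: 1) * ((t : k) *: w) + (t' : k) *: w).
by rewrite -scalerAl mul1r scalerA -scalerDl -triv_kscale.
Qed.

Definition triv_map (w : B) : {linear T -> B^o} := tens_ext qp (triv_map_klinear w).

Lemma triv_map_unit w : triv_map w e = w.
Proof. by rewrite tens_ext_unit scale1r. Qed.

Lemma triv_mapE w (p : T) N : in_box N p ->
  triv_map w p = \sum_(i < N) \sum_(j < N) (p i j : k) *: (u ^+ i * v ^+ j * w).
Proof.
move=> pN; rewrite [in LHS](tens_sum pN) linear_sum; apply: eq_bigr => i _.
rewrite linear_sum; apply: eq_bigr => j _; rewrite linearZ tens_ext_unit.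
by rewrite -[LHS]/((u ^+ i * v ^+ j) * (_ *: w)) -scalerAr.
Qed.

Lemma kos_u_triv l (f : T) x y : kos_u qp (triv qp) l f x y =
  (if x is x'.+1 then kscale (l * c ^+ y) (f x' y) else 0).
Proof. by rewrite kos_uE triv_u subr0. Qed.
Lemma kos_v_triv l (f : T) x y : kos_v qp (triv qp) l f x y = (if y is y'.+1 then f x y' else 0).
Proof. by rewrite kos_vE triv_v kscaler0 subr0. Qed.

(** The Koszul differentials at the generator: on k the terms a (x) u m and
    a (x) v m vanish. *)
Lemma kos_u_e l : kos_u qp (triv qp) l e = (l *: u) *: e.
Proof.
rewrite kos_u_unit triv_u scale_scale -[RHS]subr0; congr (_ - _).
by apply: fs2P => x y; rewrite tens_unitE; case: ifP.
Qed.
Lemma kos_v_e l : kos_v qp (triv qp) l e = v *: e.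
Proof.
rewrite kos_v_unit triv_v -[RHS]subr0; congr (_ - _).
by apply: fs2P => x y; rewrite tens_kscale tens_unitE; case: ifP; rewrite kscaler0.
Qed.

Fact coord00_linear : linear (fun p : T => p 0%N 0%N).
Proof.
pose ev : {additive T -> triv qp} := HB.pack (fun p : T => p 0%N 0%N)
  (GRing.isAdditive.Build T (triv qp) (fun p : T => p 0%N 0%N) (fun p q => erefl)).
apply: (@qp_linear _ _ _ _ _ qp T (triv qp) ev) => [l p|p|p].
- exact: tens_kscale.
- by rewrite triv_u -[LHS]/((u *: p) 0%N 0%N) tens_u.
- by rewrite triv_v -[LHS]/((v *: p) 0%N 0%N) tens_v.
Qed.

Lemma kos_aug_triv (p : T) : kos_aug qp (triv qp) p = p 0%N 0%N.
Proof.
rewrite -[RHS](mklinE coord00_linear).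
by apply: triv_ext_uniq; rewrite kos_aug_unit mklinE.
Qed.

End Trivial.

(** * The graded Koszul resolution *)

Section KoszulGrading.
Variables (R : realType) (B : algType R[i]) (u v : B) (c : R[i]).
Hypothesis qp : qplane u v c.
Local Notation qcoef := (qcoef qp).
Variables (du dv : nat).
Hypotheses (du_gt0 : (0 < du)%N) (dv_gt0 : (0 < dv)%N).
Local Notation gr := (qgr qp du dv).
Local Notation deg := (qdeg du dv).
Local Notation T := (tens qp (triv qp)).
Local Notation e := (tens_unit qp (triv1 qp)).

(** The grading of the free module T whose generator sits in degree s. *)
Definition tgr (s m : int) : set T :=
  [set f | forall x y, f x y <> 0 -> m = s + deg x y]%classic.

Definition tgr_part (s m : int) (f : T) : T.
Proof.
refine (@Fs2 _ (fun x y => if m == s + deg x y then f x y else 0) _).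
apply/finite_boxP; have [N fN] := fs2_box f; exists N => i j ij.
by rewrite fN //; case: ifP.
Defined.

Fact coord_exists (t : nat * nat) : {p : {additive T -> triv qp} | forall f, p f = f t.1 t.2}.
Proof.
pose p : {additive T -> triv qp} := HB.pack (fun f : T => f t.1 t.2)
  (GRing.isAdditive.Build T (triv qp) (fun f : T => f t.1 t.2) (fun p q => erefl)).
by exists p.
Qed.

Definition coord t : {additive T -> triv qp} := sval (coord_exists t).
Lemma coordE t f : coord t f = f t.1 t.2.
Proof. by rewrite /coord; case: coord_exists. Qed.

Fact pcoord_exists (t : bool * (nat * nat)) :
  {p : {additive (T * T)%type -> triv qp} | forall f, p f = coord t.2 (if t.1 then f.1 else f.2)}.
Proof.
pose f0 (f : T * T) := coord t.2 (if t.1 then f.1 else f.2).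
have f0_add : {morph f0 : f g / f - g}.
  by move=> f g; rewrite /f0 -raddfB; case: t.1.
pose p : {additive (T * T)%type -> triv qp} :=
  HB.pack f0 (GRing.isAdditive.Build (T * T)%type (triv qp) f0 f0_add).
by exists p.
Qed.

Definition tdegrees s N : seq int := [seq s + m | m <- degrees du dv N].

Lemma mem_tdegrees s N (f : T) x y : in_box N f -> f x y <> 0 -> s + deg x y \in tdegrees s N.
Proof.
move=> fN fxy; apply: map_f; have /andP[iN jN] : (x < N)%N && (y < N)%N.
  by apply: contra_notT fxy; rewrite negb_and -!leqNgt; exact: fN.
exact: mem_degrees.
Qed.

Lemma tgr_graded s : graded_by (tgr s).
Proof.
apply: (@coord_graded T (triv qp) (nat * nat)%type coord (fun t => s + deg t.1 t.2)).
- move=> m f; split=> [gf [x y]|gf x y]; first by rewrite coordE; exact: gf.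
  by have := gf (x, y); rewrite coordE.
- by move=> f f0; apply: fs2P => x y; have := f0 (x, y); rewrite coordE.
- move=> f; have [N fN] := fs2_box f; exists (tdegrees s N), (fun m => tgr_part s m f); split.
  + by rewrite map_inj_uniq ?degrees_uniq //; exact: addrI.
  + by move=> [x y]; rewrite coordE; exact: mem_tdegrees.
  + by move=> m [x y]; rewrite !coordE.
Qed.

Lemma tgr2_graded s1 s2 : graded_by (fun m => [set p : T * T | tgr s1 m p.1 /\ tgr s2 m p.2]%classic).
Proof.
apply: (@coord_graded (T * T)%type (triv qp) (bool * (nat * nat))%type
  (fun t => sval (pcoord_exists t)) (fun t => (if t.1 then s1 else s2) + deg t.2.1 t.2.2)).
- move=> m f; split=> [[gf gf'] [b [x y]]|gf].
    by case: pcoord_exists => p /= ->; case: b; rewrite coordE; [exact: gf|exact: gf'].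
  split=> x y; first by have := gf (true, (x, y)); case: pcoord_exists => p /= ->; rewrite coordE.
  by have := gf (false, (x, y)); case: pcoord_exists => p /= ->; rewrite coordE.
- move=> [f g] f0; congr (_, _); apply: fs2P => x y.
    by have := f0 (true, (x, y)); case: pcoord_exists => p /= ->; rewrite coordE.
  by have := f0 (false, (x, y)); case: pcoord_exists => p /= ->; rewrite coordE.
- move=> [f g]; have [N fN] := fs2_box f; have [N' gN] := fs2_box g.
  exists (undup (tdegrees s1 N ++ tdegrees s2 N')), (fun m => (tgr_part s1 m f, tgr_part s2 m g)).
  split; first exact: undup_uniq.
  + move=> [b [x y]]; case: pcoord_exists => p /= ->; rewrite coordE mem_undup mem_cat.
    by case: b => /= [/(mem_tdegrees s1 fN)|/(mem_tdegrees s2 gN)] ->; rewrite ?orbT.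
  + by move=> m [b [x y]]; case: pcoord_exists => p /= pE; rewrite !pE; case: b {pE}; rewrite !coordE.
Qed.

Lemma tgr_scale s m l a (p : T) : gr m a -> tgr s l p -> tgr s (m + l) (a *: p).
Proof.
move=> ga gp x y; apply: contra_notP => ml.
rewrite -[LHS]/(tens_act qp a p x y); apply: big1 => i _; apply: big1 => j _.
have [->|/eqP aij] := eqVneq (qcoef a i j) 0; first by rewrite mul0r kscale0.
have [->|/eqP pij] := eqVneq (p (x - i)%N (y - j)%N) 0; first by rewrite kscaler0.
case: ml; rewrite (ga _ _ aij) (gp _ _ pij) addrCA -qdegD.
by rewrite !subnKC // -ltnS.
Qed.

Lemma tgr_unit s : tgr s s e.
Proof. by move=> [|x] [|y] //=; rewrite /qdeg !mul0n addr0. Qed.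

Lemma tgr0 s m : tgr s m 0. Proof. by case: (tgr_graded s) => /(_ m) []. Qed.

(** The shifts make the differentials of degree 0: the two generators in
    homological degree 1 correspond to u and v, the one in degree 2 to the
    relation, of degree du + dv. *)
Definition kos_gr (i : nat) : int -> set (kos_obj qp (triv qp) i) :=
  match i return int -> set (kos_obj qp (triv qp) i) with
  | 0 => tgr 0
  | 1 => fun m => [set p : T * T | tgr du m p.1 /\ tgr dv m p.2]%classic
  | 2 => tgr (du%:Z + dv%:Z)
  | _.+3 => fun _ => setT
  end.

Lemma kos_graded i : graded_module gr (@kos_gr i).
Proof.
case: i => [|[|[|i]]]; split.
- exact: tgr_graded.
- by move=> m l a p; exact: tgr_scale.
- exact: tgr2_graded.
- by move=> m l a p ga [gp gp']; split; exact: tgr_scale.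
- exact: tgr_graded.
- by move=> m l a p; exact: tgr_scale.
- split=> // [a|s d _ _ _ m _]; last exact: row0E.
  by exists [::], (fun _ => 0); split=> //; exact: row0E.
- by [].
Qed.

Lemma kos_gr_d i m (p : kos_obj qp (triv qp) i.+1) :
  @kos_gr i.+1 m p -> @kos_gr i m (kos_d qp (triv qp) i p).
Proof.
case: i p => [|[|i]] p gp.
- case: gp => gf gg; rewrite /= kos_d0E => x y.
  rewrite fs2D kos_u_triv kos_v_triv add0r.
  have [fz|/eqP fnz] := eqVneq (if x is x'.+1 then p.1 x' y else 0) 0.
    move=> H; have : (if y is y'.+1 then p.2 x y' else 0) <> 0.
      move=> gz; apply: H; rewrite gz addr0; case: x fz {gz} => // x ->; exact: kscaler0.
    by case: y {fz H} => // y /gg ->; rewrite qdegS'.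
  by move=> _; case: x fnz => // x /gf ->; rewrite qdegS.
- rewrite /= kos_d1E; split=> x y.
    rewrite -[X in X <> 0]/(- (kos_v qp (triv qp) c p x y)) kos_v_triv; case: y => [|y]; first by rewrite oppr0.
    by move=> H; rewrite (gp x y) ?qdegS' ?addrA // => p0; apply: H; rewrite p0 oppr0.
  rewrite -[X in X <> 0]/(kos_u qp (triv qp) c p x y) kos_u_triv; case: x => // x H.
  rewrite (gp x y) ?qdegS; first by rewrite addrA [dv%:Z + _]addrC.
  by move=> p0; apply: H; rewrite p0 kscaler0.
- by case: i p gp => [|i] p gp //=; exact: tgr0.
Qed.

Lemma kos_graded_resolution : graded_resolution gr (Q := koszul qp (triv qp)) kos_gr.
Proof.
split; [exact: kos_graded|exact: kos_gr_d|].
move=> m p /eqP m0 gp; rewrite -[LHS]/(kos_aug qp (triv qp) p) kos_aug_triv.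
apply/eqP; apply: contraTT isT => /eqP /gp mE.
by move: m0; rewrite mE add0r /qdeg !mul0n eqxx.
Qed.

Lemma hom_degree_map s m w : gr (s + m) w ->
  forall l (p : T), tgr s l p -> gr (l + m) (triv_map qp w p).
Proof.
move=> gw l p gp; have [N pN] := fs2_box p; rewrite (triv_mapE w pN).
apply: qgr_sum => // i _; apply: qgr_sum => // j _.
have [->|/eqP pij] := eqVneq (p i j) 0; first by rewrite scale0r; apply: qgr0.
rewrite (gp _ _ pij) [s + _]addrC -addrA; apply: qgrZ => //; apply: qgrM => //; exact: qgr_monomial.
Qed.

End KoszulGrading.

(** * Ext of the trivial module *)

Section Ext.
Variables (R : realType) (B : algType R[i]) (u v : B) (c : R[i]).
Hypothesis qp : qplane u v c.
Local Notation qcoef := (qcoef qp).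
Variables (du dv : nat).
Hypotheses (du_gt0 : (0 < du)%N) (dv_gt0 : (0 < dv)%N).
Local Notation gr := (qgr qp du dv).
Local Notation T := (tens qp (triv qp)).
Local Notation e := (tens_unit qp (triv1 qp)).
Local Notation Q := (koszul qp (triv qp)).
Local Notation grQ := (@kos_gr R B u v c qp du dv : forall i, int -> set (res_obj Q i)).

Lemma linear_pair (A : pzRingType) (U V N : lmodType A) (f : {linear (U * V)%type -> N}) :
  exists (f1 : {linear U -> N}) (f2 : {linear V -> N}),
    [/\ forall p, f p = f1 p.1 + f2 p.2, forall x, f1 x = f (x, 0) & forall y, f2 y = f (0, y)].
Proof.
have lin1 : linear (fun p => f (p, 0)).
  by move=> a x y; rewrite -linearP; congr (f (_, _)); rewrite /= scaler0 addr0.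
have lin2 : linear (fun q => f (0, q)).
  by move=> a x y; rewrite -linearP; congr (f (_, _)); rewrite /= scaler0 addr0.
exists (mklin lin1), (mklin lin2); split=> [[x y]|x|y]; rewrite ?mklinE //.
by rewrite -linearD; congr (f (_, _)); rewrite /= ?addr0 ?add0r.
Qed.

(** Under evaluation at generators, Hom (_, B) of the Koszul complex becomes
    B -> B^2 -> B with w |-> (u w, v w) and (a, b) |-> c u b - v a. Left
    multiplication by u is injective, and the middle exactness is qp_syzygy. *)
Lemma ext_vanish i m (f : {linear res_obj Q i -> B^o}) : i <> 2 ->
  ext_cocycle gr grQ m f -> ext_coboundary gr grQ m f.
Proof.
case: i f => [|[|[|i]]] // f _ [f_deg fd].
- move=> p; apply: (@triv_ext_uniq _ _ _ _ _ qp B^o (f : {linear T -> B^o}) \0).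
  have := fd (e, 0); rewrite -[res_d Q 0 _]/(kos_d0 qp (triv qp) (e, 0)) kos_d0E.
  rewrite linear0 addr0 /= kos_u_e linearZ scale1r; exact: (qp_lregu qp).
- have [f1 [f2 [fE f1E f2E]]] := linear_pair f.
  have : v * (f1 e : B) = c *: (u * (f2 e : B)).
    have := fd e; rewrite -[res_d Q 1 _]/(kos_d1 qp (triv qp) e) kos_d1E kos_v_e kos_u_e.
    rewrite fE /= linearN (linearZZ f1) (linearZZ f2) => /addr0_eq; rewrite opprK => vE.
    by rewrite -[LHS]/(v *: f1 e) vE scalerAl.
  move=> /(qp_syzygy qp)[w [aE bE]]; exists (triv_map qp w); split.
    apply: hom_degree_map => //; rewrite add0r; apply: (@qgr_u_inv _ _ _ _ _ qp du dv).
    rewrite -aE f1E; apply: f_deg; split; [exact: tgr_unit|exact: tgr0].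
  move=> p; rewrite fE -[res_d Q 0 p]/(kos_d0 qp (triv qp) p) kos_d0E linearD; congr (_ + _).
    apply: (@triv_ext_uniq _ _ _ _ _ qp B^o f1 (triv_map qp w \o kos_u qp (triv qp) 1)%FUN).
    by rewrite aE /= kos_u_e linearZ triv_map_unit scale1r.
  apply: (@triv_ext_uniq _ _ _ _ _ qp B^o f2 (triv_map qp w \o kos_v qp (triv qp) 1)%FUN).
  by rewrite bE /= kos_v_e linearZ triv_map_unit.
- exists \0; split=> [l p _|p]; first exact: qgr0.
  by rewrite (row0E p 0) linear0.
Qed.

(** The image of (a, b) |-> c u b - v a is the right ideal u B + v B, that is, by
    qgr_split, the elements with no constant term. *)
Lemma top_coboundary m (w : B) : gr (du%:Z + dv%:Z + m) w -> qcoef w 0 0 = 0 ->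
  exists g : {linear (T * T)%type -> B^o},
    hom_degree gr grQ (i := 1) m g /\ forall p, triv_map qp w p = g (kos_d1 qp (triv qp) p).
Proof.
move=> gw w0; have [a1 [a2 [g1 g2 wE]]] := qgr_split gw w0.
have gP1 : gr (du%:Z + m) (- a2).
  rewrite -sub0r; apply: qgrB => //; first exact: qgr0.
  by rewrite (_ : _ + m = du%:Z + dv%:Z + m - dv%:Z) //; lia.
have gP2 : gr (dv%:Z + m) (c^-1 *: a1).
  by apply: qgrZ => //; rewrite (_ : _ + m = du%:Z + dv%:Z + m - du%:Z) //; lia.
pose h1 := triv_map qp (- a2); pose h2 := triv_map qp (c^-1 *: a1).
have lin : linear (fun p : T * T => h1 p.1 + h2 p.2).
  by move=> a p q; rewrite /= !linearP scalerDr addrACA.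
exists (mklin lin); split=> [l p [gp gp']|p].
  by rewrite mklinE; apply: qgrD => //; apply: hom_degree_map gp || apply: hom_degree_map gp'.
apply: (@triv_ext_uniq _ _ _ _ _ qp B^o (triv_map qp w) (mklin lin \o kos_d1 qp (triv qp))%FUN).
rewrite triv_map_unit /= mklinE kos_d1E kos_v_e kos_u_e /=.
rewrite linearN (linearZZ h1) (linearZZ h2) !triv_map_unit wE.
rewrite -[RHS]/(- (v * (- a2)) + (c *: u) * (c^-1 *: a1)).
by rewrite mulrN opprK -scalerAl -scalerAr scalerA mulfV ?(qp_neq0 qp) // scale1r addrC.
Qed.

(** The cokernel of (a, b) |-> c u b - v a is B / (u B + v B) = k, spanned by the
    class of 1 in degree - (du + dv). *)
Lemma kos_ext_shift : ext_shift gr grQ 2 (du%:Z + dv%:Z).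
Proof.
split=> [i m f|]; first exact: ext_vanish.
have one_gr : gr (du%:Z + dv%:Z + - (du%:Z + dv%:Z)) 1.
  by rewrite subrr; apply/qgr_scalar => //; exists 1; rewrite scale1r.
have value m (f : {linear T -> B^o}) : hom_degree gr grQ (i := 2) m f -> gr (du%:Z + dv%:Z + m) (f e).
  by move=> fm; apply: fm; exact: tgr_unit.
have fE (f : {linear T -> B^o}) : f =1 triv_map qp (f e).
  by apply: triv_ext_uniq; rewrite triv_map_unit.
exists (triv_map qp 1); split.
- split; first by split=> [|p]; [exact: hom_degree_map|rewrite linear0].
  move=> [g [_ /(_ e)]]; rewrite triv_map_unit.
  rewrite -[res_d Q 1 _]/(kos_d1 qp (triv qp) e) kos_d1E kos_v_e kos_u_e.
  have [g1 [g2 [gE _ _]]] := linear_pair g; rewrite gE /= linearN (linearZZ g1) (linearZZ g2).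
  rewrite -[X in _ = X]/(- (v * (g1 e : B)) + (c *: u) * (g2 e : B)) => /(congr1 (fun b => qcoef b 0 0)).
  rewrite qcoef1 -scaleN1r -scalerAl qcoefD !qcoefZ qcoef_u qcoef_v !mulr0 addr0 => /eqP.
  by rewrite oner_eq0.
- move=> m f ml [fm _]; have gf := value _ _ fm.
  have f0 : qcoef (f e) 0 0 = 0.
    apply/eqP; apply: contra_notT ml => /eqP /gf; rewrite /qdeg !mul0n => H.
    by apply/eqP; rewrite -subr_eq0 opprK addrC H.
  have [g [gm gE]] := top_coboundary gf f0; exists g; split=> // p; rewrite fE; exact: gE.
- move=> f [fm _]; have := value _ _ fm; rewrite subrr => /qgr_scalar[] // l fl.
  exists l, \0; split=> [a b _|p]; first exact: qgr0.
  rewrite /= fE fl; apply/eqP; rewrite subr_eq0; apply/eqP.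
  have [N pN] := fs2_box p; rewrite !(triv_mapE _ pN) scaler_sumr; apply: eq_bigr => i _.
  rewrite scaler_sumr; apply: eq_bigr => j _; rewrite -scalerAr !scalerA; congr (_ *: _).
  exact: mulrC.
- move=> m a m0 ga; have a0 : qcoef a 0 0 = 0.
    by apply/eqP; apply: contraTT m0 => /eqP /ga ->.
  have ga' : gr (du%:Z + dv%:Z + (m - (du%:Z + dv%:Z))) a by rewrite addrC subrK.
  have [g [gm gE]] := top_coboundary ga' a0; exists g; split=> // p; rewrite -gE.
  have [N pN] := fs2_box p; rewrite !(triv_mapE _ pN) mulr_suml; apply: eq_bigr => i _.
  by rewrite mulr_suml; apply: eq_bigr => j _; rewrite -scalerAl mulr1.
Qed.

End Ext.

(** * Global dimension *)

Section Pullback.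
Variables (A : pzRingType) (P M N : lmodType A) (f : {linear M -> N}) (g : {linear P -> N}).

Definition pullback_pred : {pred (P * M)%type} := fun x => f x.2 == g x.1.

Fact pullback_closed : GRing.submod_closed pullback_pred.
Proof.
split=> [|a x y]; rewrite !unfold_in; first by rewrite /= !linear0.
by move=> /eqP xE /eqP yE; rewrite /= !linearP xE yE.
Qed.
HB.instance Definition _ := GRing.isSubmodClosed.Build A (P * M)%type pullback_pred pullback_closed.

Record pullback := Pullback { pullback_val : P * M; _ : pullback_val \in pullback_pred }.
HB.instance Definition _ := [isSub for pullback_val].
HB.instance Definition _ := [Choice of pullback by <:].
HB.instance Definition _ := [SubChoice_isSubLmodule of pullback by <:].

(** Projectivity lifts along a map that only covers the image of g, because
    P x_N M -> P is onto and hence split. *)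
Lemma projective_lift : projective P -> (forall p, exists m, f m = g p) ->
  exists h : {linear P -> M}, forall p, f (h p) = g p.
Proof.
move=> projP fg.
have lin1 : linear (fun x : pullback => (val x).1) by [].
have lin2 : linear (fun x : pullback => (val x).2) by [].
have [p|s sE] := projP _ _ (mklin lin1) idfun.
  have [m fm] := fg p; have mp : (p, m) \in pullback_pred by rewrite unfold_in /= fm.
  by exists (Pullback mp); rewrite mklinE.
exists (mklin lin2 \o s)%FUN => p; rewrite /= mklinE.
have := sE p; rewrite mklinE /= => {2}<-; apply/eqP; exact: (valP (s p)).
Qed.
End Pullback.

Section GlobalDimension.
Variables (k : fieldType) (B : algType k) (u v : B) (c : k).
Hypothesis qp : qplane u v c.

(** The lower bound compares the Koszul resolution of k with a hypothetical
    resolution of length one: the identity of the former would be homotopic to a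
    map vanishing in degree 2, so the last differential would split. Modulo
    u and v that differential is zero, which is absurd. *)
Lemma qp_gldim_ge2 d : gldim_le B d -> (2 <= d)%N.
Proof.
move=> gl; rewrite leqNgt; apply/negP => d2.
pose T := triv qp; have [Q Q0] := gl T.
have Q2 (p : res_obj Q 2) : p = 0 by apply: Q0.
pose K0 := tens qp T; pose K1 := (K0 * K0)%type.
pose aug := kos_aug qp T; pose d0 := kos_d0 qp T; pose d1 := kos_d1 qp T.
have pK0 : projective K0 by exact: tens_projective.
have pK1 : projective K1 by exact: projective_prod.
have exK0 (p : K0) : aug p = 0 <-> exists p' : K1, d0 p' = p := kos_exact0 (p : kos_obj qp T 0).
have exK1 (p : K1) : d0 p = 0 <-> exists p' : K0, d1 p' = p := kos_exact (p : kos_obj qp T 1).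
have injK (p : K0) : d1 p = 0 -> p = 0.
  by move=> /(kos_exact (p : kos_obj qp T 2)) [p' <-].
have injQ (p : res_obj Q 1) : res_d Q 0 p = 0 -> p = 0.
  by move=> /res_exact[p' <-]; rewrite (Q2 p') linear0.
have [p|f0 f0E] := @projective_lift _ _ _ _ (res_aug Q) aug pK0; first exact: res_surj.
have [p|f1 f1E] := @projective_lift _ _ _ _ (res_d Q 0) (f0 \o d0)%FUN pK1.
  by apply/res_exact0; rewrite /= f0E; apply/exK0; exists p.
have f1d1 p : f1 (d1 p) = 0.
  apply: injQ; rewrite f1E /=; have -> : d0 (d1 p) = 0 by apply/exK1; exists p.
  exact: linear0.
have [p|g0 g0E] := @projective_lift _ _ _ _ aug (res_aug Q) (@res_projective _ _ Q 0).
  by exists (tens_unit qp (res_aug Q p)); exact: kos_aug_unit.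
have [p|g1 g1E] := @projective_lift _ _ _ _ d0 (g0 \o res_d Q 0)%FUN (@res_projective _ _ Q 1).
  by apply/exK0; rewrite /= g0E; apply/res_exact0; exists p.
have [p|h0 h0E] := @projective_lift _ _ _ _ d0 (idfun \- (g0 \o f0))%FUN pK0.
  by apply/exK0; rewrite /= linearB g0E f0E subrr.
have [p|h1 h1E] := @projective_lift _ _ _ _ d1 (idfun \- (g1 \o f1) \- (h0 \o d0))%FUN pK1.
  by apply/exK1; rewrite /= !linearB g1E h0E /= f1E /= subrr.
pose e := tens_unit qp (triv1 qp).
have he : h1 (d1 e) = e.
  apply/eqP; rewrite -subr_eq0; apply/eqP/injK; rewrite linearB h1E /= f1d1.
  have -> : d0 (d1 e) = 0 by apply/exK1; exists e.
  by rewrite (linear0 g1) (linear0 h0) !subr0 subrr.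
have : e 0%N 0%N = 0.
  rewrite -he /d1 kos_d1E kos_v_e kos_u_e.
  have [g [g' [hE _ _]]] := linear_pair h1; rewrite hE /= linearN (linearZZ g) (linearZZ g').
  rewrite -[LHS]/(- ((v *: (g e : tens qp T)) 0%N 0%N) +
    ((c *: u) *: (g' e : tens qp T)) 0%N 0%N).
  by rewrite tens_v oppr0 add0r scale_scale tens_kscale tens_u kscaler0.
by move=> /eqP; rewrite oner_eq0.
Qed.

Lemma qp_gldim : gldim_eq B 2.
Proof. by split; [exact: qp_gldim_le2 qp|exact: qp_gldim_ge2]. Qed.

End GlobalDimension.

(** * Gelfand-Kirillov dimension and AS regularity *)

Section GKDimension.
Variables (R : realType) (B : algType R[i]) (u v : B) (c : R[i]).
Hypothesis qp : qplane u v c.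
Local Notation qcoef := (qcoef qp).

(** The filtration by total degree, whose m-th step has dimension at most
    (m + 1)^2. *)
Definition qfilt (m : nat) (a : B) := forall i j, qcoef a i j <> 0 -> (i + j <= m)%N.

Lemma qfilt_le m m' a : (m <= m')%N -> qfilt m a -> qfilt m' a.
Proof. by move=> mm' fa i j /fa /leq_trans; apply. Qed.

Lemma qfilt_sum m I (r : seq I) (P : pred I) (F : I -> B) :
  (forall x, P x -> qfilt m (F x)) -> qfilt m (\sum_(x <- r | P x) F x).
Proof.
move=> FP i j; rewrite qcoef_sum => H; apply: contra_notT H => ij.
apply: big1 => x Px; apply/eqP; apply: contraNT ij => /eqP; exact: FP.
Qed.

Lemma qfiltM m m' a b : qfilt m a -> qfilt m' b -> qfilt (m + m') (a * b).
Proof.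
move=> fa fb; rewrite [a in a * _](qcoefK (leqnn (qcoef_bound qp a)))
  [b in _ * b](qcoefK (leqnn (qcoef_bound qp b))).
rewrite /monomial_sum mulr_suml; apply: qfilt_sum => i _.
rewrite mulr_suml; apply: qfilt_sum => j _; rewrite mulr_sumr; apply: qfilt_sum => i' _.
rewrite mulr_sumr; apply: qfilt_sum => j' _ x y.
rewrite -scalerAl -scalerAr scalerA -mulrA [v ^+ j * _]mulrA (vXuX qp) -scalerAl -scalerAr.
rewrite !mulrA -exprD -mulrA -exprD !qcoefZ qcoef_monomial => H.
have [/eqP|/eqP/fa aij] := eqVneq (qcoef a i j) 0; first by move/eqP=> a0; case: H; rewrite a0 !mul0r.
have [/eqP|/eqP/fb bij] := eqVneq (qcoef b i' j') 0; first by move/eqP=> b0; case: H; rewrite b0 mulr0 mul0r.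
move: H; case: eqP => [->|]; last by rewrite !mulr0.
case: eqP => [->|]; last by rewrite !mulr0.
by rewrite addnACA leq_add.
Qed.

Lemma qfilt_words (s : seq B) : exists D, forall n w, w \in words s n -> qfilt (D * n) w.
Proof.
pose D := (\sum_(a <- s) 2 * qcoef_bound qp a)%N.
have sD a : a \in s -> qfilt D a.
  move=> a_s i j aij; have /andP[iN jN] : (i < qcoef_bound qp a)%N && (j < qcoef_bound qp a)%N.
    by apply: contra_notT aij; rewrite negb_and -!leqNgt; exact: qcoef_box.
  rewrite /D (big_rem a) //= (leq_trans (leq_add (ltnW iN) (ltnW jN))) //.
  by rewrite addnn mul2n leq_addr.
exists D; elim=> [|n IH] w /=.
  rewrite mem_seq1 => /eqP -> i j; rewrite qcoef1.
  by case: i => [|i]; case: j => [|j].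
rewrite mem_cat => /orP[/IH|/allpairsP[[a b] /= [/sD fa /IH fb ->]]].
  by apply: qfilt_le; rewrite leq_mul2l leqnSn orbT.
by rewrite mulnS; exact: qfiltM.
Qed.

Lemma free_family_size (t : seq B) m : (forall a, a \in t -> qfilt m a) ->
  free_family t -> (size t <= m.+1 * m.+1)%N.
Proof.
move=> tm t_free.
pose A := \matrix_(r < size t) mxvec (\matrix_(i < m.+1, j < m.+1) qcoef t`_r i j).
suff : row_free A by move=> /eqP <-; exact: rank_leq_col.
apply: inj_row_free => w wA; apply/rowP => r; rewrite mxE; move: r.
apply: t_free; apply: (@qcoef_inj _ _ _ _ _ qp) => i j; rewrite qcoef0 qcoef_sum.
have [/andP[im jm]|ij] := boolP ((i < m.+1)%N && (j < m.+1)%N).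
  have := congr1 (fun M : 'rV_(m.+1 * m.+1) => M 0 (mxvec_index (Ordinal im) (Ordinal jm))) wA.
  rewrite [X in _ = X -> _]mxE mxE => H; rewrite -[RHS]H; apply: eq_bigr => r _.
  by rewrite !mxE mxvecE mxE qcoefZ.
apply: big1 => r _; rewrite qcoefZ; apply/eqP; rewrite mulf_eq0; apply/orP; right.
apply: contraNT ij => /eqP /(tm _ (mem_nth _ (ltn_ord r))) ij_le; rewrite !ltnS.
by rewrite (leq_trans (leq_addr _ _) ij_le) (leq_trans (leq_addl _ _) ij_le).
Qed.

Lemma span_dim_le (s : seq B) m : (forall a, a \in s -> qfilt m a) ->
  (span_dim s <= m.+1 * m.+1)%N.
Proof.
move=> sm; apply/bigmax_leqP => b /asboolP; apply: free_family_size => a.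
by move=> /mem_mask; exact: sm.
Qed.

(** Words of length n in a finite set have degree O(n), hence span a space of
    dimension O(n^2), which n^3 dominates for n large. *)
Lemma qp_GKdim : (GKdim B < +oo)%E.
Proof.
apply: (@le_lt_trans _ _ (3%:E)); last exact: ltry.
apply: ge_ereal_sup => _ [s _ <-]; have [D DP] := qfilt_words s.
(* for n >= N the bound (D n + 1)^2 <= (D + 1)^2 n^2 is at most n^3 *)
pose N := (D.+1 * D.+1).+2.
apply: ereal_inf_le; eexists; first by exists [set n | (N <= n)%N]%classic; [exists N|reflexivity].
apply: ge_ereal_sup => _ [n /= Nn <-]; rewrite lee_fin.
have n1 : (1 < n)%N by apply: leq_trans Nn.
have lnn : 0 < ln (n%:R : R) by rewrite ln_gt0 // ltr1n.
rewrite ler_pdivrMr //.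
have dim_le : (span_dim (words s n) <= n ^ 3)%N.
  apply: leq_trans (span_dim_le (DP n)) _.
  have Dn : ((D * n).+1 <= D.+1 * n)%N by rewrite mulSn -add1n leq_add2r ltnW.
  apply: leq_trans (leq_mul Dn Dn) _; rewrite mulnACA expnS mulnn leq_mul //.
  by apply: leq_trans Nn; rewrite /N -mulnn; lia.
have [->|dim_gt0] := posnP (span_dim (words s n)).
  by rewrite ln0 // mulr_ge0 // ltW.
have -> : 3 * ln (n%:R : R) = ln ((n ^ 3)%:R).
  by rewrite natrX lnXn ?mulr_natl // ltr0n ltnW.
by rewrite ler_ln ?posrE ?ltr0n ?ler_nat // expn_gt0 ltnW.
Qed.

End GKDimension.

Section ASRegularity.
Variables (R : realType) (B : algType R[i]) (u v : B) (c : R[i]) (du dv : nat).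
Hypotheses (qp : qplane u v c) (du_gt0 : (0 < du)%N) (dv_gt0 : (0 < dv)%N).

(** The homological conditions are read off the Koszul resolution; the degrees
    of the generators only shift Ext. *)
Theorem qp_AS_regular : AS_regular (qgr qp du dv) 2.
Proof.
split.
- split; [exact: qgr_graded|exact: qgrM|move=> a; exact: qgr_scalar|exact: qgr_neg].
- exact: qp_gldim qp.
- exact: qp_GKdim qp.
- exists (triv qp), (triv1 qp), (koszul qp (triv qp)), (@kos_gr R B u v c qp du dv),
    (du%:Z + dv%:Z); split.
  + split; first by move=> /eqP; rewrite oner_eq0.
      by move=> t; exists t; rewrite -[RHS]/(kscale _ _) triv_kscale mulr1.
    move=> m a m0 ga; rewrite -[LHS]/(qcoef qp a 0 0 * 1) mulr1.
    by apply/eqP; apply: contraTT m0 => /eqP /ga ->.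
  + exact: kos_graded_resolution.
  + exact: kos_ext_shift.
Qed.

End ASRegularity.

(** * Roots of unity *)

Section Roots.
Variable R : realType.
Local Notation k := R[i].

Lemma expiD (s t : R) : expi (s + t) = expi s * expi t.
Proof. by rewrite /expi cosD sinD; apply/eqP; rewrite eq_complex /=; apply/andP; split; apply/eqP; ring. Qed.

Lemma expiM (m : nat) (t : R) : expi (m%:R * t) = expi t ^+ m.
Proof.
elim: m => [|m IH]; first by rewrite mul0r /expi cos0 sin0.
by rewrite exprS -IH -expiD -natr1 mulrDl mul1r addrC.
Qed.

Lemma expi_pi : expi (pi : R) = -1.
Proof. by rewrite /expi cospi sinpi; apply/eqP; rewrite eq_complex /= oppr0 !eqxx. Qed.

Lemma expi_2pi : expi (2 * pi : R) = 1.
Proof. by rewrite expiM expi_pi sqrrN expr1n. Qed.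

Variable n : nat.
Hypothesis n_ge2 : (2 <= n)%N.
Local Notation q := (qroot R n).

Let n_neq0 : n%:R != 0 :> R.
Proof. by rewrite pnatr_eq0 -lt0n ltnW. Qed.

Lemma qroot_expn : q ^+ n = 1.
Proof. by rewrite /qroot -expiM mulrC divfK // expi_2pi. Qed.

(** If the order m of q were smaller than n, then q^m = 1 would have real part
    cos (2 t) with 0 < t = m pi / n < pi, whereas cos (2 t) = 1 - 2 sin^2 t < 1. *)
Lemma qroot_prim : n.-primitive_root q.
Proof.
have [m m_prim m_dvd] := prim_order_exists (ltnW n_ge2) qroot_expn.
suff mn : m = n by rewrite -[X in X.-primitive_root _]mn.
apply/eqP; rewrite eqn_leq dvdn_leq ?(ltnW n_ge2) //= leqNgt; apply/negP => mn.
have m_gt0 := prim_order_gt0 m_prim.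
have := prim_expr_order m_prim; rewrite /qroot -expiM => /(congr1 (@complex.Re R)) /=.
pose t : R := m%:R * pi / n%:R.
have -> : m%:R * (2 * pi / n%:R) = t *+ 2 :> R by rewrite /t -mulr_natl; field.
have t_gt0 : 0 < t by rewrite !mulr_gt0 ?ltr0n ?invr_gt0 ?pi_gt0 ?ltr0n ?(ltnW n_ge2).
have t_lt : t < pi by rewrite /t ltr_pdivrMr ?ltr0n ?(ltnW n_ge2) // mulrC ltr_pM2l ?pi_gt0 // ltr_nat.
have sin_t : 0 < sin t by rewrite sin_gt0_pi // t_gt0 t_lt.
rewrite cos_mulr2n => cos_t; have := cos2Dsin2 t; have : 0 < sin t ^+ 2 by rewrite exprn_gt0.
lra.
Qed.

Lemma qroot_eq1 m : (q ^+ m == 1) = (n %| m)%N.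
Proof. by rewrite -(prim_order_dvd qroot_prim). Qed.

Lemma qroot_neq0 : q != 0.
Proof.
apply/eqP => q0; have /eqP := qroot_expn.
by rewrite q0 expr0n gtn_eqF ?(ltnW n_ge2) // eq_sym oner_eq0.
Qed.

Lemma qroot_sum m : \sum_(r < n) q ^+ (r * m) = if (n %| m)%N then n%:R else 0.
Proof.
under eq_bigr do rewrite mulnC exprM.
case: ifP => nm.
  move: nm; rewrite -qroot_eq1 => /eqP ->.
  by under eq_bigr do rewrite expr1n; rewrite sumr_const card_ord.
have : (q ^+ m - 1) * \sum_(r < n) (q ^+ m) ^+ r = 0.
  by rewrite -subrX1 -exprM mulnC exprM qroot_expn expr1n subrr.
by move=> /eqP; rewrite mulf_eq0 subr_eq0 qroot_eq1 nm => /eqP.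
Qed.

Lemma proot_sqr : proot R n ^+ 2 = q.
Proof. by rewrite /proot sqrrN -expiM mulrA. Qed.

Lemma proot_expn : proot R n ^+ n = (-1) ^+ n.+1.
Proof. by rewrite /proot [(- expi _) ^+ n]exprNn -expiM mulrCA divff // mulr1 expi_pi exprSr. Qed.

Lemma proot_neq0 : proot R n != 0.
Proof. by have := qroot_neq0; rewrite -proot_sqr expf_eq0. Qed.

End Roots.

(** * Presentations by generators and relations *)

Lemma sum_scale_mul (k : fieldType) (A : lalgType k) (I : Type) (s s' : seq I)
    (al be : I -> k) (x y : I -> A) (r : A) :
  (forall (c : k) (f g : A), f * (c *: g) = c *: (f * g)) ->
  (\sum_(w <- s) al w *: x w) * r * (\sum_(w <- s') be w *: y w) =
  \sum_(w <- s) \sum_(w' <- s') al w *: (be w' *: (x w * r * y w')).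
Proof.
move=> scAr; rewrite !mulr_suml; apply: eq_bigr => w _; rewrite mulr_sumr.
by apply: eq_bigr => w' _; rewrite scAr -!scalerAl !scalerA mulrC.
Qed.

Section FreeAlgebra.
Variables (k : fieldType) (I : choiceType).
Local Notation F := (free_alg k I).
Local Notation word s := (\prod_(i <- s) free_gen k i : F).

Lemma free_monomial (w : fmonom I) : mkmalgU w 1 = word (fmonom_val w).
Proof.
case: w => s /=; elim: s => [|i s IH]; first by rewrite big_nil -fmoneE.
by rewrite big_cons -IH -[RHS]/(fgmul _ _) fgmulUU mulr1 -[mmul _ _]/(fmmul _ _) fmmulE fmuE.
Qed.

Lemma free_expand (f : F) : f = \sum_(w <- finmap.enum_fset (monalg.msupp f)) monalg.mcoeff w f *: word (fmonom_val w).
Proof.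
rewrite [LHS]monalgE; apply: eq_bigr => w _.
rewrite [LHS](_ : _ = monalg.mcoeff w f *: mkmalgU w 1); first by congr (_ *: _); exact: free_monomial.
by apply/malgP => w'; rewrite monalg.mcoeffZ !monalg.mcoeffU mulr_natr.
Qed.

(** The free algebra is an algebra over its commutative base: scalars also move
    out of the right factor. *)
Lemma malg_scalerAr (c : k) (f g : malg (fmonom I) k) : f * (c *: g) = c *: (f * g).
Proof.
rewrite !malgM_def (fgmulrw (finmap.fsubset_refl _) (monalg.msuppZ_le c g)).
rewrite (fgmulrw (finmap.fsubset_refl (monalg.msupp f)) (finmap.fsubset_refl (monalg.msupp g))).
rewrite scaler_sumr; apply: eq_bigr => w _; rewrite scaler_sumr; apply: eq_bigr => w' _.
by apply/malgP => m; rewrite !monalg.mcoeffZ !monalg.mcoeffU mulrCA mulrnAr.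
Qed.

Lemma free_scalerAr (c : k) (f g : F) : f * (c *: g) = c *: (f * g).
Proof. exact: malg_scalerAr. Qed.

Lemma ideal_rel rels r : r \in rels -> @generated_ideal k I rels r.
Proof.
move=> r_in; exists [:: (1, r, 1)]; split=> [t|]; last by rewrite big_seq1 mul1r mulr1.
by rewrite mem_seq1 => /eqP ->.
Qed.

(** The ideal of the relations is spanned by their products with two words. *)
Lemma ideal_kill (V : lmodType k) (L : {linear F -> V}) rels :
  (forall r s t, r \in rels -> L (word s * r * word t) = 0) ->
  forall f, generated_ideal rels f -> L f = 0.
Proof.
move=> Lr _ [s [s_rels ->]]; rewrite linear_sum big_seq big1 // => -[[a r] b] /s_rels /= r_in.
rewrite [a]free_expand [b]free_expand (sum_scale_mul _ _ _ _ _ _ _ free_scalerAr) linear_sum.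
apply: big1 => w _; rewrite linear_sum; apply: big1 => w' _.
have := Lr r (fmonom_val w) (fmonom_val w') r_in; set m := (_ * r * _) => Lm.
by rewrite (linearZZ L) (linearZZ L) Lm !scaler0.
Qed.

Section Presented.
Variables (rels : seq F) (A : algType k) (g : I -> A) (pA : presented rels g).

Lemma presented_rel : exists phi : {lrmorphism F -> A},
  (forall i, phi (free_gen k i) = g i) /\ (forall r, r \in rels -> phi r = 0).
Proof.
case: pA => phi [phi_g _ phi0]; exists phi; split=> // r /ideal_rel; by move/phi0.
Qed.

Lemma presented_span a : exists s : seq (k * seq I),
  a = \sum_(t <- s) t.1 *: \prod_(i <- t.2) g i.
Proof.
case: pA => phi [phi_g phi_surj _]; have [f <-] := phi_surj a.
exists [seq (monalg.mcoeff w f, fmonom_val w) | w <- finmap.enum_fset (monalg.msupp f)].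
rewrite [f in LHS]free_expand linear_sum big_map; apply: eq_bigr => w _.
rewrite linearZ rmorph_prod; congr (_ *: _).
by apply: eq_bigr => i _; exact: phi_g.
Qed.

End Presented.
End FreeAlgebra.

(** * The presented quantum plane *)

Lemma ord2 (l : 'I_2) : l = 0 \/ l = 1.
Proof. by case: l => -[|[|//]] lt2; [left|right]; exact: val_inj. Qed.

(** F stands for the free algebra, phi for its projection on A, and L for a
    linear form on F. *)
Section Images.
Variables (k : fieldType) (F : lalgType k) (A : algType k) (phi : {lrmorphism F -> A}).

Lemma lrmorph_rel (c : k) (U V : F) :
  phi (c *: (U * V) - V * U) = 0 -> phi V * phi U = c *: (phi U * phi V).
Proof. by rewrite linearB linearZ !rmorphM => /eqP; rewrite subr_eq0 => /eqP. Qed.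

Lemma lrmorph_sum (U V : F) N (e : nat -> nat -> k) :
  phi (\sum_(x < N) \sum_(y < N) e x y *: (U ^+ x * V ^+ y)) =
  monomial_sum (phi U) (phi V) N e.
Proof.
rewrite linear_sum; apply: eq_bigr => x _; rewrite linear_sum; apply: eq_bigr => y _.
by rewrite linearZ rmorphM !rmorphXn.
Qed.

Hypothesis scAr : forall (c : k) (f g : F), f * (c *: g) = c *: (f * g).
Variables (I : Type) (g : I -> F) (L : {linear F -> k^o}).
Local Notation word s := (\prod_(i <- s) g i).

Lemma linear_middle_rel (c : k) s t x y :
  L (word s * (c *: (g x * g y) - g y * g x) * word t) =
  c * L (word (s ++ x :: y :: t)) - L (word (s ++ y :: x :: t)).
Proof.
rewrite mulrBr mulrBl scAr -scalerAl linearB linearZZ !big_cat !big_cons /=.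
by rewrite !mulrA.
Qed.

Lemma linear_normal_sum N (e : nat -> nat -> k) x y :
  L (\sum_(i < N) \sum_(j < N) e i j *: (g x ^+ i * g y ^+ j)) =
  \sum_(i < N) \sum_(j < N) e i j * L (word (nseq i x ++ nseq j y)).
Proof.
rewrite linear_sum; apply: eq_bigr => i _; rewrite linear_sum; apply: eq_bigr => j _.
by rewrite linearZZ big_cat /= !big_nseq -!Monoid.iteropE.
Qed.
End Images.

Section QuantumPlanePresentation.
Variables (R : realType).
Local Notation k := R[i].
Variables (c : k) (A : algType k) (u v : A).
Hypotheses (c_neq0 : c != 0) (pA : presented (quantum_plane_rels c) (tnth [tuple u; v])).
Local Notation F := (free_alg k 'I_2).
Local Notation U := (free_gen k (0 : 'I_2)).
Local Notation V := (free_gen k (1 : 'I_2)).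
Local Notation word s := (\prod_(i <- s) free_gen k i : F).

Lemma pres_comm : v * u = c *: (u * v).
Proof.
have [phi [phi_g phi_rel]] := presented_rel pA.
have /lrmorph_rel := phi_rel _ (mem_head _ _).
by rewrite (phi_g 0) (phi_g 1).
Qed.

Lemma word_monomial (s : seq 'I_2) : exists e i j,
  [/\ \prod_(x <- s) tnth [tuple u; v] x = c ^+ e *: (u ^+ i * v ^+ j),
      count_mem 0 s = i & count_mem 1 s = j].
Proof.
elim: s => [|x s [e [i [j [IH c0 c1]]]]].
  by exists 0%N, 0%N, 0%N; rewrite big_nil mulr1 scale1r.
rewrite big_cons IH -scalerAr /=; have [->|->] := ord2 x.
  by exists e, i.+1, j; rewrite c0 c1; split; rewrite // mulrA -exprS.
exists (e + i)%N, i, j.+1; rewrite c0 c1; split=> //.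
by rewrite -[tnth _ _]/v mulrA (comm_vXu _ pres_comm) -scalerAl scalerA -exprD -mulrA -exprS.
Qed.

Lemma pres_span a : exists N e, a = monomial_sum u v N e.
Proof.
have [s ->] := presented_span pA a; elim: s => [|[l w] s [N [e IH]]].
  by exists 0%N, (fun _ _ => 0); rewrite big_nil /monomial_sum big_ord0.
rewrite big_cons IH /=; have [d [i [j [-> _ _]]]] := word_monomial w.
pose e' x y := l * c ^+ d * ((x == i) && (y == j))%:R.
pose N' := maxn N (maxn i j).+1.
have [iN jN] : (i < N')%N /\ (j < N')%N by rewrite /N' !leq_max !ltnS !leq_max !leqnn !orbT.
pose e0 x y := if (x < N)%N && (y < N)%N then e x y else 0.
have e0N : in_box N e0.
  by move=> x y; rewrite /e0 [(N <= x)%N]leqNgt [(N <= y)%N]leqNgt -negb_and => /negPf ->.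
exists N', (fun x y => 1 * e' x y + e0 x y).
rewrite monomial_sum_linear scale1r (monomial_sum_widen u v e0N) ?leq_maxl //; congr (_ + _).
  rewrite /monomial_sum -(box_sum_delta (fun i j => u ^+ i * v ^+ j) iN jN).
  rewrite scalerA scaler_sumr; apply: eq_bigr => x _; rewrite scaler_sumr; apply: eq_bigr => y _.
  by rewrite /e' -scaler_nat scalerA.
by apply: monomial_sum_eq => x y xN yN; rewrite /e0 xN yN.
Qed.

(** The exponent of c picked up when a word is reordered as u^i v^j. *)
Fixpoint inversions (s : seq 'I_2) : nat :=
  if s is x :: s' then ((x == 1%R) * count_mem 0%R s' + inversions s')%N else 0%N.

Lemma inversions_cat s t :
  inversions (s ++ t) = (inversions s + inversions t + count_mem 1%R s * count_mem 0%R t)%N.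
Proof. by elim: s => [|x s IH] /=; rewrite ?mul0n ?addn0 // IH count_cat; ring. Qed.

(** The coefficient of u^x v^y in the normal form of a word. It is the linear
    form showing that no nontrivial combination of normal monomials lies in the
    ideal: it kills the relation in every context (normal_coef_rel) and is a
    Kronecker delta on normal words (normal_coef_sorted). *)
Definition normal_coef (x y : nat) (s : seq 'I_2) : k :=
  if (count_mem 0 s == x) && (count_mem 1 s == y) then c ^+ inversions s else 0.

Lemma normal_coef_rel x y s t : normal_coef x y (s ++ 1 :: 0 :: t) =
  c * normal_coef x y (s ++ 0 :: 1 :: t).
Proof.
have c0 : count_mem 0 (s ++ 1 :: 0 :: t) = count_mem 0 (s ++ 0 :: 1 :: t).
  by rewrite !count_cat.
have c1 : count_mem 1 (s ++ 1 :: 0 :: t) = count_mem 1 (s ++ 0 :: 1 :: t).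
  by rewrite !count_cat.
have inv : inversions (s ++ 1 :: 0 :: t) = (inversions (s ++ 0 :: 1 :: t)).+1.
  by rewrite !inversions_cat /=; lia.
by rewrite /normal_coef c0 c1 inv; case: ifP; rewrite ?mulr0 // exprS.
Qed.

Lemma normal_coef_sorted x y i j :
  normal_coef x y (nseq i 0 ++ nseq j 1) = ((i == x) && (j == y))%:R.
Proof.
rewrite /normal_coef !count_cat !count_nseq /= !mul1n !mul0n addn0 add0n.
case: ifP => // _; have inv0 m (a : 'I_2) : inversions (nseq m a) = 0%N.
  elim: m => //= m ->; rewrite addn0 count_nseq.
  by case: eqP => // ->; rewrite mul0n.
by rewrite inversions_cat !inv0 !count_nseq /= !mul0n.
Qed.

Let nf_fun (x y : nat) : malg (fmonom 'I_2) k -> k :=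
  monalg.mmap (idfun : {additive k -> k}) (fun w => normal_coef x y (fmonom_val w)).

Fact nf_linear x y : linear (nf_fun x y : F -> k^o).
Proof.
move=> a f g; rewrite /nf_fun monalg.mmapD; congr (_ + _).
rewrite (monalg.mmapEw (monalg.msuppZ_le _ _)) monalg.mmapE scaler_sumr.
by apply: eq_bigr => w _; rewrite monalg.mcoeffZ; exact: esym (mulrA _ _ _).
Qed.

Definition nf x y : {linear F -> k^o} := mklin (nf_linear x y).

Lemma nf_word x y (s : seq 'I_2) : nf x y (word s) = normal_coef x y s.
Proof.
rewrite mklinE; have -> : word s = mkmalgU (FMonom s) 1 by rewrite free_monomial.
by rewrite /nf_fun monalg.mmapU mul1r.
Qed.

Lemma pres_free N e : monomial_sum u v N e = 0 ->
  forall i j, (i < N)%N -> (j < N)%N -> e i j = 0.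
Proof.
move=> e0 i j iN jN; have [phi [phi_g _ phi0]] := pA.
have phiUV : phi U = u /\ phi V = v by split; exact: phi_g.
pose f : F := \sum_(x < N) \sum_(y < N) e x y *: (U ^+ x * V ^+ y).
have /phi0 f_ideal : phi f = 0 by rewrite /f lrmorph_sum (proj1 phiUV) (proj2 phiUV).
have nf_rel r s t : r \in quantum_plane_rels c -> nf i j (word s * r * word t) = 0.
  rewrite mem_seq1 => /eqP ->; rewrite (linear_middle_rel (@free_scalerAr _ _)).
  by rewrite !nf_word normal_coef_rel subrr.
have := ideal_kill nf_rel f_ideal.
rewrite /f linear_normal_sum; under eq_bigr do under eq_bigr do rewrite nf_word normal_coef_sorted mulr_natr.
by rewrite (box_sum_delta e iN jN).
Qed.

Lemma pres_qplane : qplane u v c.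
Proof. split; [exact: c_neq0|exact: pres_comm|exact: pres_span|exact: pres_free]. Qed.

End QuantumPlanePresentation.

(** * The grading by word length *)

Section WordGrading.
Variables (R : realType).
Local Notation k := R[i].
Variables (c : k) (A : algType k) (u v : A).
Hypotheses (c_neq0 : c != 0) (pA : presented (quantum_plane_rels c) (tnth [tuple u; v])).
Hypothesis qp : qplane u v c.
Local Notation g := (tnth [tuple u; v]).

Lemma word_span_sum d I (r : seq I) (F : I -> A) :
  (forall x, word_span g d (F x)) -> word_span g d (\sum_(x <- r) F x).
Proof.
move=> FP; elim: r => [|x r [s IH]]; first by exists [::]; rewrite !big_nil.
by have [s' xE] := FP x; exists (s' ++ s); rewrite big_cons big_cat IH xE.
Qed.

Lemma word_spanZ d l a : word_span g d a -> word_span g d (l *: a).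
Proof.
move=> [s ->]; exists [seq (l * t.1, t.2) | t <- s].
by rewrite big_map scaler_sumr; apply: eq_bigr => t _; rewrite scalerA.
Qed.

Lemma word_span_monomial i j : word_span g (i + j) (u ^+ i * v ^+ j).
Proof.
have sz : size (nseq i (0 : 'I_2) ++ nseq j (1 : 'I_2)) == (i + j)%N.
  by rewrite size_cat !size_nseq.
exists [:: (1, Tuple sz)]; rewrite big_seq1 scale1r big_cat /= !big_nseq -!Monoid.iteropE.
by [].
Qed.

(** Reordering a word rescales the resulting monomial but keeps its total
    degree. *)
Lemma word_gradingE : word_grading g = qgr qp 1 1.
Proof.
apply/funext => -[d|d]; apply/seteqP; split=> a.
- move=> [s ->]; apply: qgr_sum => // t _; apply: qgrZ => //.
  have [e [i [j [-> ci cj]]]] := word_monomial pA t.2; apply: qgrZ => //.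
  have -> : Posz d = qdeg 1 1 i j.
    rewrite /qdeg !muln1 -ci -cj -[in LHS](size_tuple t.2) -(count_predC (pred1 (0 : 'I_2))).
    congr (Posz (_ + _)); apply: eq_count => x /=.
    by case: (ord2 x) => ->.
  exact: qgr_monomial.
- move=> ga; rewrite (qcoefK (leqnn (qcoef_bound qp a))); apply: word_span_sum => i.
  apply: word_span_sum => j; have [->|/eqP aij] := eqVneq (qcoef qp a i j) 0.
    by exists [::]; rewrite big_nil scale0r.
  apply: word_spanZ; have [->] := ga _ _ aij; rewrite !muln1; exact: word_span_monomial.
- by move=> ->; apply: qgr0.
- by move=> /qgr_neg ->.
Qed.

End WordGrading.

Section GradingTransfer.
Variables (k : fieldType) (B : algType k) (u v : B) (c : k) (du dv : nat).
Hypotheses (qp : qplane u v c) (du_gt0 : (0 < du)%N) (dv_gt0 : (0 < dv)%N).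
Variables (V : zmodType) (gr : int -> set V) (f : {additive B -> V}).
Hypotheses (gr_V : graded_by gr) (f_inj : injective f).
Hypothesis f_gr : forall m a, qgr qp du dv m a -> gr m (f a).

(** If f a is homogeneous of degree m, then so is a: the other homogeneous
    components of a map to components of f a in other degrees, so they are
    zero by injectivity. *)
Lemma qgr_reflect m a : gr m (f a) -> qgr qp du dv m a.
Proof.
move=> ga; pose N := qcoef_bound qp a.
pose e (m : int) i j := if m == qdeg du dv i j then qcoef qp a i j else 0.
have eN m' : in_box N (e m') by move=> i j ij; rewrite /e qcoef_box //; case: ifP.
pose C m' := monomial_sum u v N (e m').
have CE m' i j : qcoef qp (C m') i j = e m' i j by exact: qcoef_uniq.
have Cgr m' : qgr qp du dv m' (C m').
  by move=> i j; rewrite CE /e; case: eqP.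
pose s := undup (m :: degrees du dv N).
have mem_s i j : qcoef qp a i j != 0 -> qdeg du dv i j \in s.
  move=> aij; have /andP[iN jN] : (i < N)%N && (j < N)%N.
    by apply: contraNT aij; rewrite negb_and -!leqNgt => /qcoef_box ->.
  by rewrite mem_undup in_cons mem_degrees ?orbT.
have aE : a = \sum_(m' <- s) C m'.
  apply: (@qcoef_inj _ _ _ _ _ qp) => i j; rewrite qcoef_sum.
  under eq_bigr do rewrite CE /e.
  have [a0|a0] := eqVneq (qcoef qp a i j) 0.
    by rewrite a0 big1 // => m' _; case: ifP.
  rewrite (bigD1_seq (qdeg du dv i j)) ?mem_s ?undup_uniq //= eqxx.
  by rewrite big1 ?addr0 // => m' /negPf ->.
pose c' m' := f (C m') - (if m' == m then f a else 0).
have c'gr m' : gr m' (c' m').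
  have [grB _ _] := gr_V; have [gr0 grB'] := grB m'.
  by apply: grB'; [exact: f_gr|case: eqP => [->|]].
have c'0 : \sum_(m' <- s) c' m' = 0.
  rewrite sumrB -raddf_sum -aE (bigD1_seq m) ?undup_uniq ?mem_undup ?mem_head //= eqxx.
  by rewrite big1 ?addr0 ?subrr // => m' /negPf ->.
have [_ _ uniqP] := gr_V; move=> i j aij; apply/eqP; rewrite eq_sym; apply/negPn/negP => ij_m.
have ij_s : qdeg du dv i j \in s by apply: mem_s; exact/eqP.
have := uniqP _ _ (undup_uniq _) c'gr c'0 _ ij_s; rewrite /c' (negPf ij_m) subr0.
rewrite -[0](raddf0 f) => /f_inj C0; apply: aij.
by have := CE (qdeg du dv i j) i j; rewrite C0 qcoef0 /e eqxx.
Qed.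

End GradingTransfer.

(** * The Hopf algebra H_{2n^2} as an algebra *)

(** The shapes of the defining relations of H, read through a morphism. *)
Section PanseraRelations.
Variables (k : fieldType) (F : lalgType k) (A : algType k) (phi : {lrmorphism F -> A}).

Lemma lrmorph_expn n (X : F) : phi (X ^+ n - 1) = 0 -> phi X ^+ n = 1.
Proof. by rewrite linearB rmorphXn rmorph1 => /eqP; rewrite subr_eq0 => /eqP. Qed.

Lemma lrmorph_comm (X Y X' Y' : F) : phi (X * Y - X' * Y') = 0 -> phi X * phi Y = phi X' * phi Y'.
Proof. by rewrite linearB !rmorphM => /eqP; rewrite subr_eq0 => /eqP. Qed.

Lemma lrmorph_square n (l : k) (e : nat -> nat -> k) (X Y Z : F) :
  phi (Z ^+ 2 - l *: \sum_(r < n) \sum_(s < n) e r s *: (X ^+ r * Y ^+ s)) = 0 ->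
  phi Z ^+ 2 = l *: monomial_sum (phi X) (phi Y) n e.
Proof. rewrite linearB (linearZZ phi) => /eqP; rewrite subr_eq0 => /eqP.
rewrite -[LHS]/(phi (Z ^+ 2)) rmorphXn => ->; congr (_ *: _); exact: lrmorph_sum.
Qed.

End PanseraRelations.

Section PanseraAlgebra.
Variable R : realType.
Local Notation k := R[i].
Variables (n : nat) (n_ge2 : (2 <= n)%N).
Variables (H : algType k) (hH : hopf H) (x y z : H) (Hxyz : pansera n hH x y z).
Local Notation q := (qroot R n).

Lemma pansera_relations :
  [/\ x ^+ n = 1, y ^+ n = 1, x * y = y * x, z * x = y * z & z * y = x * z].
Proof.
have [phi [phi_g rel]] := presented_rel (pansera_presented Hxyz).
have [gx gy gz] : [/\ phi (free_gen k (0 : 'I_3)) = x, phi (free_gen k (1 : 'I_3)) = y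
    & phi (free_gen k (2 : 'I_3)) = z] by split; exact: phi_g.
have reln m : (m < 6)%N -> phi (nth 0 (pansera_rels R n) m) = 0.
  by move=> m6; apply/rel/mem_nth.
split.
- by have /lrmorph_expn := reln 0%N isT; rewrite gx.
- by have /lrmorph_expn := reln 1%N isT; rewrite gy.
- by have /lrmorph_comm := reln 2%N isT; rewrite gx gy.
- by have /lrmorph_comm := reln 3%N isT; rewrite gx gy gz.
- by have /lrmorph_comm := reln 4%N isT; rewrite gx gy gz.
Qed.

Lemma pansera_square :
  z ^+ 2 = n%:R^-1 *: monomial_sum x y n (fun r s => q ^- (r * s)).
Proof.
have [phi [phi_g rel]] := presented_rel (pansera_presented Hxyz).
have [gx gy gz] : [/\ phi (free_gen k (0 : 'I_3)) = x, phi (free_gen k (1 : 'I_3)) = y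
    & phi (free_gen k (2 : 'I_3)) = z] by split; exact: phi_g.
have reln m : (m < 6)%N -> phi (nth 0 (pansera_rels R n) m) = 0.
  by move=> m6; apply/rel/mem_nth.
have := reln 5%N isT.
move=> /(@lrmorph_square _ _ _ _ n n%:R^-1 (fun r s => q ^- (r * s))).
by rewrite gx gy gz.
Qed.

Lemma pansera_ind (P : H -> Prop) :
  P 1 -> (forall h, P h -> P (x * h)) -> (forall h, P h -> P (y * h)) ->
  (forall h, P h -> P (z * h)) -> (forall l g h, P g -> P h -> P (l *: g + h)) ->
  forall h, P h.
Proof.
move=> P1 Px Py Pz PD h.
have P0 : P 0 by rewrite -(addNr 1) -scaleN1r; apply: PD.
have [s ->] := presented_span (pansera_presented Hxyz) h.
elim: s => [|[l w] s IH]; rewrite ?big_nil // big_cons; apply: PD => //=.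
elim: w => [|a w IHw]; rewrite ?big_nil // big_cons.
case: a => -[|[|[|//]]] lt3; rewrite (tnth_nth 0) /=; [exact: Px|exact: Py|exact: Pz].
Qed.

Let n_gt0 : (0 < n)%N := ltnW n_ge2.
Let q0 : q != 0 := qroot_neq0 R n_ge2.
Let n_neq0 : n%:R != 0 :> k.
Proof. by rewrite pnatr_eq0 -lt0n. Qed.

(** Inverses are traded for natural exponents. *)
Lemma qroot_inv m : q ^- m = q ^+ (n.-1 * m).
Proof.
apply: (mulfI (expf_neq0 m q0)); rewrite mulfV ?expf_neq0 // -exprD -mulSn prednK //.
by rewrite exprM qroot_expn // expr1n.
Qed.

Lemma qroot_mod m : q ^+ (m %% n)%N = q ^+ m.
Proof. by rewrite expr_mod // qroot_expn. Qed.

(** The sum over r is n when s = al modulo n and zero otherwise. In other words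
    J and z^2 act on vectors of weights al, be by q^(al be). *)
Lemma qroot_fourier al be :
  n%:R^-1 * (\sum_(r < n) \sum_(s < n) q ^- (r * s) * (q ^+ (al * r) * q ^+ (be * s))) =
  q ^+ (al * be).
Proof.
rewrite exchange_big /=.
have inner (s : 'I_n) : \sum_(r < n) q ^- (r * s) * (q ^+ (al * r) * q ^+ (be * s)) =
    q ^+ (be * s) * (if (s == al %% n :> nat)%N then n%:R else 0).
  have -> : (s == al %% n :> nat)%N = (n %| al + n.-1 * s)%N.
    have -> : (n %| al + n.-1 * s)%N = (al + n.-1 * s + s == s %[mod n])%N.
      by rewrite -[X in _ == X %[mod n]]add0n eqn_modDr mod0n.
    by rewrite -addnA -mulSnr prednK // addnC mulnC modnMDl [(s %% n)%N]modn_small // eq_sym.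
  rewrite -(qroot_sum R n_ge2) mulr_sumr; apply: eq_bigr => r _.
  by rewrite qroot_inv -!exprD; congr (q ^+ _); ring.
under eq_bigr do rewrite inner.
have lt_al : (al %% n < n)%N by rewrite ltn_mod.
rewrite (bigD1 (Ordinal lt_al)) //= eqxx big1 ?addr0 => [|s]; last first.
  by rewrite -val_eqE /= => /negPf ->; rewrite mulr0.
by rewrite mulrC -mulrA mulfV // mulr1 mulnC exprM -[q ^+ (al %% n)%N]qroot_mod modn_mod qroot_mod -exprM.
Qed.

(** The primitive idempotents of the group algebra of <x> x <y>: idem a b is the
    projection on the weight space where x = q^a and y = q^b. *)
Definition idem (a b : nat) : H :=
  locked ((n%:R^-1 * n%:R^-1) *:
    \sum_(r < n) \sum_(s < n) q ^- (a * r + b * s) *: (x ^+ r * y ^+ s)).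

Lemma idemE a b : idem a b = (n%:R^-1 * n%:R^-1) *:
    \sum_(r < n) \sum_(s < n) q ^- (a * r + b * s) *: (x ^+ r * y ^+ s).
Proof. by rewrite /idem -lock. Qed.

Lemma cyclic_shift (g : H) (f : nat -> H) : (forall r, g * f r = f r.+1) ->
  f n = f 0%N -> g * (\sum_(r < n) f r) = \sum_(r < n) f r.
Proof.
move=> gf fn; rewrite mulr_sumr; under eq_bigr do rewrite gf.
have [m nE] : exists m, n = m.+1 by exists n.-1; rewrite prednK.
rewrite nE in fn *.
by rewrite [RHS]big_ord_recl [LHS]big_ord_recr /= fn addrC.
Qed.

Lemma x_idem a b : x * idem a b = q ^+ a *: idem a b.
Proof.
have [xn yn xy zx zy] := pansera_relations.
rewrite idemE -scalerAr; suff -> : x * (\sum_(r < n) \sum_(s < n) q ^- (a * r + b * s) *: (x ^+ r * y ^+ s)) = q ^+ a *: \sum_(r < n) \sum_(s < n) q ^- (a * r + b * s) *: (x ^+ r * y ^+ s).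
  by rewrite !scalerA mulrC.
pose f r := \sum_(s < n) q ^- (a * r + b * s) *: (x ^+ r * y ^+ s).
have fE : (q ^- a *: x) * (\sum_(r < n) f r) = \sum_(r < n) f r; last first.
  by rewrite -[in RHS]fE -scalerAl scalerA mulfV ?expf_neq0 // scale1r.
apply: cyclic_shift.
- move=> r; rewrite /f mulr_sumr; apply: eq_bigr => s _.
  rewrite -scalerAl -scalerAr scalerA mulrA -exprS -invfM -exprD.
  by congr (_ ^- _ *: _); rewrite mulnS addnA.
- apply: eq_bigr => s _; rewrite xn expr0 mulnC exprD exprM muln0 qroot_expn //.
  by rewrite expr1n mul1r.
Qed.

Lemma y_idem a b : y * idem a b = q ^+ b *: idem a b.
Proof.
have [xn yn xy zx zy] := pansera_relations.
rewrite idemE -scalerAr exchange_big.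
suff -> : y * (\sum_(s < n) \sum_(r < n) q ^- (a * r + b * s) *: (x ^+ r * y ^+ s)) = q ^+ b *: \sum_(s < n) \sum_(r < n) q ^- (a * r + b * s) *: (x ^+ r * y ^+ s).
  by rewrite !scalerA mulrC.
pose f s := \sum_(r < n) q ^- (a * r + b * s) *: (x ^+ r * y ^+ s).
have fE : (q ^- b *: y) * (\sum_(s < n) f s) = \sum_(s < n) f s; last first.
  by rewrite -[in RHS]fE -scalerAl scalerA mulfV ?expf_neq0 // scale1r.
apply: cyclic_shift.
- move=> s; rewrite /f mulr_sumr; apply: eq_bigr => r _.
  have yx : y * x ^+ r = x ^+ r * y by apply: commrX; rewrite /GRing.comm xy.
  rewrite -scalerAl -scalerAr scalerA mulrA yx -mulrA -exprS -invfM -exprD.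
  by congr (_ ^- _ *: _); rewrite mulnS addnCA.
- apply: eq_bigr => r _; rewrite yn expr0 muln0 addn0 exprD [(b * n)%N]mulnC.
  by rewrite [q ^+ (n * b)]exprM qroot_expn // expr1n mulr1.
Qed.

Lemma z_monomial r s : z * (x ^+ r * y ^+ s) = x ^+ s * y ^+ r * z.
Proof.
have [xn yn xy zx zy] := pansera_relations.
have zxr : z * x ^+ r = y ^+ r * z.
  elim: r => [|r IH]; first by rewrite mulr1 mul1r.
  by rewrite exprSr mulrA IH -mulrA zx mulrA -exprSr.
have zys : z * y ^+ s = x ^+ s * z.
  elim: s => [|s IH]; first by rewrite mulr1 mul1r.
  by rewrite exprSr mulrA IH -mulrA zy mulrA -exprSr.
rewrite mulrA zxr -mulrA zys mulrA; congr (_ * _).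
by apply: commrX; apply: commr_sym; apply: commrX.
Qed.

Lemma z_idem a b : z * idem a b = idem b a * z.
Proof.
rewrite !idemE -scalerAr -scalerAl; congr (_ *: _).
rewrite mulr_sumr mulr_suml; under eq_bigr do rewrite mulr_sumr.
rewrite exchange_big; apply: eq_bigr => s _; rewrite mulr_suml; apply: eq_bigr => r _.
by rewrite -scalerAr -scalerAl z_monomial addnC.
Qed.

Lemma xX_idem r a b : x ^+ r * idem a b = q ^+ (a * r) *: idem a b.
Proof.
elim: r => [|r IH]; first by rewrite muln0 mul1r scale1r.
by rewrite exprSr -mulrA x_idem -scalerAr IH scalerA -exprD mulnS.
Qed.

Lemma yX_idem s a b : y ^+ s * idem a b = q ^+ (b * s) *: idem a b.
Proof.
elim: s => [|s IH]; first by rewrite muln0 mul1r scale1r.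
by rewrite exprSr -mulrA y_idem -scalerAr IH scalerA -exprD mulnS.
Qed.

Lemma zz_idem a b : z * (z * idem a b) = q ^+ (a * b) *: idem a b.
Proof.
rewrite mulrA -expr2 pansera_square -scalerAl /monomial_sum mulr_suml.
rewrite -(qroot_fourier a b) -scalerA; congr (_ *: _); rewrite scaler_suml; apply: eq_bigr => r _.
rewrite mulr_suml scaler_suml; apply: eq_bigr => s _.
by rewrite -scalerAl -mulrA yX_idem -scalerAr xX_idem !scalerA; congr (_ *: _); ring.
Qed.

Lemma idemM a b : idem a b * idem a b = idem a b.
Proof.
rewrite [X in X * _]idemE -scalerAl mulr_suml.
rewrite [X in _ *: X](_ : _ = (n%:R * n%:R) *: idem a b).
  by rewrite scalerA -invfM mulVf ?mulf_neq0 // scale1r.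
transitivity (\sum_(r < n) \sum_(s < n) idem a b); last first.
  by rewrite !sumr_const !card_ord -scalerA !scaler_nat.
apply: eq_bigr => r _; rewrite mulr_suml; apply: eq_bigr => s _.
rewrite -scalerAl -mulrA yX_idem -scalerAr xX_idem !scalerA -[RHS]scale1r.
by congr (_ *: _); rewrite exprD; field; rewrite !expf_neq0.
Qed.

Lemma idem_sum : \sum_(a < n) \sum_(b < n) idem a b = 1.
Proof.
under eq_bigr do under eq_bigr do rewrite idemE.
under eq_bigr do rewrite -scaler_sumr.
rewrite -scaler_sumr.
have -> : \sum_(a < n) \sum_(b < n) \sum_(r < n) \sum_(s < n)
    q ^- (a * r + b * s) *: (x ^+ r * y ^+ s) =
  \sum_(r < n) \sum_(s < n) ((\sum_(a < n) q ^- (a * r)) * (\sum_(b < n) q ^- (b * s))) *: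
     (x ^+ r * y ^+ s).
  under eq_bigr do rewrite exchange_big.
  rewrite exchange_big; apply: eq_bigr => r _.
  under eq_bigr do rewrite exchange_big.
  rewrite exchange_big; apply: eq_bigr => s _.
  rewrite mulr_suml scaler_suml; apply: eq_bigr => a _.
  rewrite mulr_sumr scaler_suml; apply: eq_bigr => b _.
  by rewrite exprD invfM.
have delta (r : 'I_n) : \sum_(a < n) q ^- (a * r) = if (r == 0 :> nat)%N then n%:R else 0.
  rewrite (eq_bigr (fun a : 'I_n => q ^+ (a * (n.-1 * r)))) => [|a _]; last first.
    by rewrite qroot_inv; congr (q ^+ _); ring.
  rewrite qroot_sum // Gauss_dvdr; last by rewrite coprime_sym coprimePn.
  by rewrite /dvdn modn_small.
under eq_bigr do under eq_bigr do rewrite !delta.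
rewrite (bigD1 (Ordinal n_gt0)) //= (bigD1 (Ordinal n_gt0)) //=.
rewrite big1 => [|s]; last by rewrite -val_eqE /= => /negPf ->; rewrite mulr0 scale0r.
rewrite big1 => [|r]; last first.
  by rewrite -val_eqE /= => /negPf ->; rewrite big1 // => s _; rewrite mul0r scale0r.
by rewrite !addr0 scalerA -invfM mulVf ?mulf_neq0 // scale1r mulr1.
Qed.

(** A spanning set of 2 n^2 elements adapted to weights; that it is a basis is
    a consequence of the faithful action on A. *)
Lemma pansera_span h : exists c d : nat -> nat -> k,
  h = \sum_(a < n) \sum_(b < n) (c a b *: idem a b + d a b *: (idem a b * z)).
Proof.
move: h; apply: pansera_ind.
- exists (fun _ _ => 1), (fun _ _ => 0); rewrite -idem_sum; apply: eq_bigr => a _.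
  by apply: eq_bigr => b _; rewrite scale1r scale0r addr0.
- move=> _ [c [d ->]]; exists (fun a b => q ^+ a * c a b), (fun a b => q ^+ a * d a b).
  rewrite mulr_sumr; apply: eq_bigr => a _; rewrite mulr_sumr; apply: eq_bigr => b _.
  rewrite mulrDr -!scalerAr mulrA x_idem -scalerAl !scalerA.
  by rewrite [c _ _ * _]mulrC [d _ _ * _]mulrC.
- move=> _ [c [d ->]]; exists (fun a b => q ^+ b * c a b), (fun a b => q ^+ b * d a b).
  rewrite mulr_sumr; apply: eq_bigr => a _; rewrite mulr_sumr; apply: eq_bigr => b _.
  rewrite mulrDr -!scalerAr mulrA y_idem -scalerAl !scalerA.
  by rewrite [c _ _ * _]mulrC [d _ _ * _]mulrC.
- move=> _ [c [d ->]]; exists (fun a b => q ^+ (a * b) * d b a), (fun a b => c b a).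
  rewrite mulr_sumr; under eq_bigr do rewrite mulr_sumr.
  rewrite exchange_big; apply: eq_bigr => a _; apply: eq_bigr => b _.
  rewrite mulrDr -!scalerAr z_idem addrC; congr (_ + _).
  by rewrite -z_idem zz_idem scalerA mulrC.
- move=> l _ _ [c [d ->]] [c' [d' ->]].
  exists (fun a b => l * c a b + c' a b), (fun a b => l * d a b + d' a b).
  rewrite scaler_sumr -big_split; apply: eq_bigr => a _ /=.
  rewrite scaler_sumr -big_split; apply: eq_bigr => b _ /=.
  by rewrite !scalerDl scalerDr !scalerA addrACA.
Qed.

End PanseraAlgebra.

(** * Semisimplicity *)

Lemma subspace_projection (k : fieldType) (W : lmodType k) (N : set W) :
  N 0 -> (forall (l : k) a b, N a -> N b -> N (l *: a + b)) ->
  exists p : {linear W -> W}, (forall w, N (p w)) /\ (forall w, N w -> p w = w).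
Proof.
move=> N0 Nlin; have [C [C0 Clin span disj]] := subspace_complement N0 Nlin.
have pP w : exists a, N a /\ C (w - a).
  by have [a [b [Na Cb ->]]] := span w; exists a; rewrite addrC addKr.
pose p w := projT1 (cid (pP w)).
have Np w : N (p w) by have [] := projT2 (cid (pP w)).
have Cp w : C (w - p w) by have [] := projT2 (cid (pP w)).
have p_uniq w a : N a -> C (w - a) -> p w = a.
  move=> Na Ca; apply/eqP; rewrite -subr_eq0; apply/eqP/disj.
    by rewrite addrC -scaleN1r; apply: Nlin.
  have -> : p w - a = -1 *: (w - p w) + (w - a) by rewrite scaleN1r opprB addrA subrK.
  exact: Clin.
have p_lin : linear p.
  move=> l a b; apply: p_uniq; first exact: Nlin.
  by rewrite opprD addrACA -scalerBr; apply: Clin.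
exists (mklin p_lin); split=> w; rewrite mklinE // => Nw.
by apply: p_uniq => //; rewrite subrr.
Qed.

Section PanseraSemisimple.
Variable R : realType.
Local Notation k := R[i].
Variables (n : nat) (n_ge2 : (2 <= n)%N).
Variables (H : algType k) (hH : hopf H) (x y z : H) (Hxyz : pansera n hH x y z).
Local Notation q := (qroot R n).
Local Notation idem := (idem n x y).

Lemma idem_x a b : idem a b * x = x * idem a b.
Proof.
have [_ _ xy _ _] := pansera_relations Hxyz.
rewrite !idemE -scalerAr -scalerAl mulr_suml mulr_sumr; congr (_ *: _).
apply: eq_bigr => r _; rewrite mulr_suml mulr_sumr; apply: eq_bigr => s _.
rewrite -scalerAr -scalerAl; congr (_ *: _); apply: commr_sym.
by apply: commrM; apply: commrX; rewrite /GRing.comm ?xy.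
Qed.

Lemma idem_y a b : idem a b * y = y * idem a b.
Proof.
have [_ _ xy _ _] := pansera_relations Hxyz.
rewrite !idemE -scalerAr -scalerAl mulr_suml mulr_sumr; congr (_ *: _).
apply: eq_bigr => r _; rewrite mulr_suml mulr_sumr; apply: eq_bigr => s _.
rewrite -scalerAr -scalerAl; congr (_ *: _); apply: commr_sym.
by apply: commrM; apply: commrX; rewrite /GRing.comm ?xy.
Qed.

Lemma idem_zz a b : idem a b * (z * z) = z * z * idem a b.
Proof. by rewrite -mulrA (z_idem Hxyz) [z * (_ * z)]mulrA (z_idem Hxyz) mulrA. Qed.

(** The inverse of z, as z^2 acts by q^(a b) on the weight space (a, b). *)
Definition zinv : H := z * \sum_(a < n) \sum_(b < n) q ^- (a * b) *: idem a b.

Lemma mulz_zinv : z * zinv = 1.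
Proof.
rewrite /zinv mulrA -(idem_sum n_ge2 x y) mulr_sumr; apply: eq_bigr => a _.
rewrite mulr_sumr; apply: eq_bigr => b _.
rewrite -scalerAr -mulrA (zz_idem n_ge2 Hxyz) scalerA mulVf ?scale1r //.
by rewrite expf_neq0 // qroot_neq0.
Qed.

Lemma mulzinv_z : zinv * z = 1.
Proof.
have -> : zinv * z = z * zinv; last exact: mulz_zinv.
rewrite /zinv -mulrA; congr (z * _).
rewrite mulr_suml mulr_sumr; under eq_bigr do rewrite mulr_suml.
under [RHS]eq_bigr do rewrite mulr_sumr.
rewrite exchange_big; apply: eq_bigr => b _; apply: eq_bigr => a _.
by rewrite -scalerAr -scalerAl (z_idem Hxyz) mulnC.
Qed.

Lemma x_zinv : x * zinv = zinv * y.
Proof.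
have [_ _ _ zx _] := pansera_relations Hxyz.
rewrite -[LHS]mul1r -mulzinv_z -[zinv * z * _]mulrA [z * (x * _)]mulrA zx.
by rewrite -[y * z * _]mulrA mulz_zinv mulr1.
Qed.

Lemma y_zinv : y * zinv = zinv * x.
Proof.
have [_ _ _ _ zy] := pansera_relations Hxyz.
rewrite -[LHS]mul1r -mulzinv_z -[zinv * z * _]mulrA [z * (y * _)]mulrA zy.
by rewrite -[x * z * _]mulrA mulz_zinv mulr1.
Qed.

(** Maschke: a k-linear projection on a submodule is made linear for x and y by
    compressing it to the weight spaces, then for z by averaging over 1 and z.
    The average is z-linear because z^2 commutes with the compressed
    projection. *)
Lemma pansera_semisimple : semisimple H.
Proof.
move=> M N N0 Nlin.
have NZ (h : H) a : N a -> N (h *: a) by move=> Na; rewrite -[h *: a]addr0; apply: Nlin.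
have ND a b : N a -> N b -> N (a + b) by move=> Na Nb; rewrite -[a]scale1r; apply: Nlin.
have [|p [Np pN]] := @subspace_projection k (kmod M) N N0.
  by move=> l a b Na Nb; apply: Nlin.
have pk l (m : M) : p (kscale l m) = kscale l (p m) by exact: (linearZZ p).
have pD (m m' : M) : p (m + m') = (p m : M) + p m' by exact: (linearD p).
pose P1 (m : M) : M := \sum_(a < n) \sum_(b < n) idem a b *: (p (idem a b *: m) : M).
have P1D (m m' : M) : P1 (m + m') = P1 m + P1 m'.
  rewrite /P1 -big_split; apply: eq_bigr => a _; rewrite -big_split; apply: eq_bigr => b _.
  by rewrite scalerDr pD; exact: scalerDr.
have P1k l (m : M) : P1 (kscale l m) = kscale l (P1 m).
  rewrite /P1 kscale_sum; apply: eq_bigr => a _; rewrite kscale_sum; apply: eq_bigr => b _.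
  by rewrite scale_kscale pk scale_kscale.
have P1_comm (g : H) (lam : nat -> nat -> k) :
    (forall a b, g * idem a b = lam a b *: idem a b) ->
    (forall a b, idem a b * g = g * idem a b) -> forall m, P1 (g *: m) = g *: P1 m.
  move=> g_idem idem_g m; rewrite /P1 scaler_sumr; apply: eq_bigr => a _.
  rewrite scaler_sumr; apply: eq_bigr => b _.
  by rewrite !scalerA idem_g g_idem !scale_scale pk scale_kscale.
have P1x := P1_comm _ _ (x_idem n_ge2 Hxyz) idem_x.
have P1y := P1_comm _ _ (y_idem n_ge2 Hxyz) idem_y.
have P1zz : forall m, P1 (z * z *: m) = z * z *: P1 m.
  by apply: P1_comm idem_zz => a b; rewrite -mulrA (zz_idem n_ge2 Hxyz).
have NP1 m : N (P1 m).
  by rewrite /P1; elim/big_ind: _ => // a _; elim/big_ind: _ => // b _; apply: NZ; exact: Np.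
have P1N m : N m -> P1 m = m.
  move=> Nm; rewrite -[RHS]scale1r -(idem_sum n_ge2 x y) scaler_suml; apply: eq_bigr => a _.
  rewrite scaler_suml; apply: eq_bigr => b _.
  by rewrite pN ?scalerA ?(idemM n_ge2 Hxyz) //; apply: NZ.
pose P2 (m : M) : M := kscale 2^-1 (P1 m + zinv *: P1 (z *: m)).
have NP2 m : N (P2 m) by exact: NZ _ _ (ND _ _ (NP1 _) (NZ _ _ (NP1 _))).
have P2N m : N m -> P2 m = m.
  move=> Nm; rewrite /P2 !P1N //; last exact: NZ.
  rewrite scalerA mulzinv_z scale1r -[m in m + _]kscale1 -[m in _ + m]kscale1 -kscaleDl kscaleA.
  by rewrite mulVf ?kscale1 // -[1 + 1]/(2%:R) pnatr_eq0.
have P2D (m m' : M) : P2 (m + m') = P2 m + P2 m'.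
  by rewrite /P2 scalerDr !P1D scalerDr addrACA kscaleDr.
have P2k l (m : M) : P2 (kscale l m) = kscale l (P2 m).
  by rewrite /P2 scale_kscale !P1k scale_kscale -kscaleDr !kscaleA mulrC.
have [_ _ _ zx zy] := pansera_relations Hxyz.
have P2x m : P2 (x *: m) = x *: P2 m.
  rewrite /P2 scale_kscale scalerDr P1x; congr (kscale _ (_ + _)).
  by rewrite scalerA zx -scalerA P1y !scalerA x_zinv.
have P2y m : P2 (y *: m) = y *: P2 m.
  rewrite /P2 scale_kscale scalerDr P1y; congr (kscale _ (_ + _)).
  by rewrite scalerA zy -scalerA P1x !scalerA y_zinv.
have P2z m : P2 (z *: m) = z *: P2 m.
  rewrite /P2 scale_kscale scalerDr addrC; congr (kscale _ (_ + _)).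
    by rewrite !scalerA P1zz scalerA mulrA mulzinv_z mul1r.
  by rewrite scalerA mulz_zinv scale1r.
have P2h (h : H) m : P2 (h *: m) = h *: P2 m.
  move: h m; apply: (pansera_ind Hxyz) => [m|h IH m|h IH m|h IH m|l g h IHg IHh m].
  - by rewrite !scale1r.
  - by rewrite -!scalerA P2x IH.
  - by rewrite -!scalerA P2y IH.
  - by rewrite -!scalerA P2z IH.
  - by rewrite !scalerDl P2D !scale_scale P2k IHg IHh.
exists [set m | P2 m = 0]%classic; split=> /=.
- exact: P2N.
- by move=> h a b a0 b0; rewrite P2D P2h a0 b0 scaler0 addr0.
- move=> m; exists (P2 m), (m - P2 m); split=> //=; last by rewrite addrC subrK.
  by rewrite -scaleN1r P2D P2h (P2N (P2 m)) // scaleN1r subrr.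
- by move=> m Nm; rewrite P2N.
Qed.

End PanseraSemisimple.

(** * The action on monomials *)

Section Action.
Variable R : realType.
Local Notation k := R[i].
Variables (n : nat) (n_ge2 : (2 <= n)%N).
Variables (H : algType k) (hH : hopf H) (x y z : H) (Hxyz : pansera n hH x y z).
Variables (A : algType k) (M : module_algebra hH A).
Local Notation q := (qroot R n).

Lemma act_linear h : linear (M h). Proof. by have [] := act_bilinear M. Qed.
Lemma act_linearl a : linear (M^~ a). Proof. by have [] := act_bilinear M. Qed.

Lemma actD h a b : M h (a + b) = M h a + M h b.
Proof. by have := act_linear h 1 a b; rewrite !scale1r. Qed.
Lemma act0 h : M h 0 = 0.
Proof. by apply: (addrI (M h 0)); rewrite -actD !addr0. Qed.
Lemma actZ h l a : M h (l *: a) = l *: M h a.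
Proof. by have := act_linear h l a 0; rewrite act0 !addr0. Qed.
Lemma act_sum h I (r : seq I) (P : pred I) (F : I -> A) :
  M h (\sum_(t <- r | P t) F t) = \sum_(t <- r | P t) M h (F t).
Proof. by apply: (big_morph (M h)) => [a b|]; [exact: actD|exact: act0]. Qed.
Lemma actDl g h a : M (g + h) a = M g a + M h a.
Proof. by have := act_linearl a 1 g h; rewrite !scale1r. Qed.
Lemma act0l a : M 0 a = 0.
Proof. by apply: (addrI (M 0 a)); rewrite -actDl !addr0. Qed.
Lemma actZl h l a : M (l *: h) a = l *: M h a.
Proof. by have := act_linearl a l h 0; rewrite act0l !addr0. Qed.
Lemma act_suml I (r : seq I) (P : pred I) (F : I -> H) a :
  M (\sum_(t <- r | P t) F t) a = \sum_(t <- r | P t) M (F t) a.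
Proof. by apply: (big_morph (M^~ a)) => [g h|]; [exact: actDl|exact: act0l]. Qed.

Lemma act_bilinear_mul a b : bilinear_map (fun g h => M g a * M h b).
Proof.
split=> h l g g'; first by rewrite actDl actZl mulrDr scalerAr.
by rewrite /= actDl actZl mulrDl scalerAl.
Qed.

Lemma act_x1 : M x 1 = 1. Proof. by rewrite act_unit (counit_x Hxyz) scale1r. Qed.
Lemma act_y1 : M y 1 = 1. Proof. by rewrite act_unit (counit_y Hxyz) scale1r. Qed.
Lemma act_z1 : M z 1 = 1. Proof. by rewrite act_unit (counit_z Hxyz) scale1r. Qed.

Lemma act_xM a b : M x (a * b) = M x a * M x b.
Proof. by rewrite act_mul (comul_x Hxyz (act_bilinear_mul a b)) big_seq1. Qed.

Lemma act_yM a b : M y (a * b) = M y a * M y b.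
Proof. by rewrite act_mul (comul_y Hxyz (act_bilinear_mul a b)) big_seq1. Qed.

Lemma act_xX a s l : M x a = l *: a -> M x (a ^+ s) = l ^+ s *: a ^+ s.
Proof.
move=> xa; elim: s => [|s IH]; first by rewrite act_x1 scale1r.
by rewrite exprS act_xM xa IH -scalerAl -scalerAr scalerA -!exprS.
Qed.

Lemma act_yX a s l : M y a = l *: a -> M y (a ^+ s) = l ^+ s *: a ^+ s.
Proof.
move=> ya; elim: s => [|s IH]; first by rewrite act_y1 scale1r.
by rewrite exprS act_yM ya IH -scalerAl -scalerAr scalerA -!exprS.
Qed.

Lemma act_exp g a l s : M g a = l *: a -> M (g ^+ s) a = l ^+ s *: a.
Proof.
move=> ga; elim: s => [|s IH]; first by rewrite !expr0 act1 scale1r.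
by rewrite exprSr actM ga actZ IH scalerA -exprS.
Qed.

(** On weight vectors the twist J in the coproduct of z is the scalar
    q^(al be). *)
Lemma act_zM al be a b :
  M x (M z a) = q ^+ al *: M z a -> M y (M z b) = q ^+ be *: M z b ->
  M z (a * b) = q ^+ (al * be) *: (M z a * M z b).
Proof.
move=> xa yb; rewrite act_mul (comul_z Hxyz (act_bilinear_mul a b)) big_allpairs_dep.
rewrite -(qroot_fourier R n_ge2) -scalerA scaler_suml scaler_sumr.
rewrite -{1}[n in iota 0 n]subn0 big_mkord; apply: eq_bigr => r _.
rewrite scaler_suml scaler_sumr -{1}[n in iota 0 n]subn0 big_mkord; apply: eq_bigr => s _.
rewrite actZl !actM (act_exp r xa) (act_exp s yb) -!exprM.
by rewrite -!scalerAl -scalerAr !scalerA; congr (_ *: _); rewrite !mulrA.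
Qed.

Variables (i j : nat) (u v : A).
Hypothesis M_pi : acts_by_pi n x y z M i j u v.

Lemma act_x_monomial s t : M x (u ^+ s * v ^+ t) = q ^+ (i * s + j * t) *: (u ^+ s * v ^+ t).
Proof.
have [[xu xv] _ _] := M_pi; rewrite act_xM (act_xX _ xu) (act_xX _ xv) -!exprM.
by rewrite -scalerAl -scalerAr scalerA -exprD.
Qed.

Lemma act_y_monomial s t : M y (u ^+ s * v ^+ t) = q ^+ (j * s + i * t) *: (u ^+ s * v ^+ t).
Proof.
have [_ [yu yv] _] := M_pi; rewrite act_yM (act_yX _ yu) (act_yX _ yv) -!exprM.
by rewrite -scalerAl -scalerAr scalerA -exprD.
Qed.

Lemma act_z_u s : M z (u ^+ s) = q ^+ (i * j * 'C(s.+1, 2)) *: v ^+ s.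
Proof.
have [[xu xv] [yu yv] [zu zv]] := M_pi.
elim: s => [|s IH]; first by rewrite act_z1 muln0 scale1r.
rewrite exprS (@act_zM j (i * s)); last first.
- by rewrite IH actZ (act_yX _ yv) -exprM !scalerA mulrC.
- by rewrite zu actZ xv !scalerA mulrC.
rewrite zu IH -scalerAl -scalerAr !scalerA -exprS -!exprD; congr (q ^+ _ *: _).
by rewrite [in RHS]binS bin1; ring.
Qed.

Lemma act_z_v s : M z (v ^+ s) = q ^+ (i * j * 'C(s, 2)) *: u ^+ s.
Proof.
have [[xu xv] [yu yv] [zu zv]] := M_pi.
elim: s => [|s IH]; first by rewrite act_z1 muln0 scale1r.
rewrite exprS (@act_zM i (j * s)); last first.
- by rewrite IH actZ (act_yX _ yu) -exprM !scalerA mulrC.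
- by rewrite zv xu.
rewrite zv IH -scalerAr !scalerA -exprS -!exprD; congr (q ^+ _ *: _).
by rewrite [in RHS]binS bin1; ring.
Qed.

Variable c : k.
Hypothesis qp : qplane u v c.

(** Up to a unit, z exchanges u and v, hence the two exponents. *)
Lemma act_z_monomial s t : exists2 l, l != 0 & M z (u ^+ s * v ^+ t) = l *: (u ^+ t * v ^+ s).
Proof.
have [[xu xv] [yu yv] [zu zv]] := M_pi.
have q0 := qroot_neq0 R n_ge2.
exists (q ^+ (j * s * (j * t)) * (q ^+ (i * j * 'C(s.+1, 2)) * (q ^+ (i * j * 'C(t, 2)) * c ^+ (t * s)))).
  by rewrite !mulf_neq0 ?expf_neq0 ?(qp_neq0 qp).
rewrite (@act_zM (j * s) (j * t)); last first.
- by rewrite act_z_v actZ (act_yX _ yu) -exprM !scalerA mulrC.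
- by rewrite act_z_u actZ (act_xX _ xv) -exprM !scalerA mulrC.
by rewrite act_z_u act_z_v -scalerAl -scalerAr (vXuX qp) !scalerA !mulrA.
Qed.

Lemma act_preserves_degree h m a : qgr qp 1 1 m a -> qgr qp 1 1 m (M h a).
Proof.
have mono g m' b : (forall s t, qgr qp 1 1 (qdeg 1 1 s t) (M g (u ^+ s * v ^+ t))) ->
    qgr qp 1 1 m' b -> qgr qp 1 1 m' (M g b).
  move=> Mg gb; rewrite [b](qcoefK (leqnn (qcoef_bound qp b))) act_sum.
  apply: qgr_sum => // s _; rewrite act_sum; apply: qgr_sum => // t _.
  rewrite actZ; have [->|/eqP bst] := eqVneq (qcoef qp b s t) 0.
    by rewrite scale0r; apply: qgr0.
  by rewrite (gb _ _ bst); apply: qgrZ.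
move: h m a; apply: (pansera_ind Hxyz) => [m a|h IH m a ga|h IH m a ga|h IH m a ga|l g h IHg IHh m a ga].
- by rewrite act1.
- rewrite actM; apply: mono (IH _ _ ga) => s t; rewrite act_x_monomial.
  by apply: qgrZ => //; apply: qgr_monomial.
- rewrite actM; apply: mono (IH _ _ ga) => s t; rewrite act_y_monomial.
  by apply: qgrZ => //; apply: qgr_monomial.
- rewrite actM; apply: mono (IH _ _ ga) => s t; have [l _ ->] := act_z_monomial s t.
  apply: qgrZ => //; have -> : qdeg 1 1 s t = qdeg 1 1 t s by rewrite /qdeg !muln1 addnC.
  exact: qgr_monomial.
- by rewrite actDl actZl; apply: qgrD => //; [apply: qgrZ => //; exact: IHg|exact: IHh].
Qed.

Hypothesis coprime_ij : coprimez (i%:Z ^+ 2 - j%:Z ^+ 2) n%:Z.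

Let n_gt0 : (0 < n)%N := ltnW n_ge2.

Lemma eq_modn_int (m p : nat) (w : int) :
  m%:Z = p%:Z + w * n%:Z -> (m = p %[mod n])%N.
Proof.
move=> mE; have := congr1 (fun t => (t %% n%:Z)%Z) mE.
by rewrite addrC modzMDl !modz_nat => -[].
Qed.

(** The weight matrix (i, j; j, i) is invertible modulo n, so every weight is
    that of a monomial, which can moreover be chosen off the diagonal. *)
Lemma weight_surj a b : exists s t : nat, [/\ s != t, (i * s + j * t = a %[mod n])%N
  & (j * s + i * t = b %[mod n])%N].
Proof.
have [U [V UV]] := Bezoutz (i%:Z ^+ 2 - j%:Z ^+ 2) n%:Z.
rewrite (eqP coprime_ij) in UV.
pose X : int := U * (i%:Z * a%:Z - j%:Z * b%:Z).
pose Y : int := U * (i%:Z * b%:Z - j%:Z * a%:Z).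
have nZ : n%:Z != 0 by rewrite eqz_nat -lt0n.
have XE := divz_eq X n%:Z; have YE := divz_eq Y n%:Z.
have sE := gez0_abs (modz_ge0 X nZ); have tE := gez0_abs (modz_ge0 Y nZ).
have tn : (`|(Y %% n%:Z)%Z| < n)%N.
  by rewrite -ltz_nat tE ltz_pmod // ltz_nat.
(* adding n makes the first exponent larger than the second *)
exists (`|(X %% n%:Z)%Z| + n)%N, `|(Y %% n%:Z)%Z|%N; split.
- by rewrite gtn_eqF // (leq_trans tn) // leq_addl.
- apply: (@eq_modn_int _ _ (- V * a%:Z + i%:Z - i%:Z * (X %/ n%:Z)%Z - j%:Z * (Y %/ n%:Z)%Z)).
  rewrite PoszD !PoszM PoszD sE tE.
  have -> : (X %% n%:Z)%Z = X - (X %/ n%:Z)%Z * n%:Z by rewrite [X in X - _]XE addrC addKr.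
  have -> : (Y %% n%:Z)%Z = Y - (Y %/ n%:Z)%Z * n%:Z by rewrite [X in X - _]YE addrC addKr.
  move: (X %/ n%:Z)%Z (Y %/ n%:Z)%Z => Qs Qt; apply/eqP; rewrite -subr_eq0.
  rewrite [X in X == 0](_ : _ = (U * (i%:Z ^+ 2 - j%:Z ^+ 2) + V * n%:Z - 1) * a%:Z).
    by rewrite UV subrr mul0r.
  by rewrite /X /Y; ring.
- apply: (@eq_modn_int _ _ (- V * b%:Z + j%:Z - j%:Z * (X %/ n%:Z)%Z - i%:Z * (Y %/ n%:Z)%Z)).
  rewrite PoszD !PoszM PoszD sE tE.
  have -> : (X %% n%:Z)%Z = X - (X %/ n%:Z)%Z * n%:Z by rewrite [X in X - _]XE addrC addKr.
  have -> : (Y %% n%:Z)%Z = Y - (Y %/ n%:Z)%Z * n%:Z by rewrite [X in X - _]YE addrC addKr.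
  move: (X %/ n%:Z)%Z (Y %/ n%:Z)%Z => Qs Qt; apply/eqP; rewrite -subr_eq0.
  rewrite [X in X == 0](_ : _ = (U * (i%:Z ^+ 2 - j%:Z ^+ 2) + V * n%:Z - 1) * b%:Z).
    by rewrite UV subrr mul0r.
  by rewrite /X /Y; ring.
Qed.

Lemma weight_zero s t : (n %| i * s + j * t)%N -> (n %| j * s + i * t)%N ->
  (n %| s)%N /\ (n %| t)%N.
Proof.
have dvdZ (m : nat) : (n %| m)%N = (n%:Z %| m%:Z)%Z by [].
have co : coprimez n%:Z (i%:Z ^+ 2 - j%:Z ^+ 2) by rewrite coprimez_sym.
rewrite !dvdZ => d1 d2; split; rewrite -(Gauss_dvdzr _ co).
- have -> : (i%:Z ^+ 2 - j%:Z ^+ 2) * s%:Z =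
    i%:Z * (i * s + j * t)%N%:Z - j%:Z * (j * s + i * t)%N%:Z.
    by rewrite !PoszD !PoszM; ring.
  by rewrite rpredB // dvdz_mull.
- have -> : (i%:Z ^+ 2 - j%:Z ^+ 2) * t%:Z =
    i%:Z * (j * s + i * t)%N%:Z - j%:Z * (i * s + j * t)%N%:Z.
    by rewrite !PoszD !PoszM; ring.
  by rewrite rpredB // dvdz_mull.
Qed.

Lemma qroot_orth a w : \sum_(r < n) q ^- (a * r) * q ^+ (w * r) =
  if (w == a %[mod n])%N then n%:R else 0.
Proof.
have -> : (w == a %[mod n])%N = (n %| w + n.-1 * a)%N.
  have -> : (n %| w + n.-1 * a)%N = (w + n.-1 * a + a == a %[mod n])%N.
    by rewrite -[X in _ == X %[mod n]]add0n eqn_modDr mod0n.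
  by rewrite -addnA -mulSnr prednK // addnC mulnC modnMDl.
rewrite -(qroot_sum R n_ge2); apply: eq_bigr => r _.
by rewrite (qroot_inv R n_ge2) -exprD; congr (q ^+ _); ring.
Qed.

Lemma act_idem a b s t : M (idem n x y a b) (u ^+ s * v ^+ t) =
  if ((i * s + j * t == a %[mod n]) && (j * s + i * t == b %[mod n]))%N
  then u ^+ s * v ^+ t else 0.
Proof.
set m := u ^+ s * v ^+ t; rewrite idemE actZl act_suml.
transitivity ((n%:R^-1 * n%:R^-1) *:
  (((\sum_(r < n) q ^- (a * r) * q ^+ ((i * s + j * t) * r)) *
   (\sum_(r < n) q ^- (b * r) * q ^+ ((j * s + i * t) * r))) *: m)).
  congr (_ *: _); rewrite mulr_suml scaler_suml; apply: eq_bigr => r _.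
  rewrite act_suml mulr_sumr scaler_suml; apply: eq_bigr => r' _.
  rewrite actZl actM (act_exp r' (act_y_monomial s t)) actZ (act_exp r (act_x_monomial s t)).
  by rewrite -!exprM !scalerA exprD; congr (_ *: _); rewrite invfM; ring.
have nk : n%:R != 0 :> k by rewrite pnatr_eq0 -lt0n.
rewrite !qroot_orth; case: ifP; case: ifP => //= _ _; rewrite ?mul0r ?mulr0 ?scale0r ?scaler0 //.
by rewrite scalerA -invfM mulVf ?mulf_neq0 // scale1r.
Qed.

(** Choose u^s v^t with s <> t of weight (a, b). Apart from idem a b and
    idem b a * z, every element of the spanning set kills it, and these two send
    it to multiples of the distinct monomials u^s v^t and u^t v^s; so both
    coefficients of h vanish. *)
Lemma act_faithful h : (forall a, M h a = 0) -> h = 0.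
Proof.
move=> h0; have [e [d hE]] := pansera_span n_ge2 Hxyz h.
have delta (f : nat -> nat -> k) (X : A) a b : (a < n)%N -> (b < n)%N ->
    \sum_(a' < n) \sum_(b' < n) f a' b' *:
      (if ((a == a' %[mod n]) && (b == b' %[mod n]))%N then X else 0) = f a b *: X.
  move=> an bn; rewrite -(box_sum_delta (fun a' b' => f a' b' *: X) an bn).
  apply: eq_bigr => a' _; apply: eq_bigr => b' _; rewrite !modn_small //.
  by rewrite [a == _]eq_sym [b == _]eq_sym; case: ifP; rewrite ?scaler0.
suff cd a b : (a < n)%N -> (b < n)%N -> e a b = 0 /\ d b a = 0.
  rewrite hE big1 // => a _; rewrite big1 // => b _.
  have [-> _] := cd a b (ltn_ord a) (ltn_ord b); have [_ ->] := cd b a (ltn_ord b) (ltn_ord a).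
  by rewrite !scale0r addr0.
move=> an bn; have [s [t [st wa wb]]] := weight_surj a b.
have [l l0 zst] := act_z_monomial s t.
have := h0 (u ^+ s * v ^+ t); rewrite hE act_suml.
have -> : \sum_(a' < n) M (\sum_(b' < n) (e a' b' *: idem n x y a' b' +
    d a' b' *: (idem n x y a' b' * z))) (u ^+ s * v ^+ t) =
  e a b *: (u ^+ s * v ^+ t) + d b a *: (l *: (u ^+ t * v ^+ s)).
  rewrite -(delta e _ a b) // -(delta d _ b a) // -big_split; apply: eq_bigr => a' _.
  rewrite act_suml -big_split; apply: eq_bigr => b' _ /=.
  rewrite actDl !actZl actM zst actZ !act_idem wa wb [(i * t + _)%N]addnC [(j * t + _)%N]addnC wa wb.
  by congr (_ + _ *: _); case: ifP; rewrite ?scaler0.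
move=> E.
have := congr1 (fun a => qcoef qp a s t) E; have := congr1 (fun a => qcoef qp a t s) E.
rewrite !qcoefD !qcoefZ !qcoef_monomial !qcoef0 !eqxx [t == s]eq_sym (negPf st) /=.
rewrite !mulr1 !mulr0 add0r addr0 => /eqP; rewrite mulf_eq0 (negPf l0) orbF => /eqP -> ->.
by [].
Qed.

End Action.

(** * Polynomials in two variables *)

Section PolynomialEvaluation.
Variable k : fieldType.

Lemma mpoly_ext (A : algType k) (phi phi' : {lrmorphism mpoly 2 k -> A}) :
  (forall i, phi (mpolyX k (mnm1 i)) = phi' (mpolyX k (mnm1 i))) -> phi =1 phi'.
Proof.
move=> pp f; rewrite (mpolyE f) !linear_sum; apply: eq_bigr => m _; rewrite !linearZ.
congr (_ *: _); rewrite mpolyXE_id !rmorph_prod; apply: eq_bigr => i _.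
by rewrite [LHS](rmorphXn phi) [RHS](rmorphXn phi'); congr (_ ^+ _); exact: pp.
Qed.

Lemma prod_ord2 (A : pzRingType) (F : 'I_2 -> A) : \prod_(i < 2) F i = F 0 * F 1.
Proof.
rewrite big_ord_recl big_ord1; congr (_ * F _); exact: val_inj.
Qed.

Lemma mpoly_monomial (m : multinom 2) : mpolyX k m =
  mpolyX k (mnm1 (0 : 'I_2)) ^+ m 0 * mpolyX k (mnm1 (1 : 'I_2)) ^+ m 1.
Proof. by rewrite mpolyXE_id prod_ord2. Qed.

(** Commutation of the two values suffices: A is not commutative. *)
Lemma mpoly_eval (A : algType k) (a b : A) : a * b = b * a ->
  exists phi : {lrmorphism mpoly 2 k -> A}, forall m, phi (mpolyX k m) = a ^+ m 0 * b ^+ m 1.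
Proof.
move=> ab; pose h (i : 'I_2) := if i == 0 then a else b.
pose phi0 : mpoly 2 k -> A := mpoly.mmap (in_alg A) h.
have phiX m : phi0 (mpolyX k m) = a ^+ m 0 * b ^+ m 1.
  by rewrite /phi0 mpoly.mmapX /mpoly.mmap1 prod_ord2.
have phi_lin : linear phi0.
  by move=> l f g; rewrite /phi0 mpoly.mmapD mpoly.mmapZ /= mulr_algl.
pose phi1 : {linear mpoly 2 k -> A} := HB.pack phi0 (GRing.isLinear.Build k (mpoly 2 k) A *:%R phi0 phi_lin).
have phi_mul : GRing.monoid_morphism phi0.
  have one : (1 : mpoly 2 k) = mpolyX k mnm0 by rewrite mpolyX0.
  split=> [|f g]; first by rewrite one phiX !mnm0E mulr1.
  rewrite -[phi0 f]/(phi1 f) -[phi0 g]/(phi1 g) -[LHS]/(phi1 (f * g)).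
  rewrite [in LHS](mpolyE f) [in RHS](mpolyE f) mulr_suml !linear_sum mulr_suml.
  apply: eq_bigr => m _; rewrite -scalerAl !linearZ -[RHS]scalerAl; congr (_ *: _).
  rewrite [in LHS](mpolyE g) [in RHS](mpolyE g) mulr_sumr !linear_sum mulr_sumr.
  apply: eq_bigr => m' _; rewrite -scalerAr !linearZ -[RHS]scalerAr; congr (_ *: _).
  rewrite -mpolyXD [LHS]phiX [phi1 _](phiX m) [X in _ = _ * X](phiX m') !mnmDE !exprD.
  have bXa s t : b ^+ s * a ^+ t = a ^+ t * b ^+ s.
    by apply: commrX; apply: commr_sym; apply: commrX.
  by rewrite -!mulrA; congr (_ * _); rewrite !mulrA bXa.
pose phi : {lrmorphism mpoly 2 k -> A} := HB.pack phi0
  (GRing.isLinear.Build k (mpoly 2 k) A *:%R phi0 phi_lin)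
  (GRing.isMonoidMorphism.Build (mpoly 2 k) A phi0 phi_mul).
by exists phi.
Qed.

Lemma perm2 (s : 'S_2) : s = (perm_one _) \/ s = tperm 0 1.
Proof.
have s01 : s 0 != s 1 by rewrite (inj_eq (@perm_inj _ s)).
case: (ord2 (s 0)) (ord2 (s 1)) s01 => s0 [s1|s1]; rewrite s0 s1 // => _.
- by left; apply/permP => x; rewrite perm1; case: (ord2 x) => ->.
- by right; apply/permP => x; case: (ord2 x) => ->; rewrite ?tpermL ?tpermR.
Qed.

End PolynomialEvaluation.

(** * The fixed ring *)

Section FixedRing.
Variable R : realType.
Local Notation k := R[i].
Variables (n : nat) (n_ge2 : (2 <= n)%N).
Variables (H : algType k) (hH : hopf H) (x y z : H) (Hxyz : pansera n hH x y z).
Variables (A : algType k) (M : module_algebra hH A) (i j : nat) (u v : A).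
Hypothesis M_pi : acts_by_pi n x y z M i j u v.
Variable c : k.
Hypotheses (qp : qplane u v c) (c_nn : c ^+ (n * n) = 1).
Hypothesis coprime_ij : coprimez (i%:Z ^+ 2 - j%:Z ^+ 2) n%:Z.
Local Notation q := (qroot R n).
Local Notation U := (u ^+ n).
Local Notation V := (v ^+ n).

Let n_gt0 : (0 < n)%N := ltnW n_ge2.

(** The scalar with z U = eps V, namely q^(i j n (n - 1) / 2). *)
Definition eps : k := if odd n then 1 else (-1) ^+ (i * j).

Lemma eps_sqr : eps * eps = 1.
Proof. by rewrite /eps; case: ifP => _; rewrite ?mulr1 // -expr2 sqrr_sign. Qed.

Lemma qroot_half m : n = m.*2 -> q ^+ m = -1.
Proof.
move=> nE; have : q ^+ m ^+ 2 == 1 by rewrite -exprM muln2 -nE qroot_expn.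
rewrite sqrf_eq1 (qroot_eq1 R n_ge2) => /orP[/dvdn_leq|/eqP //].
by rewrite nE -addnn; lia.
Qed.

(** For n odd, n divides n (n - 1) / 2; for n = 2 m the exponent is an odd
    multiple of i j m, and q^m = -1. *)
Lemma epsE : q ^+ (i * j * 'C(n, 2)) = eps.
Proof.
rewrite /eps; case: ifP => n_odd.
  rewrite (bin2odd n_odd) mulnCA exprM qroot_expn // expr1n //.
have [m nE] : exists m, n = m.*2 by exists n./2; rewrite -[LHS]odd_double_half n_odd.
have -> : 'C(n, 2) = (m * n.-1)%N by rewrite bin2 nE -!muln2 mulnAC muln2 doubleK.
rewrite mulnCA exprM (qroot_half nE) mulnC exprM; congr (_ ^+ _).
by rewrite -signr_odd nE -subn1 oddB ?odd_double // double_gt0; case: m nE => // E; lia.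
Qed.

Lemma act_z_U : M z U = eps *: V.
Proof.
rewrite (act_z_u n_ge2 Hxyz M_pi); congr (_ *: _).
by rewrite binS bin1 mulnDr exprD epsE mulnC exprM qroot_expn // expr1n mulr1.
Qed.

Lemma act_z_V : M z V = eps *: U.
Proof. by rewrite (act_z_v n_ge2 Hxyz M_pi) epsE. Qed.

Lemma UV_comm : U * V = V * U.
Proof. by rewrite (vXuX qp) c_nn scale1r. Qed.

Lemma act_x_UV s t : M x (U ^+ s * V ^+ t) = U ^+ s * V ^+ t.
Proof.
rewrite -!exprM (act_x_monomial Hxyz M_pi).
have -> : (i * (n * s) + j * (n * t) = n * (i * s + j * t))%N by ring.
by rewrite exprM qroot_expn // expr1n scale1r.
Qed.

Lemma act_y_UV s t : M y (U ^+ s * V ^+ t) = U ^+ s * V ^+ t.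
Proof.
rewrite -!exprM (act_y_monomial Hxyz M_pi).
have -> : (j * (n * s) + i * (n * t) = n * (j * s + i * t))%N by ring.
by rewrite exprM qroot_expn // expr1n scale1r.
Qed.

(** When the weights are trivial so is the twist J. *)
Lemma act_zM0 a b : M x (M z a) = M z a -> M y (M z b) = M z b ->
  M z (a * b) = M z a * M z b.
Proof.
move=> xa yb; rewrite (@act_zM _ _ n_ge2 _ _ _ _ _ Hxyz _ _ 0 0) ?expr0 ?scale1r //.
Qed.

(** z U = eps V and z (eps V) = U, and all elements here have weight zero. *)
Lemma act_z_UVX s t : M z (U ^+ s * (eps *: V) ^+ t) = U ^+ t * (eps *: V) ^+ s.
Proof.
have xV r : M x ((eps *: V) ^+ r) = (eps *: V) ^+ r.
  by have := act_x_UV 0 r; rewrite expr0 mul1r exprZn actZ => ->.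
have yV r : M y ((eps *: V) ^+ r) = (eps *: V) ^+ r.
  by have := act_y_UV 0 r; rewrite expr0 mul1r exprZn actZ => ->.
have xU r : M x (U ^+ r) = U ^+ r by have := act_x_UV r 0; rewrite expr0 mulr1.
have yU r : M y (U ^+ r) = U ^+ r by have := act_y_UV r 0; rewrite expr0 mulr1.
have zU r : M z (U ^+ r) = (eps *: V) ^+ r.
  elim: r => [|r IH]; first exact: (act_z1 Hxyz M).
  by rewrite exprS act_zM0 ?act_z_U ?IH -?exprS // -[eps *: V]expr1 xV.
have zV r : M z ((eps *: V) ^+ r) = U ^+ r.
  have zV1 : M z (eps *: V) = U by rewrite actZ act_z_V scalerA eps_sqr scale1r.
  elim: r => [|r IH]; first exact: (act_z1 Hxyz M).
  by rewrite exprS act_zM0 ?zV1 ?IH -?exprS // -[U]expr1 xU.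
rewrite act_zM0 ?zU ?zV //; apply: commrX; apply: commr_sym; apply: commrX.
by rewrite /GRing.comm -scalerAl -scalerAr UV_comm.
Qed.

Lemma fixedE a : (a \in fixed M) <-> [/\ M x a = a, M y a = a & M z a = a].
Proof.
split=> [/fixedP Fa|[xa ya za]].
  by rewrite !Fa (counit_x Hxyz) (counit_y Hxyz) (counit_z Hxyz) scale1r.
have cM g h : counit hH (g * h) = (counit hH g : k) * (counit hH h : k) by exact: (rmorphM (counit hH)).
apply/fixedP; apply: (pansera_ind Hxyz) => [|h IH|h IH|h IH|l g h IHg IHh].
- by rewrite act1 (rmorph1 (counit hH)) scale1r.
- by rewrite actM IH actZ xa cM (counit_x Hxyz) mul1r.
- by rewrite actM IH actZ ya cM (counit_y Hxyz) mul1r.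
- by rewrite actM IH actZ za cM (counit_z Hxyz) mul1r.
- have cE : counit hH (l *: g + h) = l * (counit hH g : k) + (counit hH h : k).
    by exact: (linearP (counit hH)).
  by rewrite actDl actZl IHg IHh cE scalerDl scalerA.
Qed.

Local Notation X0 := (mpolyX k (mnm1 (0 : 'I_2))).
Local Notation X1 := (mpolyX k (mnm1 (1 : 'I_2))).

(** The elements fixed by x and y form the polynomial ring k[U, eps V], the image
    of the evaluation psi. *)
Section GroupFixed.
Variable psi : {lrmorphism mpoly 2 k -> A}.
Hypothesis psiX : forall m, psi (mpolyX k m) = U ^+ m 0 * (eps *: V) ^+ m 1.

Lemma psiZ l f : psi (l *: f) = l *: psi f. Proof. exact: (linearZZ psi). Qed.

Lemma psi_sum f : psi f = \sum_(m <- msupp f) (mcoeff m f * eps ^+ m 1) *: (u ^+ (n * m 0%R) * v ^+ (n * m 1%R)).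
Proof.
rewrite [f in LHS]mpolyE linear_sum; apply: eq_bigr => m _.
by rewrite [LHS]psiZ psiX exprZn -scalerAr scalerA -!exprM.
Qed.

Lemma psi_eq0 (f : mpoly 2 k) : psi f = 0 -> f = 0.
Proof.
move=> f0; apply/eqP; rewrite -msupp_eq0; apply/negPn/negP => supp_f.
have [m m_f] : exists m, m \in msupp f.
  by case: (msupp f) supp_f => // m s _; exists m; rewrite mem_head.
have := congr1 (fun a => qcoef qp a (n * m 0%R) (n * m 1%R)) f0.
rewrite psi_sum qcoef0 qcoef_sum (bigD1_seq m) ?msupp_uniq //= qcoefZ qcoef_monomial !eqxx mulr1.
rewrite big1 ?addr0 => [/eqP|m' m'm].
  rewrite mulf_eq0 expf_eq0 mcoeff_eq0 m_f /= => /andP[_ /eqP eps0].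
  by have /eqP := eps_sqr; rewrite eps0 mul0r eq_sym oner_eq0.
rewrite qcoefZ qcoef_monomial !eqn_pmul2l //.
case: eqP => [m0|]; case: eqP => [m1|]; rewrite ?mulr0 //=.
case/eqP: m'm; apply/mnmP => t; by have [->|->] := ord2 t.
Qed.

Lemma psi_inj : injective psi.
Proof. by apply: raddf_inj; exact: psi_eq0. Qed.

(** An element fixed by x and y involves only monomials of weight zero, and the
    weight of u^s v^t is zero only if n divides s and t. *)
Lemma psi_surj a : M x a = a -> M y a = a -> exists f, psi f = a.
Proof.
move=> xa ya; pose N := qcoef_bound qp a.
have eigen g w : (forall s t, M g (u ^+ s * v ^+ t) = q ^+ w s t *: (u ^+ s * v ^+ t)) ->
    M g a = a -> forall s t, q ^+ w s t * qcoef qp a s t = qcoef qp a s t.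
  move=> gE ga s t; symmetry; apply: (@qcoef_uniq _ _ _ _ _ qp a N (fun s t => q ^+ w s t * qcoef qp a s t)) => [s' t' st|].
    by rewrite (qcoef_box (qp := qp)) ?mulr0.
  rewrite -[LHS]ga [in LHS](qcoefK (leqnn N)) act_sum; apply: eq_bigr => s' _.
  by rewrite act_sum; apply: eq_bigr => t' _; rewrite actZ gE scalerA mulrC.
have xqcoef := eigen _ _ (act_x_monomial Hxyz M_pi) xa.
have yqcoef := eigen _ _ (act_y_monomial Hxyz M_pi) ya.
have im_sum (I : Type) (r : seq I) (F : I -> A) : (forall t, exists f, psi f = F t) ->
    exists f, psi f = \sum_(t <- r) F t.
  move=> FP; elim: r => [|t r [f fE]]; first by exists 0; rewrite big_nil; exact: (raddf0 psi).
  by have [g gE] := FP t; exists (g + f); rewrite big_cons -fE -gE; exact: (raddfD psi).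
rewrite (qcoefK (leqnn N)); apply: (im_sum) => s; apply: (im_sum) => t.
have [->|ast] := eqVneq (qcoef qp a s t) 0; first by exists 0; rewrite scale0r; exact: (raddf0 psi).
have xw : (n %| i * s + j * t)%N.
  by rewrite -(qroot_eq1 R n_ge2) -(inj_eq (mulIf ast)) xqcoef mul1r.
have yw : (n %| j * s + i * t)%N.
  by rewrite -(qroot_eq1 R n_ge2) -(inj_eq (mulIf ast)) yqcoef mul1r.
have [/dvdnP[s' sE] /dvdnP[t' tE]] := weight_zero coprime_ij xw yw.
exists ((qcoef qp a s t * eps ^+ t') *: mpolyX k (mnm_add (mnm_muln (mnm1 0) s') (mnm_muln (mnm1 1) t'))).
rewrite psiZ psiX !mnmDE !mulmnE !mnm1E /= mul1n mul0n mul0n mul1n addn0 add0n.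
rewrite exprZn -scalerAr scalerA -mulrA -exprMn eps_sqr expr1n mulr1.
by rewrite -!exprM ![(n * _)%N]mulnC -sE -tE.
Qed.

Lemma psi_swap f : M z (psi f) = psi (msym (tperm 0 1) f).
Proof.
have psiS (F : multinom 2 -> mpoly 2 k) :
    psi (\sum_(m <- msupp f) mcoeff m f *: F m) = \sum_(m <- msupp f) mcoeff m f *: psi (F m).
  by rewrite [LHS](raddf_sum psi); apply: eq_bigr => m _; exact: psiZ.
have fE : msym (tperm 0 1) f =
    \sum_(m <- msupp f) mcoeff m f *: msym (tperm 0 1) (mpolyX k m).
  rewrite [in LHS](mpolyE f) [LHS](raddf_sum (msym (tperm 0 1))).
  by apply: eq_bigr => m _; exact: msymZ.
rewrite fE psiS [in LHS](mpolyE f) psiS act_sum; apply: eq_bigr => m _.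
rewrite actZ; congr (_ *: _).
by rewrite psiX act_z_UVX msymX psiX !mnmE tpermV tpermL tpermR.
Qed.

End GroupFixed.

(** In k[U, eps V] the action of z is the exchange of the two variables, so the
    fixed ring is the ring of symmetric polynomials, freely generated by
    U + eps V and eps U V. The substitution theta, which rescales the second
    variable by eps, replaces eps U V by U V. *)
Theorem fixed_polynomial_ring :
  is_polynomial_ring (fixed M) (U + eps *: V) (U * V).
Proof.
have UVc : U * (eps *: V) = (eps *: V) * U by rewrite -scalerAl -scalerAr UV_comm.
have [psi psiX] := mpoly_eval UVc.
have psiU : psi X0 = U by rewrite psiX !mnm1E /= expr1 expr0 mulr1.
have psiV : psi X1 = eps *: V by rewrite psiX !mnm1E /= expr1 expr0 mul1r.
have X01 : X0 * (eps *: X1) = (eps *: X1) * X0 by exact: mulrC.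
have [theta thetaX] := mpoly_eval X01.
have theta0 : theta X0 = X0 by rewrite thetaX !mnm1E /= expr1 expr0 mulr1.
have theta1 : theta X1 = eps *: X1 by rewrite thetaX !mnm1E /= expr1 expr0 mul1r.
have thetaK : cancel theta theta.
  pose idm : {lrmorphism mpoly 2 k -> mpoly 2 k} := idfun.
  apply: (@mpoly_ext _ _ (theta \o theta)%FUN idm) => l /=.
  have [->|->] := ord2 l; first by rewrite !theta0.
  rewrite [LHS](congr1 theta theta1) [LHS](linearZZ theta) [X in _ *: X]theta1.
  by rewrite scalerA eps_sqr scale1r.
pose S := [tuple mesym 2 k t.+1 | t < 2].
pose phi : {lrmorphism mpoly 2 k -> A} := (psi \o (comp_mpoly S \o theta))%FUN.
have S0 : comp_mpoly S X0 = X0 + X1.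
  rewrite comp_mpolyXU -tnth_nth tnth_mktuple mesym1E big_ord_recl big_ord1.
  by congr (_ + mpolyX _ (mnm1 _)); exact: val_inj.
have S1 : comp_mpoly S X1 = X0 * X1.
  by rewrite comp_mpolyXU -tnth_nth tnth_mktuple (mesymnnE 2) prod_ord2.
exists phi; split.
- rewrite /phi /= theta0 S0 [LHS](raddfD psi); exact: (congr2 +%R psiU psiV).
- rewrite /phi /= theta1 comp_mpolyZ S1 [LHS](psiZ psi).
  rewrite [LHS](congr1 _ (etrans (rmorphM psi _ _) (congr2 *%R psiU psiV))).
  by rewrite -scalerAr scalerA eps_sqr scale1r.
- by move=> f g /(psi_inj psiX)/msym_fundamental_un/(can_inj thetaK).
- move=> a; rewrite fixedE; split=> [[xa ya za]|[f <-]].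
    have [f fE] := psi_surj psiX xa ya.
    have f_sym : f \is symmetric.
      apply/issymP => s; have [->|->] := perm2 s; first exact: msym1m.
      by apply: (psi_inj psiX); rewrite -(psi_swap psiX) fE.
    have [g [gE _]] := sym_fundamental f_sym; exists (theta g).
    by rewrite /phi /= thetaK gE.
  have fixpsi g : M x (psi g) = psi g /\ M y (psi g) = psi g.
    by rewrite (psi_sum psiX) !act_sum; split; apply: eq_bigr => m _;
      rewrite actZ !exprM ?act_x_UV ?act_y_UV.
  have [fx fy] := fixpsi (comp_mpoly S (theta f)).
  have /issymP sym : comp_mpoly S (theta f) \is symmetric.
    by apply: mcomp_sym => l; rewrite -tnth_nth tnth_map; exact: mesym_sym.
  have fz := psi_swap psiX (comp_mpoly S (theta f)).
  by split; [exact: fx|exact: fy|exact: etrans fz (congr1 psi (sym _))].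
Qed.

End FixedRing.

(** * The fixed ring as a quantum plane *)

Section PolynomialSubalgebra.
Variable k : fieldType.

Definition mnm_pair (i j : nat) : multinom 2 :=
  mnm_add (mnm_muln (mnm1 (0 : 'I_2)) i) (mnm_muln (mnm1 (1 : 'I_2)) j).

Lemma mnm_pairE i j : (mnm_pair i j 0 = i) * (mnm_pair i j 1 = j).
Proof. by rewrite /mnm_pair !mnmDE !mulmnE !mnm1E /= !mul1n !mul0n addn0 add0n. Qed.

Lemma mnm_pair_eq i j m : (mnm_pair i j == m) = (i == m 0) && (j == m 1).
Proof.
apply/eqP/andP=> [<-|[/eqP -> /eqP ->]]; first by rewrite !mnm_pairE !eqxx.
apply/mnmP => l; have [->|->] := ord2 l.
- exact: (mnm_pairE _ _).1.
- exact: (mnm_pairE _ _).2.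
Qed.

(** Polynomials as sums over a square of exponents, the format of the basis
    property qplane. *)
Definition box_poly N (e : nat -> nat -> k) : mpoly 2 k :=
  \sum_(i < N) \sum_(j < N) e i j *: mpolyX k (mnm_pair i j).

Lemma box_poly_coef N e m : mcoeff m (box_poly N e) =
  if (m 0%R < N)%N && (m 1%R < N)%N then e (m 0%R) (m 1%R) else 0.
Proof.
have termE i j : mcoeff m (e i j *: mpolyX k (mnm_pair i j)) =
    e i j *+ ((i == m 0%R) && (j == m 1%R)).
  by rewrite mcoeffZ mcoeffX mnm_pair_eq mulr_natr.
rewrite /box_poly raddf_sum.
have -> : \sum_(i < N) mcoeff m (\sum_(j < N) e i j *: mpolyX k (mnm_pair i j)) =
    \sum_(i < N) \sum_(j < N) e i j *+ ((i == m 0%R :> nat) && (j == m 1%R :> nat)).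
  by apply: eq_bigr => i _; rewrite raddf_sum; apply: eq_bigr => j _; exact: termE.
case: ifP => [/andP[m0 m1]|out]; first exact: box_sum_delta.
rewrite big1 // => i _; rewrite big1 // => j _; case: andP => // -[/eqP im /eqP jm].
by rewrite -im -jm !ltn_ord in out.
Qed.

Lemma box_polyK (g : mpoly 2 k) : exists N, g = box_poly N (fun i j => mcoeff (mnm_pair i j) g).
Proof.
exists (msize g); apply/mpolyP => m; rewrite box_poly_coef.
have -> : mnm_pair (m 0%R) (m 1%R) = m by apply/eqP; rewrite mnm_pair_eq !eqxx.
case: ifP => // /negP out; apply/eqP; rewrite mcoeff_eq0; apply/negP => m_g; apply: out.
have lt_m : (mdeg m < msize g)%N := msize_mdeg_lt m_g.
have le_m l : (m l <= mdeg m)%N by rewrite mdegE (bigD1 l) //= leq_addr.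
by rewrite !(leq_ltn_trans (le_m _) lt_m).
Qed.

(** A polynomial ring is the quantum plane with parameter 1, whence its
    homological properties. *)
Lemma polynomial_qplane (A B : algType k) (f : {lrmorphism B -> A}) (P : {pred A}) (s t : B) :
  injective f -> (forall b, f b \in P) -> is_polynomial_ring P (f s) (f t) -> qplane s t 1.
Proof.
move=> f_inj fP [phi [phi0 phi1 phi_inj phiP]].
have fXY i j : f (s ^+ i * t ^+ j) = phi (mpolyX k (mnm_pair i j)).
  rewrite mpoly_monomial !mnm_pairE [LHS]rmorphM [RHS]rmorphM; congr (_ * _).
    by rewrite [LHS](rmorphXn f) [RHS](rmorphXn phi); congr (_ ^+ _); exact: esym phi0.
  by rewrite [LHS](rmorphXn f) [RHS](rmorphXn phi); congr (_ ^+ _); exact: esym phi1.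
have f_box N e : f (monomial_sum s t N e) = phi (box_poly N e).
  rewrite raddf_sum [RHS](raddf_sum phi); apply: eq_bigr => i _.
  rewrite raddf_sum [RHS](raddf_sum phi); apply: eq_bigr => j _.
  by rewrite [RHS](linearZZ phi) [LHS](linearZZ f); congr (_ *: _); exact: fXY.
split; first exact: oner_neq0.
- apply: f_inj; rewrite scale1r [LHS]rmorphM [RHS]rmorphM.
  have st : f s * f t = f t * f s.
    by rewrite -phi0 -phi1 -[LHS](rmorphM phi) -[RHS](rmorphM phi) mulrC.
  exact: esym st.
- move=> b; have [g gE] := (phiP (f b)).1 (fP b); have [N gN] := box_polyK g.
  exists N, (fun i j => mcoeff (mnm_pair i j) g); apply: f_inj.
  by rewrite f_box -gE; congr (phi _).
- move=> N e e0 i j iN jN.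
  have : box_poly N e = 0.
    by apply: phi_inj; rewrite -f_box e0 raddf0; symmetry; exact: (raddf0 phi).
  move=> /(congr1 (mcoeff (mnm_pair i j))); rewrite box_poly_coef !mnm_pairE iN jN /= => ->.
  exact: mcoeff0.
Qed.

Lemma fixed_val_lrmorphism (H : algType k) (hH : hopf H) (A : algType k)
    (M : module_algebra hH A) :
  exists f : {lrmorphism fixed_alg M -> A}, forall b, f b = fixed_val b.
Proof.
pose f : fixed_alg M -> A := \val.
have f_lin : linear f by exact: linearP.
have f_mul : GRing.monoid_morphism f by split=> // a b; exact: rmorphM.
pose f' : {lrmorphism fixed_alg M -> A} := HB.pack f
  (GRing.isLinear.Build k _ A *:%R f f_lin) (GRing.isMonoidMorphism.Build _ A f f_mul).
by exists f'.
Qed.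

End PolynomialSubalgebra.

Section Reflection.
Variable R : realType.
Local Notation k := R[i].
Variables (n : nat) (n_ge2 : (2 <= n)%N).
Variables (H : algType k) (hH : hopf H) (x y z : H) (Hxyz : pansera n hH x y z).
Variables (A : algType k) (M : module_algebra hH A) (i j : nat) (u v : A).
Hypothesis M_pi : acts_by_pi n x y z M i j u v.
Variable c : k.
Hypotheses (qp : qplane u v c) (c_nn : c ^+ (n * n) = 1).
Hypothesis coprime_ij : coprimez (i%:Z ^+ 2 - j%:Z ^+ 2) n%:Z.

Let n_gt0 : (0 < n)%N := ltnW n_ge2.

(** The grading induced from A puts U + eps V and U V in degrees n and 2 n. That
    it is the whole grading of the polynomial ring follows from qgr_reflect
    applied to the inclusion. *)
Lemma fixed_ring_AS_regular : AS_regular (fixed_grading (M := M) (qgr qp 1 1)) 2.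
Proof.
have poly := fixed_polynomial_ring n_ge2 Hxyz M_pi qp c_nn coprime_ij.
pose s := u ^+ n + eps R n i j *: v ^+ n; pose t := u ^+ n * v ^+ n.
have sF : s \in fixed M.
  by case: poly => phi [s_phi _ _ ->]; exists (mpolyX k (mnm1 0)).
have tF : t \in fixed M.
  by case: poly => phi [_ t_phi _ ->]; exists (mpolyX k (mnm1 1)).
have [f fE] := fixed_val_lrmorphism M.
have f_inj : injective f by move=> a b; rewrite !fE; exact: val_inj.
have [fs ft] : f (FixedAlg sF) = s /\ f (FixedAlg tF) = t by rewrite !fE.
have qp' : qplane (FixedAlg sF) (FixedAlg tF) 1.
  apply: (@polynomial_qplane _ _ _ f (fixed M)) => // [b|]; last by rewrite fs ft.
  by rewrite fE; exact: fixed_valP.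
have s_gr : qgr qp 1 1 n s.
  have gu : qgr qp 1 1 n (u ^+ n).
    by have := @qgr_monomial _ _ _ _ _ qp 1 1 n 0; rewrite /qdeg !muln1 addn0 expr0 mulr1.
  have gv : qgr qp 1 1 n (v ^+ n).
    by have := @qgr_monomial _ _ _ _ _ qp 1 1 0 n; rewrite /qdeg !muln1 add0n expr0 mul1r.
  by apply: qgrD => //; apply: qgrZ.
have t_gr : qgr qp 1 1 (2 * n)%N t.
  by have := @qgr_monomial _ _ _ _ _ qp 1 1 n n; rewrite /qdeg !muln1 addnn mul2n.
have X_gr (a : A) d m : qgr qp 1 1 (Posz d) a -> qgr qp 1 1 (Posz (m * d)) (a ^+ m).
  move=> ga; elim: m => [|m IH]; last by rewrite exprS mulSn PoszD; exact: qgrM.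
  by rewrite mul0n; apply/qgr_scalar => //; exists 1; rewrite scale1r.
have gr_sub m b : qgr qp' n (2 * n) m b -> qgr qp 1 1 m (f b).
  move=> gb; rewrite (qcoefK (leqnn (qcoef_bound qp' b))) raddf_sum.
  apply: qgr_sum => // r _; rewrite raddf_sum; apply: qgr_sum => // r' _.
  have [->|/eqP brr] := eqVneq (qcoef qp' b r r') 0.
    by rewrite scale0r raddf0; exact: qgr0.
  rewrite (gb _ _ brr) [X in qgr _ _ _ _ X](linearZZ f); apply: qgrZ.
  rewrite [X in qgr _ _ _ _ X](rmorphM f) /qdeg PoszD; apply: qgrM => //.
    by rewrite [X in qgr _ _ _ _ X](rmorphXn f) [X in X ^+ _]fs; exact: X_gr.
  by rewrite [X in qgr _ _ _ _ X](rmorphXn f) [X in X ^+ _]ft; exact: X_gr.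
have -> : fixed_grading (M := M) (qgr qp 1 1) = qgr qp' n (2 * n).
  apply/funext => m; apply/seteqP; rewrite /fixed_grading.
  split=> b /=; rewrite -fE; last exact: gr_sub.
  have gr_A : graded_by (qgr qp 1 1) by exact: qgr_graded.
  exact: (@qgr_reflect _ _ _ _ _ n (2 * n) qp' n_gt0 _ _ f gr_A f_inj gr_sub m b).
by apply: qp_AS_regular; rewrite ?muln_gt0.
Qed.

End Reflection.

Theorem theorem3p10 (R : realType) (n i j : nat)
    (n_ge2 : (2 <= n)%N) (lt_ij : (i < j)%N) (le_jn : (j <= n - 1)%N)
    (coprime_ij : coprimez (i%:Z ^+ 2 - j%:Z ^+ 2) n%:Z)
    (H : algType R[i]) (hH : hopf H) (x y z : H) (Hxyz : pansera n hH x y z)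
    (A : algType R[i]) (u v : A)
    (Auv : presented
      (quantum_plane_rels (proot R n ^ (i%:Z ^+ 2 - j%:Z ^+ 2)))
      (tnth [tuple u; v]))
    (M : module_algebra hH A) (M_pi : acts_by_pi n x y z M i j u v) :
  is_polynomial_ring (fixed M)
    (if odd n then u ^+ n + v ^+ n else u ^+ n + (-1) ^+ (i * j) *: v ^+ n)
    (u ^+ n * v ^+ n)
  /\ reflection_hopf (word_grading (tnth [tuple u; v])) M.
Proof.
set e := i%:Z ^+ 2 - j%:Z ^+ 2 in coprime_ij Auv *.
have c_neq0 : proot R n ^ e != 0 by rewrite expfz_neq0 ?proot_neq0.
(* p^n = (-1)^(n+1) and n (n + 1) is even *)
have c_nn : (proot R n ^ e) ^+ (n * n) = 1.
  rewrite -[LHS]/((proot R n ^ e) ^ (n * n)%N) exprzAC -[proot R n ^ _]/(proot R n ^+ _).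
  rewrite exprM proot_expn // -exprM -signr_odd oddM /=.
  by case: (odd n); rewrite ?expr0 ?exp1rz.
have qp := pres_qplane c_neq0 Auv.
split.
  have -> : (if odd n then u ^+ n + v ^+ n else u ^+ n + (-1) ^+ (i * j) *: v ^+ n) =
      u ^+ n + eps R n i j *: v ^+ n.
    by rewrite /eps; case: ifP; rewrite ?scale1r.
  exact: (fixed_polynomial_ring n_ge2 Hxyz M_pi qp c_nn coprime_ij).
rewrite (word_gradingE Auv qp); split.
- exact: (pansera_semisimple n_ge2 Hxyz).
- by exists 2%N; exact: qp_AS_regular.
- move=> I _ I0 h Ih; apply: (act_faithful n_ge2 Hxyz M_pi qp coprime_ij) => a.
  exact: I0.
- by move=> h m a; exact: (act_preserves_degree n_ge2 Hxyz M_pi).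
- by exists 2%N; exact: (fixed_ring_AS_regular n_ge2 Hxyz M_pi qp c_nn coprime_ij).
Qed.
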